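(* Let $\Phi=\{\varphi_i\}_{i=1}^K$ be a homogeneous IFS on $\mathbb R^d$ with common contraction ratio $r\in(0,1)$ satisfying the strong separation condition, and let $\mu$ be the Gibbs measure on $\Sigma=\{1,\dots,K\}^{\mathbb N}$ of a Hölder continuous potential that is not cohomologous to a constant. For $\varepsilon>0$ let $\psi_\varepsilon^{\pm}:\mathbb N\to[0,\infty)$ be $$\psi_\varepsilon^{+}(n)=\frac{\log n}{h_\mu}+\frac{1+\varepsilon}{h_\mu^{3/2}}\sqrt{2\rho_\mu\log n\log\log\log n},\qquad \psi_\varepsilon^{-}(n)=\frac{\log n}{h_\mu}+\frac{1-\varepsilon}{h_\mu^{3/2}}\sqrt{2\rho_\mu\log n\log\log\log n}.$$ Then for every $\varepsilon>0$, $\pi^*\mu(\tilde R_{\psi_\varepsilon^+})=0$ and $\pi^*\mu(\tilde R_{\psi_\varepsilon^-})=1$.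
   Context: A contracting similarity is a map $\varphi:\mathbb R^d\to\mathbb R^d$ with $\|\varphi(x)-\varphi(y)\|=r\|x-y\|$, $r\in(0,1)$; a homogeneous IFS is a finite set $\{\varphi_i\}_{i=1}^K$ of such maps with common ratio $r$; its self-similar set is the unique nonempty compact $X$ with $X=\bigcup_i\varphi_i(X)$. The coding map is $\pi(\mathbf i)=\lim_n\varphi_{i_1}\circ\cdots\circ\varphi_{i_n}(0)$ and $\pi^*\mu=\mu\circ\pi^{-1}$. Strong separation condition: $\varphi_i(X)\cap\varphi_j(X)=\emptyset$ for $i\ne j$; then $T:X\to X$, $T(x)=\varphi_i^{-1}(x)$ for $x\in\varphi_i(X)$. For $\psi:\mathbb N\to[0,\infty)$, $\tilde R_\psi=\{x\in X:\|T^n(x)-x\|\le r^{\psi(n)}\text{ for infinitely many }n\}$. On $\Sigma$ with left shift $\sigma$ and $|\mathbf i\wedge\mathbf j|=\inf\{n\ge0:i_{n+1}\ne j_{n+1}\}$: $f:\Sigma\to\mathbb R$ is Hölder continuous if $|f(\mathbf i)-f(\mathbf j)|\le b\alpha^{|\mathbf i\wedge\mathbf j|}$ for some $b>0,0<\alpha<1$; $P(f)=\lim_n\frac1n\log\sum_{w\in\{1..K\}^n}\sup_{\mathbf j\in[w]}e^{\sum_{k=0}^{n-1}f(\sigma^k\mathbf j)}$; the Gibbs measure of $f$ is the unique $\sigma$-invariant ergodic probability $\mu$ with $C^{-1}\le\mu([i_1\dots i_n])/\exp(-nP(f)+\sum_{k=0}^{n-1}f(\sigma^k\mathbf i))\le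 C$ for some $C>1$ and all $\mathbf i,n$. $h_\mu=\lim_n-\frac1n\sum_{|w|=n}\mu([w])\log\mu([w])$, $\rho_\mu=\lim_n\frac1n\int(\sum_{k=0}^{n-1}f\circ\sigma^k-n\int fd\mu)^2d\mu$. Cohomologous to a constant: $f=g\circ\sigma-g+c$, $g$ continuous, $c$ constant. Convention: $\log x=0$ for $x\le1$. *)

(* Defs.v *)
From HB Require Import structures.
From mathcomp Require Import all_boot all_order all_algebra.
From mathcomp Require Import all_classical all_reals all_analysis.
Import numFieldNormedType.Exports.
Import Order.TTheory GRing.Theory Num.Theory.

Set Implicit Arguments.
Unset Strict Implicit.
Unset Printing Implicit Defensive.

Local Open Scope classical_set_scope.
Local Open Scope ring_scope.

(* Symbolic space Sigma = {1,...,K}^N with K = m.+1 symbols ('I_m.+1);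
   the sequence i = (i_1, i_2, ...) is stored as i 0, i 1, ... *)
Definition Sig (m : nat) := nat -> 'I_m.+1.
HB.instance Definition _ m := Choice.on (Sig m).
HB.instance Definition _ m := isPointed.Build (Sig m) (fun _ => ord0).

Definition shift (m : nat) (i : Sig m) : Sig m := fun n => i n.+1.

Definition agree (m : nat) (i j : Sig m) (n : nat) : Prop :=
  forall k, (k < n)%N -> i k = j k.

Definition cyl (m n : nat) (w : n.-tuple 'I_m.+1) : set (Sig m) :=
  [set i | forall k : 'I_n, i k = tnth w k].

Definition pcyl (m : nat) (i : Sig m) (n : nat) : set (Sig m) :=
  [set j | agree i j n].

Definition cylinders (m : nat) : set (set (Sig m)) :=
  [set A | exists n (w : n.-tuple 'I_m.+1), A = cyl w].

(* Sigma with the Borel sigma-algebra (generated by cylinders) *)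
Notation SigMeas m := (g_sigma_algebraType (@cylinders m)).

Definition holder (R : realType) (m : nat) (f : Sig m -> R) : Prop :=
  exists b alpha : R, 0 < b /\ 0 < alpha < 1 /\
    forall (i j : Sig m) (n : nat), agree i j n -> `|f i - f j| <= b * alpha ^+ n.

(* continuity for the product topology on Sigma *)
Definition continuous_Sig (R : realType) (m : nat) (g : Sig m -> R) : Prop :=
  forall (i : Sig m) (e : R), 0 < e ->
    exists N : nat, forall j : Sig m, agree i j N -> `|g i - g j| < e.

Definition cohomologous_to_constant (R : realType) (m : nat) (f : Sig m -> R) : Prop :=
  exists (g : Sig m -> R) (c : R), continuous_Sig g /\
    forall i : Sig m, f i = g (shift i) - g i + c.

Definition birkhoff (R : realType) (m : nat) (f : Sig m -> R) (n : nat) (i : Sig m) : R :=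
  \sum_(k < n) f (iter k (@shift m) i).

Definition pressure (R : realType) (m : nat) (f : Sig m -> R) : R :=
  limn (fun n : nat => n%:R^-1 *
    ln (\sum_(w : n.-tuple 'I_m.+1) sup [set expR (birkhoff f n j) | j in cyl w])).

Definition is_gibbs (R : realType) (m : nat) (f : Sig m -> R)
    (mu : probability (SigMeas m) R) : Prop :=
  (forall A : set (SigMeas m), measurable A -> mu ((@shift m) @^-1` A) = mu A) /\
  (forall A : set (SigMeas m), measurable A -> (@shift m) @^-1` A = A ->
      mu A = 0%E \/ mu A = 1%E) /\
  exists C : R, 1 < C /\ forall (n : nat) (i : Sig m),
    ((C^-1 * expR (- (n%:R * pressure f) + birkhoff f n i))%:E <= mu (pcyl i n))%E /\
    (mu (pcyl i n) <= (C * expR (- (n%:R * pressure f) + birkhoff f n i))%:E)%E.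

Definition entropy (R : realType) (m : nat) (mu : probability (SigMeas m) R) : R :=
  limn (fun n : nat => - (n%:R^-1 *
    \sum_(w : n.-tuple 'I_m.+1) fine (mu (cyl w)) * ln (fine (mu (cyl w))))).

Definition asvar (R : realType) (m : nat) (f : Sig m -> R)
    (mu : probability (SigMeas m) R) : R :=
  limn (fun n : nat => n%:R^-1 *
    fine (\int[mu]_x ((birkhoff f n x - n%:R * fine (\int[mu]_y (f y)%:E)) ^+ 2)%:E)).

Definition enorm (R : realType) (d : nat) (x : 'rV[R]_d) : R :=
  Num.sqrt (\sum_(j < d) x ord0 j ^+ 2).

Definition similarity (R : realType) (d : nat) (g : 'rV[R]_d -> 'rV[R]_d) (r : R) : Prop :=
  forall x y, enorm (g x - g y) = r * enorm (x - y).

Definition homogeneous_IFS (R : realType) (d m : nat)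
    (phi : 'I_m.+1 -> 'rV[R]_d -> 'rV[R]_d) (r : R) : Prop :=
  0 < r < 1 /\ forall i, similarity (phi i) r.

Definition self_similar_set (R : realType) (d m : nat)
    (phi : 'I_m.+1 -> 'rV[R]_d -> 'rV[R]_d) (X : set 'rV[R]_d) : Prop :=
  X !=set0 /\ compact X /\ X = \bigcup_(i in [set: 'I_m.+1]) (phi i @` X).

Definition SSC (R : realType) (d m : nat)
    (phi : 'I_m.+1 -> 'rV[R]_d -> 'rV[R]_d) (X : set 'rV[R]_d) : Prop :=
  forall i j, i != j -> phi i @` X `&` phi j @` X = set0.

Fixpoint compn (R : realType) (d m : nat)
    (phi : 'I_m.+1 -> 'rV[R]_d -> 'rV[R]_d) (n : nat) (i : Sig m) (x : 'rV[R]_d)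
    : 'rV[R]_d :=
  match n with
  | 0 => x
  | k.+1 => phi (i 0%N) (compn phi k (shift i) x)
  end.

Definition coding (R : realType) (d m : nat)
    (phi : 'I_m.+1 -> 'rV[R]_d -> 'rV[R]_d) (i : Sig m) : 'rV[R]_d :=
  limn (fun n => compn phi n i 0).

(* T x = phi_i^{-1}(x) for x in phi_i(X) (well defined under SSC) *)
Definition Tmap (R : realType) (d m : nat)
    (phi : 'I_m.+1 -> 'rV[R]_d -> 'rV[R]_d) (X : set 'rV[R]_d) (x : 'rV[R]_d)
    : 'rV[R]_d :=
  xget x [set y | X y /\ exists i, phi i y = x].

Definition Rtilde (R : realType) (d m : nat)
    (phi : 'I_m.+1 -> 'rV[R]_d -> 'rV[R]_d) (X : set 'rV[R]_d) (r : R)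
    (psi : nat -> R) : set 'rV[R]_d :=
  [set x | X x /\ forall N : nat, exists n : nat, (N <= n)%N /\
      enorm (iter n (Tmap phi X) x - x) <= r `^ (psi n)].

Definition Log (R : realType) (x : R) : R := if x <= 1 then 0 else ln x.

(* psi(n) = log n / h + s / h^{3/2} sqrt(2 rho log n logloglog n);
   psi_eps^+ has s = 1 + eps, psi_eps^- has s = 1 - eps *)
Definition psi (R : realType) (h rho s : R) (n : nat) : R :=
  Log (n%:R : R) / h + s / h `^ (3 / 2) *
    Num.sqrt (2 * rho * Log (n%:R : R) * Log (Log (Log (n%:R : R)))).

(* Main.v *)
Require Import Defs.
From HB Require Import structures.
From mathcomp Require Import all_boot all_order all_algebra.
From mathcomp Require Import all_classical all_reals all_analysis.
From mathcomp Require Import measurable_realfun zify ring lra.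
Import Defs numFieldNormedType.Exports.
Import Order.TTheory GRing.Theory Num.Theory.
Local Open Scope classical_set_scope.
Local Open Scope ring_scope.

Set Implicit Arguments.
Unset Strict Implicit.
Unset Printing Implicit Defensive.

(** Under strong separation, [|T^n x - x| <= r^psi(n)] says, up to an additive constant in
    [psi(n)], that the codes of [x] and [T^n x] share their first [psi(n)] symbols.  For a Gibbs
    measure, [- ln mu [i_1 ... i_k] = k h - F_k(i) + O(1)] where [F_k] is a centred Birkhoff sum.
    Normalizing the potential makes [mu] invariant under the dual of a transfer operator [L] with
    [L 1 = 1]; solving [G - L G = f - E f] turns [F_k] into a martingale up to a coboundary, whose
    exponential moments are governed by a perturbation of [L].  These moment bounds give the
    upper law of the iterated logarithm, and (by exponential tilting, together with the
    quasi-independence of cylinders) the lower one, with variance [rho].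

    By quasi-independence, returning at time [n] to the cylinder of length [k] around [i] while
    [F_k(i) < b] has probability [O(exp (b - k h))].  At [k = psi^+(n)] this is summable, and by
    the upper law [F_k(i) < b] eventually holds for the appropriate [b], so [R_(psi^+)] is null.
    Conversely, points with [F_k(i) >= b] have a cylinder of measure at least [exp (b - k h) / K],
    so the probability of no return to it at the times [k, 2k, ..., J k] is at most
    [exp (- c J exp (b - k h))], again summable for [J k] slightly larger than [exp (k h - b)]; by
    the lower law [F_k(i) >= b] for infinitely many [k], which yields infinitely many returns. *)

(** * The symbolic space *)

(** The rate [psi] solves [k h - F_k = ln n] with [F_k] at its extreme size: there [k] is close to
    [ln n / h], so [sqrt (2 rho k ln ln k)] becomes [sqrt (2 (rho / h) ln n ln ln ln n)], and the
    division by [h] produces the power 3/2 and the triple logarithm. The obstacle is that [mu] is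
    given by invariance and two-sided cylinder bounds, not as an eigenmeasure of a transfer
    operator. The identity [E (L p) = E p] is extracted from these data by a relative entropy
    argument, which compares the weights [exp g] with the conditional probabilities of the first
    symbol given the following ones. The same bounds yield independence only up to the factor
    [C ^+ 3], which does not tend to one. Gaussian exponents therefore come from the moment bounds
    of the operator alone, and quasi-independence enters where a fixed factor is harmless: the
    maximal inequality, the divergent Borel-Cantelli lemma and the return estimates. That [f] is not
    cohomologous to a constant gives [rho > 0], and also at least two symbols, hence [h > 0]. *)

Section symbolic.
Variable m : nat.
Implicit Types (i j x y : Sig m) (n k : nat).

Lemma agree_sym i j n : agree i j n -> agree j i n.
Proof. by move=> h k /h. Qed.

Lemma agree_trans i j x n : agree i j n -> agree j x n -> agree i x n.
Proof. by move=> h1 h2 k kn; rewrite h1// h2. Qed.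

Lemma agree_le i j n k : (k <= n)%N -> agree i j n -> agree i j k.
Proof. by move=> kn h l lk; apply: h; exact: leq_trans kn. Qed.

Lemma agree_shift i j n : agree i j n.+1 -> agree (shift i) (shift j) n.
Proof. by move=> h k kn; exact: h. Qed.

Lemma iter_shiftE i n k : iter n (@shift m) i k = i (k + n)%N.
Proof. by elim: n i k => [|n IH] i k /=; rewrite ?addn0// /shift IH addSnnS. Qed.

Lemma agree_iter_shift i j n k :
  agree i j (n + k) -> agree (iter n (@shift m) i) (iter n (@shift m) j) k.
Proof.
by move=> h l lk; rewrite !iter_shiftE; apply: h; rewrite addnC ltn_add2l.
Qed.

Definition scons (a : 'I_m.+1) x : Sig m := fun n => if n is k.+1 then x k else a.

Lemma shift_scons a x : shift (scons a x) = x.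
Proof. by []. Qed.

Lemma scons_shift x : scons (x 0%N) (shift x) = x.
Proof. by apply/funext => -[|n]. Qed.

Lemma agree_scons a x y n : agree x y n -> agree (scons a x) (scons a y) n.+1.
Proof. by move=> h [|k]//= kn; exact: h. Qed.

Definition scat (w : seq 'I_m.+1) x : Sig m := foldr scons x w.

Lemma iter_shift_scat w x : iter (size w) (@shift m) (scat w x) = x.
Proof. by elim: w => //= a w IH; rewrite -iterS iterSr /= shift_scons. Qed.

Lemma scat_nth w x k : (k < size w)%N -> scat w x k = nth ord0 w k.
Proof. by elim: w k => //= a w IH [|k]//= /IH. Qed.

Lemma agree_scat w x y n : agree x y n -> agree (scat w x) (scat w y) (size w + n).
Proof. by move=> h; elim: w => //= a w IH; exact: agree_scons. Qed.

Lemma agree_scat0 w x y : agree (scat w x) (scat w y) (size w).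
Proof. by rewrite -[size w]addn0; exact: agree_scat. Qed.

Definition pt (w : seq 'I_m.+1) : Sig m := scat w (fun=> ord0).

Lemma pt_cons a w : pt (a :: w) = scons a (pt w).
Proof. by []. Qed.

(** Freezing the symbols from index [n] on turns any function into one of [n] symbols; measurability
    of continuous functions and the cylinder versions of Birkhoff sums come from composing with
    it. *)
Definition proj n i : Sig m := fun k => if (k < n)%N then i k else ord0.

Lemma agree_proj n i : agree (proj n i) i n.
Proof. by move=> k kn; rewrite /proj kn. Qed.

Lemma proj_agree n i j : agree i j n -> proj n i = proj n j.
Proof. by move=> h; apply/funext => k; rewrite /proj; case: ifP => // /h. Qed.

Lemma cylE n (w : n.-tuple 'I_m.+1) : cyl w = [set i | agree (pt w) i n].
Proof.
apply/seteqP; split => i /= h.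
  move=> k kn; rewrite /pt scat_nth ?size_tuple//.
  by have := h (Ordinal kn); rewrite (tnth_nth ord0) => /esym.
move=> k; rewrite (tnth_nth ord0) -(h k (ltn_ord k)) /pt scat_nth//.
by rewrite size_tuple.
Qed.

Lemma proj_pt n (w : seq 'I_m.+1) : size w = n -> proj n (pt w) = pt w.
Proof.
move=> wn; apply/funext => k; rewrite /proj; case: ifPn => // kn.
have : (size w <= k)%N by rewrite wn leqNgt.
by rewrite /pt; elim: w k {wn kn} => [|a s IH] [|l] //= /IH.
Qed.

Definition word n i : n.-tuple 'I_m.+1 := [tuple i k | k < n].

Lemma pcylE i n : pcyl i n = cyl (word n i).
Proof.
apply/seteqP; split => j /= h.
  by move=> k; rewrite tnth_mktuple h.
by move=> k kn; rewrite (h (Ordinal kn)) tnth_mktuple.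
Qed.

Lemma cyl_word i n (w : n.-tuple 'I_m.+1) : cyl w i <-> w = word n i.
Proof.
split => [h|->].
  by apply: eq_from_tnth => k; rewrite tnth_mktuple h.
by move=> k; rewrite tnth_mktuple.
Qed.

Lemma agree_word n i : agree (pt (word n i)) i n.
Proof. by have : cyl (word n i) i by [exact/cyl_word]; rewrite cylE. Qed.

Lemma cyl_pcyl n (w : n.-tuple 'I_m.+1) : cyl w = pcyl (pt w) n.
Proof. by rewrite cylE. Qed.

Lemma pcyl_agree i j n : agree i j n -> pcyl i n = pcyl j n.
Proof.
by move=> h; apply/seteqP; split => x /= hx; apply: agree_trans hx => //; exact: agree_sym.
Qed.

Lemma sum_tupleS (V : nmodType) n (F : n.+1.-tuple 'I_m.+1 -> V) :
  \sum_(w : n.+1.-tuple 'I_m.+1) F w =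
  \sum_(a : 'I_m.+1) \sum_(w : n.-tuple 'I_m.+1) F [tuple of a :: w].
Proof.
rewrite pair_big /=.
rewrite (reindex (fun p : 'I_m.+1 * n.-tuple 'I_m.+1 => [tuple of p.1 :: p.2])) //=.
exists (fun w : n.+1.-tuple 'I_m.+1 => (thead w, [tuple of behead w])) => /= [[a w] _|w _] /=.
  by congr pair; apply/val_inj.
by rewrite [RHS]tuple_eta; apply/val_inj.
Qed.

Lemma sum_tuple0 (V : nmodType) (F : 0.-tuple 'I_m.+1 -> V) :
  \sum_(w : 0.-tuple 'I_m.+1) F w = F [tuple].
Proof. by rewrite (big_pred1 [tuple])// => w; apply/esym/eqP/val_inj/size0nil; rewrite size_tuple. Qed.

(** Unions of [n]-cylinders, encoded by invariance under [agree]: Boolean operations, refinement and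
    shifts become immediate, and [cylsetE] recovers the finite union. *)
Definition cylset n (A : set (Sig m)) := forall i j, agree i j n -> A i -> A j.

Lemma cylsetE n A : cylset n A -> A = \big[setU/set0]_(w : n.-tuple 'I_m.+1 | pt w \in A) cyl w.
Proof.
move=> hA; apply/seteqP; split => i /=.
  move=> Ai; rewrite -bigcup_seq_cond.
  exists (word n i) => /=; last exact/cyl_word.
  rewrite mem_index_enum/=; apply/mem_set; by apply: hA Ai; apply: agree_sym; exact: agree_word.
rewrite -bigcup_seq_cond => -[w /= /andP[_ /set_mem Aw]].
rewrite cylE => wi; exact: hA Aw.
Qed.

Lemma cylsetC n A : cylset n A -> cylset n (~` A).
Proof. by move=> hA i j ij /= nA Aj; apply/nA/(hA j) => //; exact: agree_sym. Qed.

Lemma cylsetI n A B : cylset n A -> cylset n B -> cylset n (A `&` B).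
Proof. by move=> hA hB i j ij [/(hA _ _ ij) ? /(hB _ _ ij)]. Qed.

Lemma cylset_le n k A : (k <= n)%N -> cylset k A -> cylset n A.
Proof. by move=> kn hA i j ij; apply: hA; exact: agree_le ij. Qed.

Lemma cylset_shift n k A : cylset k A -> cylset (n + k) (iter n (@shift m) @^-1` A).
Proof. by move=> hA i j ij; apply: hA; exact: agree_iter_shift. Qed.

Lemma cylset_cyl n (w : n.-tuple 'I_m.+1) : cylset n (cyl w).
Proof. by rewrite cylE => i j ij wi; exact: agree_trans ij. Qed.

Lemma cylset_fun (T : Type) n (g : Sig m -> T) (A : set T) : 
  (forall i j, agree i j n -> g i = g j) -> cylset n (g @^-1` A).
Proof. by move=> h i j /h /= ->. Qed.

Lemma cylset_proj (T : Type) n (g : Sig m -> T) (A : set T) : 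
  cylset n [set i | A (g (proj n i))].
Proof. by move=> i j /proj_agree /= ->. Qed.

Lemma measurable_cyl n (w : n.-tuple 'I_m.+1) : measurable (cyl w : set (SigMeas m)).
Proof. by apply: sub_sigma_algebra; exists n, w. Qed.

Lemma measurable_pcyl i n : measurable (pcyl i n : set (SigMeas m)).
Proof. by rewrite pcylE; exact: measurable_cyl. Qed.

Lemma measurable_cylset n A : cylset n A -> measurable (A : set (SigMeas m)).
Proof.
move=> /cylsetE ->; apply: bigsetU_measurable => w _; exact: measurable_cyl.
Qed.

Lemma measurable_shift : measurable_fun setT (@shift m : SigMeas m -> SigMeas m).
Proof.
apply: (@measurability _ _ _ _ setT (@shift m : SigMeas m -> SigMeas m) (@cylinders m)) => //.
move=> _ [_ [n [w ->]] <-]; rewrite setTI.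
apply: (@measurable_cylset (1 + n)%N); apply: (@cylset_shift 1); exact: cylset_cyl.
Qed.

(** The sigma-algebra is generated by cylinders, so measurability is obtained from a pointwise
    limit: [g (proj n i)] depends on [n] symbols and tends to [g i] by continuity. *)
Lemma measurable_continuous_Sig (R : realType) (g : Sig m -> R) :
  continuous_Sig g -> measurable_fun setT (g : SigMeas m -> R).
Proof.
move=> cg; apply: (@measurable_fun_cvg _ (SigMeas m) R setT
  (fun n i => g (proj n i))).
  move=> n _ B mB; rewrite setTI.
  by apply: (@measurable_cylset n); exact: (@cylset_proj _ n g).
move=> x _; apply/cvgrPdist_lt => e e0.
have [N HN] := cg x e e0.
exists N => // n /= Nn; apply: HN; apply: agree_sym.
exact: agree_le Nn (@agree_proj _ _).
Qed.

End symbolic.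

(** * Expectations of bounded functions *)

Section expectation.
Context d (T : measurableType d) (R : realType) (mu : probability T R).
Implicit Types (p q : T -> R) (A B : set T).

Definition Ex p : R := Rintegral mu setT (p).
Definition Pr A : R := fine (mu A).
Let muT : mu setT = 1%E. Proof. exact: probability_setT. Qed.

(** Boundedness gives integrability on a probability space and, unlike integrability, is stable
    under products and exponentials. *)
Definition bm p := measurable_fun setT (p) /\
  exists M : R, forall x, `|p x| <= M.

Lemma bm_integrable p : bm p -> mu.-integrable setT (EFin \o (p)).
Proof.
move=> [mp [M hM]]; apply: measurable_bounded_integrable => //.
  by apply: (le_lt_trans (probability_le1 mu measurableT)); exact: ltry.
exists M; split; first exact: num_real.
by move=> y My x _; exact: le_trans (hM x) (ltW My).
Qed.

Lemma bm_cst c : bm (fun=> c).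
Proof. by split; [exact: measurable_cst|exists `|c|]. Qed.

Lemma bmD p q : bm p -> bm q -> bm (fun x => p x + q x).
Proof.
move=> [mp [M hM]] [mq [N hN]]; split; first exact: measurable_funD.
by exists (M + N) => x; rewrite (le_trans (ler_normD _ _))// lerD.
Qed.

Lemma bmM p q : bm p -> bm q -> bm (fun x => p x * q x).
Proof.
move=> [mp [M hM]] [mq [N hN]]; split; first exact: measurable_funM.
by exists (M * N) => x; rewrite normrM ler_pM.
Qed.

Lemma bmZ c p : bm p -> bm (fun x => c * p x).
Proof. by move=> bp; apply: bmM => //; exact: bm_cst. Qed.

Lemma bmN p : bm p -> bm (fun x => - p x).
Proof.
move=> /(bmZ (-1)); rewrite (_ : (fun x => -1 * p x) = fun x => - p x)//.
by apply/funext => x; rewrite mulN1r.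
Qed.

Lemma bmB p q : bm p -> bm q -> bm (fun x => p x - q x).
Proof. by move=> bp bq; apply: bmD => //; exact: bmN. Qed.

Lemma bm_sum (I : Type) (s : seq I) (P : pred I) (F : I -> T -> R) :
  (forall k, P k -> bm (F k)) -> bm (fun x => \sum_(k <- s | P k) F k x).
Proof.
move=> h; elim: s => [|k s IH].
  by rewrite (_ : (fun x => _) = fun=> 0); [exact: bm_cst|apply/funext => x; rewrite big_nil].
rewrite (_ : (fun x => _) = fun x =>
  if P k then F k x + \sum_(k <- s | P k) F k x else \sum_(k <- s | P k) F k x).
  by case: (boolP (P k)) => // /h bk; exact: bmD.
by apply/funext => x; rewrite big_cons.
Qed.

Lemma bm_expR p : bm p -> bm (fun x => expR (p x)).
Proof.
move=> [mp [M hM]]; split; first exact: measurableT_comp.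
exists (expR M) => x; rewrite ger0_norm ?expR_ge0// ler_expR.
exact: le_trans (ler_norm _) (hM x).
Qed.


Lemma bm_indic A : measurable A -> bm (fun x => (x \in A)%:R).
Proof.
move=> mA; split; first exact: measurable_indic.
by exists 1 => x; case: (x \in A); rewrite ?normr1 ?normr0.
Qed.

Lemma eq_Ex p q : p =1 q -> Ex p = Ex q.
Proof. by move=> /funext ->. Qed.

Lemma Ex_cst c : Ex (fun=> c) = c.
Proof. by rewrite /Ex Rintegral_cst// [fine _](congr1 fine muT) mulr1. Qed.

Lemma ExD p q : bm p -> bm q -> Ex (fun x => p x + q x) = Ex p + Ex q.
Proof. by move=> /bm_integrable ip /bm_integrable iq; rewrite /Ex RintegralD. Qed.

Lemma ExZ c p : bm p -> Ex (fun x => c * p x) = c * Ex p.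
Proof. by move=> /bm_integrable ip; rewrite /Ex RintegralZl. Qed.

Lemma ExB p q : bm p -> bm q -> Ex (fun x => p x - q x) = Ex p - Ex q.
Proof. by move=> /bm_integrable ip /bm_integrable iq; rewrite /Ex RintegralB. Qed.

Lemma ExN p : bm p -> Ex (fun x => - p x) = - Ex p.
Proof.
move=> bp; rewrite -mulN1r -ExZ//; apply: eq_Ex => x; by rewrite mulN1r.
Qed.

Lemma Ex_sum (I : Type) (s : seq I) (P : pred I) (F : I -> T -> R) :
  (forall k, P k -> bm (F k)) ->
  Ex (fun x => \sum_(k <- s | P k) F k x) = \sum_(k <- s | P k) Ex (F k).
Proof.
move=> h; elim: s => [|k s IH].
  by rewrite big_nil -[RHS]Ex_cst; apply: eq_Ex => x; rewrite big_nil.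
rewrite big_cons (eq_Ex (q := fun x =>
  if P k then F k x + \sum_(k <- s | P k) F k x else \sum_(k <- s | P k) F k x)); last first.
  by move=> x; rewrite big_cons.
case: (boolP (P k)) => // Pk.
by rewrite ExD ?IH//; [exact: h|exact: bm_sum].
Qed.

Lemma Ex_le p q : bm p -> bm q -> (forall x, p x <= q x) -> Ex p <= Ex q.
Proof.
move=> /bm_integrable ip /bm_integrable iq pq.
by apply: le_Rintegral => // x _; exact: pq.
Qed.

Lemma Ex_ge0 p : (forall x, 0 <= p x) -> 0 <= Ex p.
Proof. by move=> p0; apply: Rintegral_ge0 => x _; exact: p0. Qed.

Lemma Ex_norm_le p c : bm p -> (forall x, `|p x| <= c) -> `|Ex p| <= c.
Proof.
move=> bp pc; have pc' x : - c <= p x <= c by rewrite -ler_norml.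
rewrite ler_norml; apply/andP; split.
  by rewrite -[leLHS]Ex_cst; apply: Ex_le => // [|x]; [exact: bm_cst|case/andP: (pc' x)].
by rewrite -[leRHS]Ex_cst; apply: Ex_le => // [|x]; [exact: bm_cst|case/andP: (pc' x)].
Qed.

Lemma Ex_dist_le p q c : bm p -> bm q -> (forall x, `|p x - q x| <= c) -> `|Ex p - Ex q| <= c.
Proof. by move=> bp bq h; rewrite -ExB//; apply: Ex_norm_le => //; exact: bmB. Qed.

Lemma PrE A : measurable A -> mu A = (Pr A)%:E.
Proof. by move=> mA; rewrite /Pr fineK// fin_num_measure. Qed.

Lemma Ex_indic A : measurable A -> Ex (fun x => (x \in A)%:R) = Pr A.
Proof.
move=> mA; rewrite /Ex /Rintegral /Pr; congr fine.
by rewrite integral_indic// setIT.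
Qed.

Lemma Pr_ge0 A : 0 <= Pr A.
Proof. exact: fine_ge0. Qed.

Lemma Pr_le A B : measurable A -> measurable B ->
  A `<=` B -> Pr A <= Pr B.
Proof.
by move=> mA mB AB; rewrite -lee_fin -!PrE//; apply: le_measure => //; rewrite inE.
Qed.

Lemma PrT : Pr setT = 1.
Proof. by rewrite /Pr muT. Qed.

Lemma Pr0 : Pr set0 = 0.
Proof. by rewrite /Pr measure0. Qed.

Lemma Pr_le1 A : measurable A -> Pr A <= 1.
Proof. by move=> mA; rewrite -PrT; apply: Pr_le. Qed.

Lemma PrID A B : measurable A -> measurable B ->
  Pr A = Pr (A `&` B) + Pr (A `&` ~` B).
Proof.
move=> mA mB; have mI : measurable (A `&` B) by exact: measurableI.
have mD : measurable (A `&` ~` B).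
  by apply: measurableI => //; exact: measurableC.
apply: EFin_inj; rewrite EFinD -!PrE// -measureU//; first by rewrite -setIUr setUv setIT.
by rewrite setICA -setIA setICr !setI0.
Qed.

Lemma PrU_le A B : measurable A -> measurable B ->
  Pr (A `|` B) <= Pr A + Pr B.
Proof.
move=> mA mB; rewrite -lee_fin EFinD -!PrE//; first exact: measureU2.
exact: measurableU.
Qed.

Lemma Pr_bigsetU_le (I : Type) (s : seq I) (P : pred I) (F : I -> set T) :
  (forall k, measurable (F k)) ->
  Pr (\big[setU/set0]_(k <- s | P k) F k) <= \sum_(k <- s | P k) Pr (F k).
Proof.
move=> mF; have mU t : measurable (\big[setU/set0]_(k <- t | P k) F k).
  by apply: bigsetU_measurable => *; exact: mF.
elim: s => [|k s IH]; first by rewrite !big_nil Pr0.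
rewrite !big_cons; case: ifPn => // _.
by rewrite (le_trans (PrU_le _ _))// lerD2l.
Qed.

Lemma chernoff p a : bm p -> Pr [set x | a <= p x] <= expR (- a) * Ex (fun x => expR (p x)).
Proof.
move=> bp; have mA : measurable ([set x | a <= p x]).
  have [mp _] := bp; rewrite (_ : [set x | _] = p @^-1` `[a, +oo[); last first.
    by apply/seteqP; split => x /=; rewrite in_itv/= andbT.
  by rewrite -[X in measurable X]setTI; exact: mp.
rewrite -Ex_indic// -ExZ; last exact: bm_expR.
apply: Ex_le; [exact: bm_indic|exact/bmZ/bm_expR|move=> x].
rewrite -expRD; case: (boolP (x \in _)) => [|_]; last exact: expR_ge0.
by rewrite inE /= => ax; rewrite -expR0 ler_expR addrC subr_ge0.
Qed.

Lemma borel_cantelli (F : nat -> set T) (u : nat -> R) (K : R) :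
  (forall n, measurable (F n)) ->
  (forall n, Pr (F n) <= u n) -> (forall n, \sum_(k < n) u k <= K) ->
  mu [set x : T | forall N, exists n, (N <= n)%N /\ F n x] = 0%E.
Proof.
move=> mF hu hK.
rewrite (_ : [set x | _] = lim_sup_set (F : nat -> set T)); last first.
  apply/seteqP; split => x /=.
    by move=> h N _; have [n [Nn Fn]] := h N; exists n.
  by move=> h N; have [n Nn Fn] := h N I; exists n.
apply: lim_sup_set_cvg0 => //.
apply: (@le_lt_trans _ _ K%:E); last exact: ltry.
apply: lime_le; first by apply: is_cvg_nneseries => *.
near=> n; rewrite big_mkord; apply: (@le_trans _ _ (\sum_(k < n) u k)%:E).
  rewrite -sumEFin; apply: lee_sum => k _.
  by have := hu k; rewrite -lee_fin -(PrE (mF k)).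
by rewrite lee_fin.
Unshelve. all: by end_near.
Qed.

Variable s : T -> T.
Hypothesis ms : measurable_fun setT s.

Lemma measurable_iter n : measurable_fun setT (iter n s).
Proof.
elim: n => [|n IH]; first exact: measurable_id.
exact: (measurableT_comp ms IH).
Qed.

Lemma bm_iter p n : bm p -> bm (fun x => p (iter n s x)).
Proof.
move=> [mp [M hM]]; split; last by exists M.
by apply: (measurableT_comp mp); exact: measurable_iter.
Qed.

Lemma measurable_preimage_iter A n : measurable A -> measurable (iter n s @^-1` A).
Proof. by move=> mA; rewrite -[X in measurable X]setTI; exact: measurable_iter. Qed.

Hypothesis inv : forall A, measurable A -> mu (s @^-1` A) = mu A.

Lemma Ex_comp p : bm p -> Ex (fun x => p (s x)) = Ex p.
Proof.
move=> bp; rewrite /Ex /Rintegral; congr fine.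
have bps := bm_iter 1 bp.
rewrite -[LHS](@integral_pushforward _ _ _ _ _ s ms mu setT (EFin \o p))//.
- apply: eq_measure_integral => //= A mA _.
  by rewrite /pushforward inv.
- by apply/measurable_EFinP; have [] := bp.
- exact: (bm_integrable bps).
Qed.

Lemma Ex_iter p n : bm p -> Ex (fun x => p (iter n s x)) = Ex p.
Proof.
move=> bp; elim: n => [|n IH] //.
rewrite -IH -(Ex_comp (p := fun x => p (iter n s x))); last exact: bm_iter.
by apply: eq_Ex => x; rewrite iterSr.
Qed.

End expectation.

(** * Hoelder functions and Birkhoff sums *)

Section real_inequalities.
Variable R : realType.
Implicit Types a b c : R.

Lemma expR_sub_le a b : expR a - expR b <= expR a * (a - b).
Proof.
have := expR_ge1Dx (b - a); rewrite expRB ler_pdivlMr ?expR_gt0// => h.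
by have := expR_gt0 a; nra.
Qed.

Lemma expR_dist_le a b c : a <= c -> b <= c -> `|expR a - expR b| <= expR c * `|a - b|.
Proof.
move=> ac bc; wlog : a b ac bc / b <= a => [h|ba].
  by case: (leP b a) => [|/ltW] ab; [exact: h|rewrite distrC [`|a - b|]distrC; exact: h].
rewrite !ger0_norm ?subr_ge0 ?ler_expR//.
by rewrite (le_trans (expR_sub_le _ _))// ler_wpM2r ?subr_ge0 ?ler_expR.
Qed.

Lemma ln_le_subr1 a : 0 < a -> ln a <= a - 1.
Proof. by move=> a0; rewrite -[X in ln X](subrK 1 a) addrC le_ln1Dx; lra. Qed.

Lemma ln_dist_le a b c : 0 < c -> c <= a -> c <= b -> `|ln a - ln b| <= c^-1 * `|a - b|.
Proof.
move=> c0 ca cb; wlog : a b ca cb / b <= a => [h|ba].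
  by case: (leP b a) => [|/ltW] ab; [exact: h|rewrite distrC [`|a - b|]distrC; exact: h].
have b0 : 0 < b by exact: lt_le_trans cb.
have a0 : 0 < a by exact: lt_le_trans ca.
rewrite !ger0_norm ?subr_ge0 ?ler_ln ?posrE//.
rewrite -ln_div ?posrE// (le_trans (ln_le_subr1 _)) ?divr_gt0//.
rewrite -[X in _ - X](divff (lt0r_neq0 b0)) -mulrBl mulrC ler_wpM2r ?subr_ge0//.
by rewrite lef_pV2 ?posrE.
Qed.

End real_inequalities.

Section hoelder_class.
Variables (R : realType) (m : nat) (al : R).
Hypothesis al01 : 0 < al < 1.
Implicit Types (p q : Sig m -> R) (b c : R).

Let al0 : 0 < al. Proof. by case/andP: al01. Qed.
Let al1 : al < 1. Proof. by case/andP: al01. Qed.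
Let aln n : 0 < al ^+ n. Proof. exact: exprn_gt0. Qed.

(** The exponent [al] stays fixed and only the constant [b] varies: sums, products, shifts,
    prefixing a symbol, exponentials and the transfer operator all preserve the exponent. *)
Definition hol b p := forall i j n, agree i j n -> `|p i - p j| <= b * al ^+ n.

Lemma hol_osc b p i j : hol b p -> `|p i - p j| <= b.
Proof. by move=> /(_ i j 0%N); rewrite expr0 mulr1; apply. Qed.

Lemma hol_ge0 b p : hol b p -> 0 <= b.
Proof. by move=> /(hol_osc (fun=> ord0) (fun=> ord0)); exact: le_trans. Qed.

Lemma hol_bdd b p i : hol b p -> `|p i| <= `|p (fun=> ord0)| + b.
Proof.
move=> hp; rewrite -[p i](subrK (p (fun=> ord0))) addrC (le_trans (ler_normD _ _))//.
by rewrite lerD2l; exact: hol_osc.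
Qed.

Lemma hol_continuous b p : hol b p -> continuous_Sig p.
Proof.
move=> hp i e e0; have b0 := hol_ge0 hp.
have : (fun n => al ^+ n) @ \oo --> (0 : R) by apply: cvg_expr; rewrite gtr0_norm.
move=> /cvgrPdist_lt /(_ (e / (b + 1))) []; first by rewrite divr_gt0// ltr_wpDl.
move=> N _ /(_ N (leqnn _)); rewrite /= sub0r normrN gtr0_norm// => hN.
exists N => j /hp /le_lt_trans; apply.
move: hN; rewrite ltr_pdivlMr ?ltr_wpDl// => hN; have := aln N; nra.
Qed.

Definition holder_class p := exists b, hol b p.
Local Notation H := holder_class.

Lemma H_cst c : H (fun=> c).
Proof. by exists 0 => i j n _; rewrite subrr normr0 mul0r. Qed.

Lemma HD p q : H p -> H q -> H (fun x => p x + q x).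
Proof.
move=> [b hp] [c hq]; exists (b + c) => i j n ij.
rewrite (_ : _ - _ = (p i - p j) + (q i - q j)); last by ring.
by rewrite (le_trans (ler_normD _ _))// mulrDl lerD ?hp ?hq.
Qed.

Lemma HM p q : H p -> H q -> H (fun x => p x * q x).
Proof.
move=> [b hp] [c hq]; set P := `|p (fun=> ord0)| + b; set Q := `|q (fun=> ord0)| + c.
exists (P * c + Q * b) => i j n ij.
rewrite (_ : _ - _ = p i * (q i - q j) + (p i - p j) * q j); last by ring.
rewrite (le_trans (ler_normD _ _))// !normrM mulrDl lerD//.
  by rewrite -mulrA ler_pM ?hq//; exact: hol_bdd.
by rewrite mulrC -mulrA ler_pM ?hp//; exact: hol_bdd.
Qed.

Lemma HZ c p : H p -> H (fun x => c * p x).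
Proof. by move=> hp; apply: HM => //; exact: H_cst. Qed.

Lemma eqH p q : p =1 q -> H p -> H q.
Proof. by move=> /funext ->. Qed.

Lemma HN p : H p -> H (fun x => - p x).
Proof. by move=> /(HZ (-1)); apply: eqH => x; rewrite mulN1r. Qed.

Lemma HB p q : H p -> H q -> H (fun x => p x - q x).
Proof. by move=> hp hq; apply: HD => //; exact: HN. Qed.

Lemma H_sum (I : Type) (s : seq I) (F : I -> Sig m -> R) :
  (forall k, H (F k)) -> H (fun x => \sum_(k <- s) F k x).
Proof.
move=> h; elim: s => [|k s IH].
  by apply: eqH (H_cst 0) => x; rewrite big_nil.
by apply: eqH (HD (h k) IH) => x; rewrite big_cons.
Qed.

Lemma HX p n : H p -> H (fun x => p x ^+ n).
Proof.
move=> hp; elim: n => [|n IH]; first by apply: eqH (H_cst 1).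
by apply: eqH (HM hp IH) => x; rewrite exprS.
Qed.

Lemma H_shift p : H p -> H (fun x => p (shift x)).
Proof.
move=> [b hp]; have b0 := hol_ge0 hp; exists (b / al) => i j [|n] ij.
  rewrite expr0 mulr1 (le_trans (hol_osc _ _ hp))// ler_pdivlMr//; have := ltW al1; nra.
rewrite (le_trans (hp _ _ _ (agree_shift ij)))// exprS mulrA divfK//; exact: lt0r_neq0.
Qed.

Lemma H_iter_shift p n : H p -> H (fun x => p (iter n (@shift m) x)).
Proof.
move=> hp; elim: n => [//|n IH].
by apply: eqH (H_shift IH) => x; rewrite iterSr.
Qed.

Lemma H_birkhoff p n : H p -> H (birkhoff p n).
Proof. by move=> hp; apply: H_sum => k; exact: H_iter_shift. Qed.

Lemma H_bdd p : H p -> exists M : R, 0 < M /\ forall x, `|p x| <= M.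
Proof.
move=> [b hp]; exists (`|p (fun=> ord0)| + b + 1); split.
  by rewrite ltr_pwDr// addr_ge0// (hol_ge0 hp).
by move=> x; rewrite (le_trans (hol_bdd x hp))// lerDl.
Qed.

Lemma H_scons a p : H p -> H (fun x => p (scons a x)).
Proof.
move=> [b hp]; exists b => i j n ij; have b0 := hol_ge0 hp.
rewrite (le_trans (hp _ _ _ (agree_scons a ij)))// exprS.
by rewrite ler_wpM2l// -[leRHS]mul1r ler_wpM2r// ltW.
Qed.

Lemma H_expR p : H p -> H (fun x => expR (p x)).
Proof.
move=> hp; have [M [M0 hM]] := H_bdd hp; case: hp => b hp.
exists (expR M * b) => i j n ij; rewrite -mulrA.
have pM x : p x <= M := le_trans (ler_norm _) (hM x).
rewrite (le_trans (expR_dist_le (pM i) (pM j)))//.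
by rewrite ler_wpM2l ?expR_ge0// hp.
Qed.

Lemma H_ln p c : 0 < c -> (forall x, c <= p x) -> H p -> H (fun x => ln (p x)).
Proof.
move=> c0 cp [b hp]; exists (c^-1 * b) => i j n ij; rewrite -mulrA.
by rewrite (le_trans (ln_dist_le c0 _ _))// ler_wpM2l ?hp// invr_ge0 ltW.
Qed.

Lemma H_continuous p : H p -> continuous_Sig p.
Proof. by move=> [b]; exact: hol_continuous. Qed.

Lemma H_bm p : H p -> bm (p : SigMeas m -> R).
Proof.
move=> hp; split; first by apply: measurable_continuous_Sig; exact: H_continuous.
by have [M [_ hM]] := H_bdd hp; exists M.
Qed.

(** Bounded distortion: the [l]-th terms see [n - l + k] common symbols, and the resulting geometric
    sum does not grow with [n]. *)
Lemma birkhoff_hol b p n i j k : hol b p -> agree i j (n + k) ->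
  `|birkhoff p n i - birkhoff p n j| <= b / (1 - al) * al ^+ k.
Proof.
move=> hp ij; have b0 := hol_ge0 hp; rewrite /birkhoff -sumrB.
apply: (@le_trans _ _ (\sum_(l < n) b * al ^+ (n - l + k))).
  rewrite (le_trans (ler_norm_sum _ _ _))// ler_sum// => l _; apply: hp.
  by apply: agree_iter_shift; rewrite addnA subnKC// ltnW.
rewrite -mulr_sumr -mulrA ler_wpM2l//.
under eq_bigr do rewrite exprD.
rewrite -mulr_suml ler_wpM2r ?(ltW (aln _))//.
rewrite -[leRHS]mul1r ler_pdivlMr ?subr_gt0//.
have h : forall N, (\sum_(l < N) al ^+ (N - l)) * (1 - al) <= 1 - al ^+ N.
  elim=> [|N IH]; first by rewrite big_ord0 mul0r expr0 subrr.
  rewrite big_ord_recl subn0 mulrDl.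
  under eq_bigr do rewrite lift0 subSS.
  have : al ^+ N.+1 * (1 - al) <= al ^+ N - al ^+ N.+1.
    by rewrite exprS; have := mulr_ge0 (ltW (aln N)) (sqr_ge0 (1 - al)); nra.
  lra.
by rewrite (le_trans (h n))// lerBlDr lerDl ltW// aln.
Qed.

Lemma birkhoffD p n k i : birkhoff p (n + k) i = birkhoff p n i + birkhoff p k (iter n (@shift m) i).
Proof.
rewrite /birkhoff big_split_ord /=; congr (_ + _); apply: eq_bigr => l _.
by rewrite addnC iterD.
Qed.

End hoelder_class.

(** * Events and expectations as sums over words *)

Section cylinder_expectation.
Variables (R : realType) (m : nat) (mu : probability (SigMeas m) R).
Implicit Types (p : Sig m -> R) (A B D : set (Sig m)).

Local Notation E := (Ex mu).
Local Notation P := (Pr mu).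

Lemma Pr_split n k A D : cylset k A -> measurable (D : set (SigMeas m)) ->
  P (D `&` iter n (@shift m) @^-1` A) =
  \sum_(v : k.-tuple 'I_m.+1 | pt v \in A) P (D `&` iter n (@shift m) @^-1` (cyl v)).
Proof.
move=> hA mD.
have mI B : measurable (B : set (SigMeas m)) ->
    measurable (D `&` iter n (@shift m) @^-1` B : set (SigMeas m)).
  by move=> mB; apply: measurableI => //; apply: measurable_preimage_iter => //; exact: measurable_shift.
rewrite -Ex_indic; last by apply: mI; exact: measurable_cylset hA.
transitivity (E (fun x => \sum_(v : k.-tuple 'I_m.+1 | pt v \in A)
    (x \in D `&` iter n (@shift m) @^-1` (cyl v))%:R)).
  apply: eq_Ex => x; set y := iter n (@shift m) x.
  have yw : agree (pt (word k y)) y k by exact: agree_word.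
  have -> : (x \in D `&` iter n (@shift m) @^-1` A) = (x \in D) && (y \in A).
    by apply/idP/andP => [/set_mem[? ?]|[/set_mem ? /set_mem ?]]; [split|]; exact/mem_set.
  under eq_bigr => v _.
    have -> : (x \in D `&` iter n (@shift m) @^-1` (cyl v)) = (x \in D) && (v == word k y).
      apply/idP/andP => [/set_mem[? /cyl_word ->]|[/set_mem Dx /eqP ->]].
        by split; [exact/mem_set|].
      by apply/mem_set; split => //=; apply/cyl_word.
    over.
  case: (x \in D) => /=; last by rewrite big1.
  rewrite big_mkcond (bigD1 (word k y))//= eqxx big1 ?addr0; last first.
    by move=> v /negbTE ->; case: ifP.
  have -> : (pt (word k y) \in A) = (y \in A); last by case: ifP.
  by apply/idP/idP => /set_mem h; apply/mem_set; apply: hA h => //; exact: agree_sym.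
rewrite Ex_sum => [|v _]; last by apply: bm_indic; apply: mI; exact: measurable_cyl.
by apply: eq_bigr => v _; rewrite Ex_indic//; by apply: mI; exact: measurable_cyl.
Qed.

Lemma Pr_cylset k A : cylset k A -> P A = \sum_(v : k.-tuple 'I_m.+1 | pt v \in A) P (cyl v).
Proof.
move=> hA; have := @Pr_split 0%N k A setT hA measurableT; rewrite setTI => ->.
by apply: eq_bigr => v _; rewrite setTI.
Qed.

Lemma sum_Pr_cyl n : \sum_(v : n.-tuple 'I_m.+1) P (cyl v) = 1.
Proof.
rewrite -(PrT mu) (@Pr_cylset n)//.
by apply: eq_bigl => v; apply/esym/mem_set.
Qed.

Lemma bm_cyl (n : nat) p : (forall i j, agree i j n -> p i = p j) -> bm (p : SigMeas m -> R).
Proof.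
move=> hp; split.
  by move=> _ B mB; rewrite setTI; apply: (@measurable_cylset _ n); exact: cylset_fun.
exists (\sum_(w : n.-tuple 'I_m.+1) `|p (pt w)|) => x.
rewrite (bigD1 (word n x))//= (hp x (pt (word n x))).
  by rewrite lerDl sumr_ge0.
by apply: agree_sym; exact: agree_word.
Qed.

Lemma Ex_cyl (n : nat) p : (forall i j, agree i j n -> p i = p j) ->
  E p = \sum_(w : n.-tuple 'I_m.+1) P (cyl w) * p (pt w).
Proof.
move=> hp; transitivity (E (fun x => \sum_(w : n.-tuple 'I_m.+1) p (pt w) * (x \in cyl w)%:R)).
  apply: eq_Ex => x; rewrite (bigD1 (word n x))//= mem_set ?mulr1; last exact/cyl_word.
  rewrite big1 ?addr0 => [|v /eqP vx]; last first.
    by rewrite memNset ?mulr0//; apply: contra_not vx => /cyl_word.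
  by apply: hp; apply: agree_sym; exact: agree_word.
have bI w : bm (fun x : SigMeas m => (x \in cyl (n := n) w)%:R : R).
  by apply: bm_indic; exact: measurable_cyl.
rewrite Ex_sum => [|w _]; last exact: bmZ.
by apply: eq_bigr => w _; rewrite ExZ// Ex_indic 1?mulrC//; exact: measurable_cyl.
Qed.

(** The sum over words is exactly the expectation of [p (proj n x)], which is uniformly within
    [b * al ^+ n] of [p x]. *)
Lemma Ex_hol_cyl al b p n : 0 < al < 1 -> hol al b p ->
  `|E p - \sum_(w : n.-tuple 'I_m.+1) P (cyl w) * p (pt w)| <= b * al ^+ n.
Proof.
move=> al01 hp; have hq i j : agree i j n -> p (proj n i) = p (proj n j) by move=> /proj_agree ->.
rewrite (_ : \sum_(w : n.-tuple 'I_m.+1) _ = E (fun x => p (proj n x))).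
  apply: Ex_dist_le; [by apply: (H_bm al01); exists b|by have := bm_cyl hq|move=> x].
  by apply: hp; apply: agree_sym; exact: agree_proj.
by rewrite (Ex_cyl hq); apply: eq_bigr => w _; rewrite proj_pt// size_tuple.
Qed.

End cylinder_expectation.

(** * Quasi-independence of cylinders *)

Section quasi_bernoulli.
Variables (R : realType) (m : nat) (mu : probability (SigMeas m) R).
Variables (f : Sig m -> R) (pr C : R).
Implicit Types (A B D : set (Sig m)).
Local Notation P := (Pr mu).

Definition gibbs_weight n i := expR (- (n%:R * pr) + birkhoff f n i).
Local Notation G := gibbs_weight.

(** The number [pr] is a parameter rather than [pressure f], so that the normalized potential can be
    handled with [pr = 0] without computing its pressure. *)
Definition gibbs_bound := 1 < C /\
  forall n i, C^-1 * G n i <= P (pcyl i n) <= C * G n i.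

Hypothesis gib : gibbs_bound.

Let C0 : 0 < C. Proof. by case: gib => /(lt_trans ltr01). Qed.

Lemma gibbs_weightD n k i : G (n + k) i = G n i * G k (iter n (@shift m) i).
Proof. by rewrite /G -expRD birkhoffD natrD; congr expR; ring. Qed.

Lemma gibbs_upper n i : P (pcyl i n) <= C * G n i.
Proof. by case: gib => _ /(_ n i) /andP[]. Qed.

Lemma gibbs_lower n i : C^-1 * G n i <= P (pcyl i n).
Proof. by case: gib => _ /(_ n i) /andP[]. Qed.

Lemma Pr_pcyl_gt0 n i : 0 < P (pcyl i n).
Proof. by rewrite (lt_le_trans _ (gibbs_lower n i))// mulr_gt0 ?expR_gt0 ?invr_gt0. Qed.

Lemma pcylD z n k : pcyl z (n + k) = pcyl z n `&` iter n (@shift m) @^-1` pcyl (iter n (@shift m) z) k.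
Proof.
apply/seteqP; split => x /=.
  move=> zx; split; first exact: agree_le (leq_addr _ _) zx.
  exact: agree_iter_shift.
move=> [zx1 zx2] l lnk; have [/zx1 //|nl] := ltnP l n.
have := zx2 (l - n)%N; rewrite !iter_shiftE subnK//; apply.
by rewrite ltn_subLR.
Qed.

(** Gibbs weights are multiplicative along an orbit; [C ^+ 3] collects one factor [C] for the long
    cylinder and one for each of the two short ones. *)
Lemma Pr_pcylD_le z n k : P (pcyl z (n + k)) <= C ^+ 3 * (P (pcyl z n) * P (pcyl (iter n (@shift m) z) k)).
Proof.
rewrite (le_trans (gibbs_upper _ _))// gibbs_weightD.
have h1 := gibbs_lower n z; have h2 := gibbs_lower k (iter n (@shift m) z).
rewrite exprS -mulrA ler_pM2l// expr2 mulrACA ler_pM ?expR_ge0//.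
  by rewrite -ler_pdivrMl.
by rewrite -ler_pdivrMl.
Qed.

Lemma Pr_pcylD_ge z n k : C ^- 3 * (P (pcyl z n) * P (pcyl (iter n (@shift m) z) k)) <= P (pcyl z (n + k)).
Proof.
apply: le_trans (gibbs_lower _ _); rewrite gibbs_weightD.
have h1 := gibbs_upper n z; have h2 := gibbs_upper k (iter n (@shift m) z).
rewrite -exprVn exprS -mulrA ler_pM2l ?invr_gt0// expr2 mulrACA.
by rewrite ler_pM ?mulr_ge0 ?Pr_ge0 ?invr_ge0 ?(ltW C0)// ler_pdivrMl.
Qed.

(** The concatenation [scat w (pt v)] serves as a common centre, which reduces statements on pairs
    of words to the estimates for [pcyl] around one point. *)
Lemma cyl_cylE n k (w : n.-tuple 'I_m.+1) (v : k.-tuple 'I_m.+1) :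
  cyl w `&` iter n (@shift m) @^-1` (cyl v) = pcyl (scat w (pt v)) (n + k) /\
  cyl w = pcyl (scat w (pt v)) n /\
  cyl v = pcyl (iter n (@shift m) (scat w (pt v))) k.
Proof.
have h1 : cyl w = pcyl (scat w (pt v)) n.
  rewrite cyl_pcyl; apply: pcyl_agree; rewrite -[X in agree _ _ X](size_tuple w).
  exact: agree_scat0.
have h2 : cyl v = pcyl (iter n (@shift m) (scat w (pt v))) k.
  by rewrite -[X in iter X](size_tuple w) iter_shift_scat cyl_pcyl.
by split=> //; rewrite pcylD -h1 -h2.
Qed.

(** The pointwise estimates for cylinders, summed over all pairs of words in [A] and [B]; this is
    the substitute for independence. *)
Lemma Pr_qb A B n k : cylset n A -> cylset k B ->
  C ^- 3 * (P A * P B) <= P (A `&` iter n (@shift m) @^-1` B) <= C ^+ 3 * (P A * P B).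
Proof.
move=> hA hB.
have mcv (v : k.-tuple 'I_m.+1) : measurable (iter n (@shift m) @^-1` (cyl v : set (SigMeas m)) : set (SigMeas m)).
  by apply: measurable_preimage_iter; [exact: measurable_shift|exact: measurable_cyl].
rewrite (Pr_split mu n hB (measurable_cylset hA)).
have -> : \sum_(v : k.-tuple 'I_m.+1 | pt v \in B) P (A `&` iter n (@shift m) @^-1` cyl v) =
   \sum_(v : k.-tuple 'I_m.+1 | pt v \in B) \sum_(w : n.-tuple 'I_m.+1 | pt w \in A)
    P (cyl w `&` iter n (@shift m) @^-1` cyl v).
  apply: eq_bigr => v _; rewrite setIC.
  rewrite (Pr_split mu 0 hA (D := iter n (@shift m) @^-1` cyl v))//.
  by apply: eq_bigr => w _; rewrite setIC.
rewrite (Pr_cylset mu hA) (Pr_cylset mu hB) mulr_suml.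
rewrite exchange_big/= !mulr_sumr; apply/andP; split; apply: ler_sum => w _.
  rewrite !mulr_sumr; apply: ler_sum => v _.
  by have [-> [-> ->]] := cyl_cylE w v; exact: Pr_pcylD_ge.
rewrite !mulr_sumr; apply: ler_sum => v _.
by have [-> [-> ->]] := cyl_cylE w v; exact: Pr_pcylD_le.
Qed.

Section missing.
Variables (A0 : set (Sig m)) (B : nat -> set (Sig m)) (t l : nat -> nat).
Hypothesis hA0 : cylset (t 0%N) A0.
Hypothesis hB : forall j, cylset (l j) (B j).
Hypothesis htl : forall j, (t j + l j <= t j.+1)%N.

(** By [htl] the windows of symbols tested at the times [t j] do not overlap, so the failures before
    step [j] are decided by the first [t j] symbols and [Pr_qb] applies at each step. *)
Fixpoint missing J : set (Sig m) :=
  if J is j.+1 then missing j `&` iter (t j) (@shift m) @^-1` (~` B j) else A0.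

Lemma cylset_missing J : cylset (t J) (missing J).
Proof.
elim: J => [//|J IH]; apply: cylset_le (htl J) _; apply: cylsetI.
  exact: cylset_le (leq_addr _ _) IH.
by apply: cylset_shift; exact: cylsetC.
Qed.

(** Given the earlier failures, [B J] still occurs with conditional probability at least
    [C ^- 3 * P (B J)]; then [1 - x <= expR (- x)]. *)
Lemma Pr_missing J : P (missing J) <= P A0 * expR (- (C ^- 3 * \sum_(j < J) P (B j))).
Proof.
elim: J => [|J IH]; first by rewrite big_ord0 mulr0 oppr0 expR0 mulr1.
have hJ := @cylset_missing J.
have mJ := measurable_cylset hJ.
have mB : measurable (iter (t J) (@shift m) @^-1` (B J) : set (SigMeas m)).
  apply: measurable_preimage_iter; first exact: measurable_shift.
  exact: (@measurable_cylset _ (l J) _ (@hB J)).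
have /andP[lo _] := Pr_qb hJ (@hB J).
have := PrID mu mJ mB; rewrite preimage_setC => h.
rewrite /= big_ord_recr/= mulrDr opprD expRD mulrA.
apply: (@le_trans _ _ (P (missing J) * (1 - C ^- 3 * P (B J)))).
  by move: h lo; lra.
have := expR_ge1Dx (- (C ^- 3 * P (B J))); rewrite -/(1 - _) => h1.
apply: (@le_trans _ _ (P (missing J) * expR (- (C ^- 3 * P (B J))))).
  by rewrite ler_wpM2l// Pr_ge0.
by rewrite ler_wpM2r// expR_ge0.
Qed.

End missing.

Lemma borel_cantelli_diverging (B : nat -> set (Sig m)) (t l : nat -> nat) :
  (forall j, cylset (l j) (B j)) -> (forall j, (t j + l j <= t j.+1)%N) ->
  (forall K : R, exists J, K <= \sum_(j < J) P (B j)) ->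
  {ae mu, forall i : SigMeas m, forall N, exists j, (N <= j)%N /\ B j (iter (t j) (@shift m) i)}.
Proof.
move=> hB htl div; apply/ae_foralln => N.
pose A := [set i : SigMeas m | forall j, (N <= j)%N -> ~ B j (iter (t j) (@shift m) i)].
have mA : measurable (A : set (SigMeas m)).
  rewrite (_ : A = \bigcap_(j in [set j | (N <= j)%N]) (iter (t j) (@shift m) @^-1` (~` B j))); last first.
    by apply/seteqP; split => i h j; apply: h.
  apply: bigcap_measurable => [|j _]; first by exists N; rewrite /=.
  apply: measurable_preimage_iter; first exact: measurable_shift.
  by apply: (@measurable_cylset _ (l j)); exact: cylsetC.
exists A; split => //; last first.
  by move=> i /= h j Nj Bj; apply: h; exists j.
suff : P A <= 0.
  by move=> PA; rewrite -[LHS]/(mu A) (PrE mu mA); congr EFin; apply/le_anti; rewrite PA Pr_ge0.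
apply/ler_addgt0Pl => e e0; rewrite addr0.
(* The first [N] probabilities sum to at most [N], so those from [N] on reach [C ^+ 3 / e]; the
   failure bound becomes [expR (- e^-1)], which is at most [e]. *)
have [J hJ] := div (C ^+ 3 * e^-1 + N%:R).
pose t' j := t (N + j)%N; pose l' j := l (N + j)%N; pose B' j := B (N + j)%N.
have hA0 : cylset (t' 0%N) (setT : set (Sig m)) by [].
have hB' j : cylset (l' j) (B' j) by exact: hB.
have htl' j : (t' j + l' j <= t' j.+1)%N by rewrite /t' addnS; exact: htl.
have h := Pr_missing hA0 hB' htl' J; rewrite PrT mul1r in h.
apply: (@le_trans _ _ (P (missing setT B' t' J))); last apply: (le_trans h).
  apply: Pr_le => //; first by apply: (@measurable_cylset _ (t' J)); exact: cylset_missing.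
  move=> i Ai; elim: J {hJ h} => [//|J IH]; split => //; apply: Ai; exact: leq_addr.
apply: (@le_trans _ _ (expR (- e^-1))).
  rewrite ler_expR lerN2 -exprVn exprVn -ler_pdivrMl ?invr_gt0 ?exprn_gt0// invrK.
  apply: (@le_trans _ _ (\sum_(j < N + J) P (B j) - N%:R)).
    rewrite lerBrDr; apply: le_trans hJ _; rewrite addnC big_split_ord/= lerDl.
    by apply: sumr_ge0 => *; exact: Pr_ge0.
  rewrite big_split_ord/= lerBlDr addrC lerD2l.
  apply: (@le_trans _ _ (\sum_(j < N) 1)); last by rewrite sumr_const card_ord.
  by apply: ler_sum => j _; apply: Pr_le1; exact: (@measurable_cylset _ (l j)).
rewrite expRN -[leRHS]invrK lef_pV2 ?posrE ?expR_gt0 ?invr_gt0//.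
by have := expR_ge1Dx e^-1; lra.
Qed.

End quasi_bernoulli.

(** * Transfer operators *)

Section transfer_operator.
Variables (R : realType) (m : nat).
Implicit Types (g p q : Sig m -> R).

(** The Ruelle transfer operator: a weighted sum over the preimages [scons a x] of [x] under the
    shift. *)
Definition transf g p : Sig m -> R :=
  fun x => \sum_(a : 'I_m.+1) expR (g (scons a x)) * p (scons a x).

Lemma birkhoffS g n x : birkhoff g n.+1 x = g x + birkhoff g n (shift x).
Proof.
rewrite /birkhoff big_ord_recl; congr (_ + _); apply: eq_bigr => k _.
by rewrite lift0 iterSr.
Qed.

Lemma transf_iterE g n p x : iter n (transf g) p x =
  \sum_(w : n.-tuple 'I_m.+1) expR (birkhoff g n (scat w x)) * p (scat w x).
Proof.
elim: n p x => [|n IH] p x.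
  by rewrite sum_tuple0 /birkhoff big_ord0 expR0 mul1r.
rewrite iterSr IH sum_tupleS exchange_big/=; apply: eq_bigr => w _.
rewrite /transf mulr_sumr; apply: eq_bigr => a _.
by rewrite birkhoffS expRD mulrA [_ * expR (g _)]mulrC.
Qed.

Lemma transf_le g p q : (forall x, p x <= q x) -> forall x, transf g p x <= transf g q x.
Proof. by move=> pq x; apply: ler_sum => a _; rewrite ler_wpM2l ?expR_ge0. Qed.

Lemma transf_iter_le g p q n : (forall x, p x <= q x) ->
  forall x, iter n (transf g) p x <= iter n (transf g) q x.
Proof. by move=> pq; elim: n => //= n IH; exact: transf_le. Qed.

Lemma transfZ g c p : transf g (fun x => c * p x) = fun x => c * transf g p x.
Proof. by apply/funext => x; rewrite /transf mulr_sumr; apply: eq_bigr => a _; ring. Qed.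

Lemma transf_iterZ g c p n : iter n (transf g) (fun x => c * p x) = fun x => c * iter n (transf g) p x.
Proof. by elim: n => //= n ->; rewrite transfZ. Qed.

Lemma transfD g p q : transf g (fun x => p x + q x) = fun x => transf g p x + transf g q x.
Proof.
by apply/funext => x; rewrite /transf -big_split; apply: eq_bigr => a _ /=; ring.
Qed.

Lemma transfB g p q : transf g (fun x => p x - q x) = fun x => transf g p x - transf g q x.
Proof.
by apply/funext => x; rewrite /transf -sumrB; apply: eq_bigr => a _ /=; ring.
Qed.

Lemma transf_cvg g (U : nat -> Sig m -> R) p : (forall x, U ^~ x @ \oo --> p x) ->
  forall x, (fun n => transf g (U n) x) @ \oo --> transf g p x.
Proof.
move=> h x; rewrite /transf; elim: (index_enum _) => [|a s IH].
  rewrite big_nil; under eq_fun do rewrite big_nil; exact: cvg_cst.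
rewrite big_cons; under eq_fun do rewrite big_cons.
by apply: cvgD => //; apply: cvgM; [exact: cvg_cst|exact: h].
Qed.

(** A function of [shift x] takes one value on all preimages of a point and leaves the operator as a
    factor. For a normalized potential and an invariant expectation, the operator thus acts as
    conditional expectation given the shifted sequence. *)
Lemma transf_mul_shift g p q : transf g (fun x => p x * q (shift x)) = fun x => transf g p x * q x.
Proof.
by apply/funext => x; rewrite /transf mulr_suml; apply: eq_bigr => a _; rewrite shift_scons mulrA.
Qed.

Variable al : R.
Hypothesis al01 : 0 < al < 1.

Let al0 : 0 < al. Proof. by case/andP: al01. Qed.
Let al1 : al < 1. Proof. by case/andP: al01. Qed.

Lemma H_transf g p : holder_class al g -> holder_class al p -> holder_class al (transf g p).
Proof.
move=> hg hp; apply: H_sum => a; apply: HM => //.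
  by apply: H_expR => //; exact: H_scons.
exact: H_scons.
Qed.

(** Regularity in ratio form: it passes to suprema and pointwise limits, and the operator preserves
    it for a suitable [B], so the iterates are uniformly regular. *)
Definition log_hol B p := forall i j n, agree i j n -> p i <= p j * expR (B * al ^+ n).

(** The constant is the fixed point of [B = (b + B) * al]: the weight adds [b], and prefixing a
    common symbol gains the factor [al]. *)
Lemma log_hol_transf g b p : hol al b g -> (forall x, 0 <= p x) -> log_hol (b * al / (1 - al)) p ->
  log_hol (b * al / (1 - al)) (transf g p).
Proof.
move=> hg p0 hp i j n ij; rewrite /transf mulr_suml; apply: ler_sum => a _.
have ija := agree_scons a ij.
set B := _ / _; have BE : B = (b + B) * al.
  rewrite /B; have : 1 - al != 0 by rewrite subr_eq0 eq_sym lt_eqF.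
  by move=> h; field.
have : expR (g (scons a i)) <= expR (g (scons a j)) * expR (b * al ^+ n.+1).
  rewrite -expRD ler_expR -lerBlDl; exact: le_trans (ler_norm _) (hg _ _ _ ija).
have := hp _ _ _ ija; rewrite -/B => h1 h2.
rewrite {1}BE (_ : _ * al ^+ n = b * al ^+ n.+1 + B * al ^+ n.+1); last by rewrite exprS; ring.
rewrite expRD mulrACA.
apply: (@le_trans _ _ (expR (g (scons a i)) * (p (scons a j) * expR (B * al ^+ n.+1)))).
  by rewrite ler_wpM2l// expR_ge0.
by rewrite ler_wpM2r// mulr_ge0// expR_ge0.
Qed.

Lemma log_hol_H B M p : 0 <= B -> (forall x, 0 <= p x <= M) -> log_hol B p -> holder_class al p.
Proof.
move=> B0 pM hp; exists (M * (expR B * B)) => i j n ij.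
have an1 : 0 <= al ^+ n <= 1.
  by apply/andP; split; [exact/exprn_ge0/ltW|apply: exprn_ile1; exact: ltW].
have step i' j' : agree i' j' n -> p i' - p j' <= M * (expR B * B) * al ^+ n.
  move=> ij'; have := hp _ _ _ ij'; have /andP[p0 pM'] := pM j'.
  have := expR_sub_le (B * al ^+ n) 0; rewrite expR0 subr0 => h1 h2.
  have h3 : expR (B * al ^+ n) <= expR B.
    by rewrite ler_expR; case/andP: an1 => h h'; nra.
  apply: (@le_trans _ _ (p j' * (expR B * (B * al ^+ n)))).
    apply: (@le_trans _ _ (p j' * (expR (B * al ^+ n) - 1))); first by rewrite mulrBr mulr1 lerB.
    rewrite ler_wpM2l// (le_trans h1)// ler_wpM2r// mulr_ge0//.
    by case/andP: an1.
  rewrite -!mulrA ler_wpM2r// !mulr_ge0 ?expR_ge0//.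
  by case/andP: an1.
rewrite ler_norml step// andbT lerNl opprB step//; exact: agree_sym.
Qed.

Section eigenfunction.
Variables (g : Sig m -> R) (K : R).
Hypothesis hg : holder_class al g.
Local Notation L := (transf g).
Let u n : Sig m -> R := iter n L (fun=> 1).
Hypothesis K0 : 0 < K.
Hypothesis hu : forall n x, K^-1 <= u n x <= K.

(* [limsup_n L^n 1] is a subsolution; its iterates increase to an eigenfunction. *)
Lemma exists_eigenfunction : exists h : Sig m -> R, [/\ holder_class al h,
  exists c : R, 0 < c /\ forall x, c <= h x & transf g h = h].
Proof.
case: hg => b hgb; have b0 := hol_ge0 hgb.
pose B := b * al / (1 - al).
have B0 : 0 <= B by rewrite divr_ge0 ?mulr_ge0 ?subr_ge0// ltW.
have u0 n x : 0 <= u n x.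
  by have /andP[] := hu n x => h _; apply: le_trans h; rewrite invr_ge0 ltW.
have uK n x : u n x <= K by case/andP: (hu n x).
have lhu n : log_hol B (u n).
  elim: n => [|n IH]; last exact: log_hol_transf.
  move=> i j n ij /=; rewrite mul1r -[leLHS]expR0 ler_expR mulr_ge0 ?exprn_ge0//.
  exact: ltW.
(* Tail suprema decrease in [N], so their limit [hb] is the upper limit of the iterates [u n]; no
   convergence of [u] itself is assumed. *)
pose v N x := sup (sdrop (u ^~ x) N).
have uub x : has_ubound (range (u ^~ x)) by exists K => _ [n _ <-].
have vub x N : has_ubound (sdrop (u ^~ x) N) by exists K => _ [n _ <-].
have uv n N x : (N <= n)%N -> u n x <= v N x.
  by move=> Nn; apply: ub_le_sup => //; exists n.
have vle N x c : (forall n, (N <= n)%N -> u n x <= c) -> v N x <= c.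
  move=> h; apply: ge_sup; first by exists (u N x), N => //=.
  by move=> _ [n Nn <-]; exact: h.
have vcvg x : v ^~ x @ \oo --> limn (v ^~ x).
  apply: nonincreasing_is_cvgn; first exact: nonincreasing_sups.
  by exists 0 => _ [N _ <-]; exact: le_trans (u0 N x) (uv _ _ _ (leqnn _)).
pose hb x := limn (v ^~ x).
have hbv N x : hb x <= v N x.
  by apply: (@nonincreasing_cvgn_ge _ (v ^~ x)); [exact: nonincreasing_sups|exact: (cvgP _ (vcvg x))].
have hb_ge x : K^-1 <= hb x.
  apply: (cvgr_to_ge (vcvg x)); apply: nearW => N.
  by apply: le_trans (uv N N x (leqnn _)); case/andP: (hu N x).
have hb_le x : hb x <= K by apply: le_trans (hbv 0%N x) _; exact: vle.
have hb0 x : 0 <= hb x by apply: le_trans (hb_ge x); rewrite invr_ge0 ltW.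
have lhb : log_hol B hb.
  move=> i j n ij; have hc : (fun N => v N j * expR (B * al ^+ n)) @ \oo --> hb j * expR (B * al ^+ n).
    exact: cvgMr_tmp (vcvg j).
  apply: (cvgr_to_ge hc).
  apply: nearW => N; apply: (le_trans (hbv N i)); apply: vle => k Nk.
  by apply: (le_trans (lhu k _ _ _ ij)); rewrite ler_wpM2r ?expR_ge0// uv.
(* For every [n >= N], positivity gives [u n.+1 = L (u n) <= L (v N)]; hence [v N.+1 <= L (v N)],
   and [N] tends to infinity. *)
have Lhb x : hb x <= L hb x.
  have hc := @transf_cvg g v hb vcvg x.
  apply: (cvgr_to_ge hc); apply: nearW => N.
  apply: (le_trans (hbv N.+1 x)); apply: vle => -[//|n] Nn.
  by rewrite /u iterS; apply: transf_le => y; exact: uv.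
pose Hn n := iter n L hb.
have Hnd x : nondecreasing_seq (Hn ^~ x).
  apply/nondecreasing_seqP => n; rewrite /Hn iterSr.
  by apply: transf_iter_le => y; exact: Lhb.
(* One factor [K] bounds [hb], the other bounds the iterates of the constant 1. *)
have HnK n x : Hn n x <= K * K.
  have -> : K * K = K * K * 1 by rewrite mulr1.
  apply: (@le_trans _ _ (iter n L (fun y => K * 1) x)).
    by apply: transf_iter_le => y; rewrite mulr1.
  by rewrite transf_iterZ mulr1; apply: ler_wpM2l; [exact: ltW|exact: (uK n x)].
have Hn0 n x : 0 <= Hn n x by apply: le_trans (hb0 x) _; apply: (Hnd x 0%N n).
have Hcvg x : Hn ^~ x @ \oo --> limn (Hn ^~ x).
  by apply: nondecreasing_is_cvgn => //; exists (K * K) => _ [n _ <-].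
have lHn n : log_hol B (Hn n).
  elim: n => [//|n IH]; exact: log_hol_transf.
pose h x := limn (Hn ^~ x).
have hb_h x : hb x <= h x.
  exact: (@nondecreasing_cvgn_le _ (Hn ^~ x) (Hnd x) (cvgP _ (Hcvg x)) 0%N).
exists h; split.
- apply: (@log_hol_H B (K * K)) => //.
    move=> x; apply/andP; split; first exact: le_trans (hb0 x) (hb_h x).
    by apply: (cvgr_to_le (Hcvg x)); apply: nearW => n.
  move=> i j n ij; apply: (ler_cvg_to (Hcvg i)); first exact: cvgMr_tmp (Hcvg j).
  by apply: nearW => k; exact: lHn.
- exists K^-1; split; first by rewrite invr_gt0.
  by move=> x; exact: le_trans (hb_ge x) (hb_h x).
- apply/funext => x; transitivity (limn (fun n => Hn n.+1 x)).
    by apply/esym/cvg_lim => //; exact: (@transf_cvg g Hn h Hcvg x).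
  by apply/cvg_lim => //; have := Hcvg x; rewrite -cvg_shiftS.
Qed.

End eigenfunction.

End transfer_operator.

Section geometric.
Variable R : realType.

Lemma geometric_sum_le (a : R) N : 0 <= a < 1 -> \sum_(k < N) a ^+ k <= (1 - a)^-1.
Proof.
move=> /andP[a0 a1]; have a1' : 0 < 1 - a by rewrite subr_gt0.
rewrite -[leRHS]mul1r ler_pdivlMr//.
have -> : (\sum_(k < N) a ^+ k) * (1 - a) = 1 - a ^+ N.
  elim: N => [|N IH]; first by rewrite big_ord0 mul0r expr0 subrr.
  by rewrite big_ord_recr/= mulrDl IH exprS; ring.
by rewrite lerBlDr lerDl exprn_ge0.
Qed.

Lemma expr_small (a e : R) : 0 < a < 1 -> 0 < e -> exists N, forall n, (N <= n)%N -> a ^+ n <= e.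
Proof.
move=> /andP[a0 a1] e0.
have : (fun n => a ^+ n) @ \oo --> (0 : R) by apply: cvg_expr; rewrite gtr0_norm.
move=> /cvgrPdist_le /(_ e e0) [N _ hN]; exists N => n Nn.
by have := hN n Nn; rewrite /= sub0r normrN gtr0_norm// exprn_gt0.
Qed.

(* [- ln y - (1 - y)] is at least [(sqrt y - 1)^2]. *)
Lemma ln_quadratic_bound (y D : R) : 0 < y -> y <= D ->
  1 - y + (Num.sqrt D + 1) ^- 2 * (y - 1) ^+ 2 <= - ln y.
Proof.
move=> y0 yD; set s := Num.sqrt y.
have s0 : 0 < s by rewrite sqrtr_gt0.
have ys : y = s ^+ 2 by rewrite sqr_sqrtr// ltW.
have sD : s <= Num.sqrt D by rewrite ler_wsqrtr.
have h : ln y <= 2 * (s - 1).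
  by rewrite ys lnXn// mulr2n; have := ln_le_subr1 s0; lra.
have : (Num.sqrt D + 1) ^- 2 * (y - 1) ^+ 2 <= (s - 1) ^+ 2.
  rewrite ler_pdivrMl ?exprn_gt0 ?ltr_wpDl ?sqrtr_ge0//.
  rewrite ys (_ : s ^+ 2 - 1 = (s + 1) * (s - 1)); last by ring.
  rewrite exprMn ler_wpM2r ?sqr_ge0//.
  by rewrite lerXn2r ?nnegrE ?lerD2r ?addr_ge0 ?sqrtr_ge0//; exact: ltW.
by rewrite ys in h *; nra.
Qed.

End geometric.

(** * Normalization of the potential *)

Section normalization.
Variables (R : realType) (m : nat) (mu : probability (SigMeas m) R).
Variables (f : Sig m -> R) (pr C al : R).
Hypothesis al01 : 0 < al < 1.
Hypothesis hf : holder_class al f.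
Hypothesis gib : gibbs_bound mu f pr C.
Local Notation E := (Ex mu).
Local Notation P := (Pr mu).

Let C0 : 0 < C. Proof. by case: gib => /(lt_trans ltr01). Qed.

(** The iterate is the sum of the Gibbs weights over all [n]-cylinders; each weight is comparable to
    the measure of its cylinder, and the measures sum to one. *)
Lemma transf_iter_bound n x :
  C^-1 <= iter n (transf (fun y => f y - pr)) (fun=> 1) x <= C.
Proof.
have -> : iter n (transf (fun y => f y - pr)) (fun=> 1) x =
    \sum_(w : n.-tuple 'I_m.+1) gibbs_weight f pr n (scat w x).
  rewrite transf_iterE; apply: eq_bigr => w _; rewrite mulr1; congr expR.
  by rewrite /birkhoff sumrB sumr_const card_ord addrC mulr_natl.
have cylw (w : n.-tuple 'I_m.+1) : pcyl (scat w x) n = cyl w.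
  rewrite cyl_pcyl; apply: pcyl_agree; rewrite -[X in agree _ _ X](size_tuple w).
  exact: agree_scat0.
have S1 := sum_Pr_cyl mu n.
apply/andP; split.
  rewrite -[leLHS]mulr1 -S1 mulr_sumr; apply: ler_sum => w _.
  by rewrite ler_pdivrMl// -cylw; exact: gibbs_upper gib _ _.
rewrite -[leRHS]mulr1 -S1 mulr_sumr; apply: ler_sum => w _.
by rewrite -ler_pdivrMl// -cylw; exact: gibbs_lower gib _ _.
Qed.

(** With [h] the eigenfunction and [w = ln h], adding the coboundary of [w] conjugates the operator
    by [h] and sends the eigenvector to 1. Birkhoff sums change by at most [2 * M], which only
    enlarges the Gibbs constant. *)
Lemma exists_normalized_potential : exists g w : Sig m -> R,
  [/\ holder_class al g, holder_class al w, transf g (fun=> 1) = (fun=> 1),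
      forall x, f x = g x + pr - w x + w (shift x) &
      exists C', gibbs_bound mu g 0 C'].
Proof.
have hfp : holder_class al (fun y => f y - pr) by apply: HB => //; exact: H_cst.
have [h [Hh [c [c0 ch]] Lh]] := exists_eigenfunction al01 hfp C0 transf_iter_bound.
have h0 x : 0 < h x by exact: lt_le_trans (ch x).
pose w x := ln (h x); have Hw : holder_class al w by exact: H_ln ch Hh.
pose g x := f x - pr + w x - w (shift x).
have Hg : holder_class al g.
  by apply: HB; [apply: HD|exact: H_shift].
exists g, w; split => //.
- apply/funext => x; have := congr1 (fun p => p x) Lh; rewrite /transf => hx.
  have -> : \sum_(a < m.+1) expR (g (scons a x)) * 1 =
      (\sum_(a < m.+1) expR (f (scons a x) - pr) * h (scons a x)) * (h x)^-1.
    rewrite mulr_suml; apply: eq_bigr => a _.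
    by rewrite mulr1 /g expRB expRD /w shift_scons !lnK ?posrE.
  by rewrite hx divff// gt_eqF.
- by move=> x; rewrite /g; ring.
- have [M [M0 wM]] := H_bdd Hw.
  have bg n x : birkhoff g n x = birkhoff f n x - n%:R * pr + w x - w (iter n (@shift m) x).
    elim: n x => [|n IH] x; first by rewrite /birkhoff !big_ord0 mul0r /=; ring.
    by rewrite !birkhoffS IH /g -natr1 iterSr; ring.
  have M1 : 1 <= expR (2 * M) by rewrite -expR0 ler_expR mulr_ge0// ltW.
  exists (C * expR (2 * M)); split.
    by have [C1 _] := gib; rewrite (lt_le_trans C1)// ler_peMr// ltW.
  move=> n i; rewrite /gibbs_weight mulr0 oppr0 add0r bg.
  have := wM i; have := wM (iter n (@shift m) i); rewrite !ler_norml => /andP[w1 w2] /andP[w3 w4].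
  apply/andP; split.
    apply: le_trans (gibbs_lower gib n i); rewrite invfM -expRN -mulrA -expRD.
    by rewrite ler_wpM2l ?invr_ge0 ?(ltW C0)// ler_expR; lra.
  apply: le_trans (gibbs_upper gib n i) _; rewrite -mulrA -expRD.
  by rewrite ler_wpM2l ?(ltW C0)// ler_expR; lra.
Qed.

End normalization.

(** * Invariance of the measure under the dual of the normalized operator *)

Section transfer_invariance.
Variables (R : realType) (m : nat) (mu : probability (SigMeas m) R).
Variables (g : Sig m -> R) (C al : R).
Hypothesis al01 : 0 < al < 1.
Hypothesis hg : holder_class al g.
Hypothesis g1 : transf g (fun=> 1) = (fun=> 1).
Hypothesis gib : gibbs_bound mu g 0 C.
Hypothesis inv : forall A : set (SigMeas m), measurable A -> mu ((@shift m) @^-1` A) = mu A.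
Local Notation E := (Ex mu).
Local Notation P := (Pr mu).
Local Notation L := (transf g).

Let C0 : 0 < C. Proof. by case: gib => /(lt_trans ltr01). Qed.

(* [back_ratio n i] is the inverse of the conditional probability of [i 0] given [i 1, ..., i n]. *)
Let back_ratio n i := P (pcyl (shift i) n) / P (pcyl i n.+1).
(** The likelihood ratio between the transition weight prescribed by [g] and the actual conditional
    probability of the first symbol given the next [n] ones. *)
Let Y n i := expR (g i) * back_ratio n i.

Let back_ratio_agree n i j : agree i j n.+1 -> back_ratio n i = back_ratio n j.
Proof.
by move=> ij; rewrite /back_ratio (pcyl_agree ij) (pcyl_agree (agree_shift ij)).
Qed.

Let gw_le n i : P (pcyl (shift i) n) * expR (g i) <= C ^+ 2 * P (pcyl i n.+1).
Proof.
have h1 := gibbs_upper gib n (shift i); have h2 := gibbs_lower gib n.+1 i.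
move: h1 h2; rewrite /gibbs_weight !mulr0 !oppr0 !add0r birkhoffS expRD => h1 h2.
apply: (@le_trans _ _ (C * expR (birkhoff g n (shift i)) * expR (g i))).
  by rewrite ler_wpM2r// expR_ge0.
have -> : C * expR (birkhoff g n (shift i)) * expR (g i) =
   C ^+ 2 * (C^-1 * (expR (g i) * expR (birkhoff g n (shift i)))).
  by have := lt0r_neq0 C0 => ?; field.
by rewrite ler_wpM2l// exprn_ge0// ltW.
Qed.

Let Y_le n i : Y n i <= C ^+ 2.
Proof.
rewrite /Y /back_ratio mulrA ler_pdivrMr ?(Pr_pcyl_gt0 gib)// [leLHS]mulrC.
exact: gw_le.
Qed.

Let Y_gt0 n i : 0 < Y n i.
Proof. by rewrite mulr_gt0 ?expR_gt0// divr_gt0// (Pr_pcyl_gt0 gib). Qed.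

Let bmg : bm (fun x : SigMeas m => expR (g x)).
Proof. by apply: bm_expR; exact: H_bm hg. Qed.

Let bm_back_ratio n : bm (back_ratio n : SigMeas m -> R).
Proof. by apply: (@bm_cyl _ _ n.+1) => i j; exact: back_ratio_agree. Qed.

Let bmY n : bm (Y n : SigMeas m -> R).
Proof. exact: bmM. Qed.

Let back_ratio_bound : exists D : R, 0 < D /\ forall n i, 0 <= back_ratio n i <= D.
Proof.
have [M [M0 hM]] := H_bdd hg; exists (C ^+ 2 * expR M); split.
  by rewrite mulr_gt0 ?expR_gt0 ?exprn_gt0.
move=> n i; apply/andP; split; first by rewrite divr_ge0 ?Pr_ge0.
have := Y_le n i; rewrite /Y mulrC -ler_pdivlMr ?expR_gt0// -expRN => /le_trans; apply.
rewrite ler_wpM2l ?exprn_ge0 ?(ltW C0)// ler_expR lerNl.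
by have := hM i; rewrite ler_norml => /andP[].
Qed.

Lemma cyl_tuple n (a : 'I_m.+1) (w : n.-tuple 'I_m.+1) :
  cyl [tuple of a :: w] = pcyl (pt (a :: w)) n.+1.
Proof. by rewrite cyl_pcyl. Qed.

(** Multiplying by [back_ratio] cancels the conditional probability of the first symbol, so summing
    over that symbol produces exactly [L p] at the points [pt w]; freezing the far symbols costs
    [O (al ^+ n)]. *)
Let Ex_mul_Y p : holder_class al p -> exists K : R, 0 <= K /\
  forall n, `|E (fun x => p x * Y n x) - E (L p)| <= K * al ^+ n.
Proof.
move=> hp; pose z x := p x * expR (g x).
have Hz : holder_class al z by apply: HM => //; exact: H_expR.
have [b hb] := Hz; have b0 := hol_ge0 hb.
have [D [D0 hD]] := back_ratio_bound.
have HLp : holder_class al (L p) by exact: H_transf.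
have [b' hb'] := HLp; have b'0 := hol_ge0 hb'.
exists (b * D + b'); split; first by rewrite addr_ge0// mulr_ge0// ltW.
move=> n; have al0 : 0 <= al by case/andP: al01 => /ltW.
pose zr x := z (proj n.+1 x) * back_ratio n x.
have zr_cyl i j : agree i j n.+1 -> zr i = zr j.
  by move=> ij; rewrite /zr (proj_agree ij) (back_ratio_agree ij).
have -> : E (fun x => p x * Y n x) = E (fun x => z x * back_ratio n x).
  by apply: eq_Ex => x; rewrite /Y /z mulrA.
have h1 : `|E (fun x => z x * back_ratio n x) - E zr| <= b * al ^+ n * D.
  apply: Ex_dist_le.
  - by apply: bmM => //; exact: H_bm Hz.
  - exact: (bm_cyl zr_cyl).
  - move=> x; rewrite /zr -mulrBl normrM.
    have /andP[r0 rD] := hD n x; rewrite [`|back_ratio _ _|]ger0_norm//.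
    apply: ler_pM => //; apply: le_trans (hb _ _ n.+1 _) _.
      by apply: agree_sym; exact: agree_proj.
    rewrite ler_wpM2l// exprS -[leRHS]mul1r ler_wpM2r ?exprn_ge0//.
    by case/andP: al01 => _ /ltW.
have h2 : E zr = \sum_(w : n.-tuple 'I_m.+1) P (cyl w) * L p (pt w).
  rewrite (Ex_cyl _ zr_cyl) sum_tupleS exchange_big/=; apply: eq_bigr => w _.
  rewrite /transf mulr_sumr; apply: eq_bigr => a _.
  rewrite /zr -pt_cons proj_pt; last by rewrite /= size_tuple.
  rewrite cyl_tuple /back_ratio pt_cons shift_scons cyl_pcyl /z.
  by field; rewrite gt_eqF// (Pr_pcyl_gt0 gib).
have := Ex_hol_cyl mu n al01 hb'; rewrite -h2 => h3.
apply: le_trans (ler_distD (E zr) _ _) _.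
rewrite (distrC (E zr)) mulrDl; apply: lerD; last exact: h3.
by have -> : b * D * al ^+ n = b * al ^+ n * D by ring.
Qed.

(** By invariance of [mu] the [n]-th term is [a n.+1 - a n - E g]. The sum is thus the mean of
    [ln P (pcyl x N)] minus the Birkhoff sum, which the upper Gibbs bound keeps below [ln C]. *)
Let sum_entropy N : \sum_(n < N) E (fun x => - ln (Y n x)) <= ln C.
Proof.
pose a n := E (fun x => ln (P (pcyl x n))).
have bma n : bm (fun x : SigMeas m => ln (P (pcyl x n)) : R).
  by apply: (@bm_cyl _ _ n) => i j ij; rewrite (pcyl_agree ij).
have bmgg : bm (g : SigMeas m -> R) by exact: H_bm hg.
have mshift := @measurable_shift m.
have step n : E (fun x => - ln (Y n x)) = a n.+1 - a n - E g.
  have -> : a n = E (fun x => ln (P (pcyl (shift x) n))).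
    by rewrite /a (Ex_comp mshift inv (bma n)).
  have bms : bm (fun x : SigMeas m => ln (P (pcyl (shift x) n)) : R) by exact: (bm_iter mshift 1 (bma n)).
  rewrite -!ExB//; last exact: bmB.
  apply: eq_Ex => x; rewrite /Y /back_ratio lnM ?posrE ?expR_gt0 ?divr_gt0 ?(Pr_pcyl_gt0 gib)//.
  by rewrite expRK ln_div ?posrE ?(Pr_pcyl_gt0 gib)//; ring.
have -> : \sum_(n < N) E (fun x => - ln (Y n x)) = a N - a 0%N - N%:R * E g.
  elim: N => [|N IH]; first by rewrite big_ord0; ring.
  by rewrite big_ord_recr/= IH step -natr1; ring.
have -> : a 0%N = 0.
  rewrite -(Ex_cst mu 0); apply: eq_Ex => x.
  by rewrite (_ : pcyl x 0 = setT) ?PrT ?ln1//; apply/seteqP; split.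
have -> : N%:R * E g = E (birkhoff g N).
  rewrite /birkhoff Ex_sum => [|k _]; last exact: (bm_iter mshift k bmgg).
  rewrite (eq_bigr (fun=> E g)) ?sumr_const ?card_ord ?mulr_natl// => k _.
  exact: Ex_iter.
have hS : holder_class al (birkhoff g N) by exact: H_birkhoff.
have bmS : bm (birkhoff g N : SigMeas m -> R) by exact: H_bm hS.
suff : a N <= ln C + E (birkhoff g N) by lra.
rewrite -[X in X + _](Ex_cst mu) -ExD//; last exact: bm_cst.
apply: Ex_le => //; first by apply: bmD => //; exact: bm_cst.
move=> x; have := gibbs_upper gib N x; rewrite /gibbs_weight mulr0 oppr0 add0r => h.
rewrite -[X in _ + X]expRK -lnM ?posrE ?expR_gt0// ler_ln ?posrE ?(Pr_pcyl_gt0 gib)//.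
by rewrite mulr_gt0 ?expR_gt0.
Qed.

(** Since [Y] is at most [C ^+ 2], [- ln Y] dominates [1 - Y] plus a fixed multiple of the square of
    [Y - 1]. The means of [1 - Y n] are summable by [Ex_mul_Y] at [p = 1], so the second moments
    have bounded partial sums and cannot stay above [e]. *)
Let second_moment_small (e : R) N0 : 0 < e ->
  exists n, (N0 <= n)%N /\ E (fun x => (Y n x - 1) ^+ 2) <= e.
Proof.
move=> e0; have [K [K0 hK]] := Ex_mul_Y (H_cst m al 1).
pose k := (Num.sqrt (C ^+ 2) + 1) ^- 2.
have k0 : 0 < k by rewrite invr_gt0 exprn_gt0// ltr_wpDl ?sqrtr_ge0.
have bmY2 n : bm (fun x : SigMeas m => (Y n x - 1) ^+ 2).
  have b1 : bm (fun x : SigMeas m => Y n x - 1) by apply: bmB => //; exact: bm_cst.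
  exact: bmM.
have bmln n : bm (fun x : SigMeas m => - ln (Y n x)).
  have -> : (fun x : SigMeas m => - ln (Y n x)) = (fun x => (ln (P (pcyl x n.+1)) - ln (P (pcyl (shift x) n))) - g x).
    apply/funext => x; rewrite /Y /back_ratio lnM ?posrE ?expR_gt0 ?divr_gt0 ?(Pr_pcyl_gt0 gib)//.
    by rewrite expRK ln_div ?posrE ?(Pr_pcyl_gt0 gib)//; ring.
  apply: bmB; last exact: H_bm hg.
  apply: (@bm_cyl _ _ n.+1) => i j ij.
  by rewrite (pcyl_agree ij) (pcyl_agree (agree_shift ij)).
have lo n : k * E (fun x => (Y n x - 1) ^+ 2) - K * al ^+ n <= E (fun x => - ln (Y n x)).
  have h1 : `|E (Y n) - 1| <= K * al ^+ n.
    have := hK n; rewrite g1 Ex_cst; congr (`|_ - _| <= _).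
    by apply: eq_Ex => x; rewrite mul1r.
  have : E (fun x => 1 - Y n x + k * (Y n x - 1) ^+ 2) <= E (fun x => - ln (Y n x)).
    apply: Ex_le => //; first by apply: bmD; [apply: bmB => //; exact: bm_cst|exact: bmZ].
    by move=> x; apply: ln_quadratic_bound.
  rewrite ExD; [|by apply: bmB => //; exact: bm_cst|exact: bmZ].
  rewrite ExZ// ExB//; last exact: bm_cst.
  rewrite Ex_cst; move: h1; rewrite ler_norml => /andP[h1 h2]; lra.
apply: contrapT => no.
have big n : (N0 <= n)%N -> e <= E (fun x => (Y n x - 1) ^+ 2).
  by move=> Nn; apply: contrapT => /negP; rewrite -ltNge => /ltW h; apply: no; exists n.
have sumlow M : k * (M%:R * e) - K * (1 - al)^-1 <= ln C.
  apply: (@le_trans _ _ (\sum_(n < N0 + M) E (fun x => - ln (Y n x)))); last exact: sum_entropy.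
  apply: (@le_trans _ _ (\sum_(n < N0 + M) (k * E (fun x => (Y n x - 1) ^+ 2) - K * al ^+ n))); last first.
    exact: ler_sum.
  rewrite sumrB -!mulr_sumr lerB//.
    rewrite ler_wpM2l ?(ltW k0)// big_split_ord/= -[leLHS]add0r lerD//.
      by apply: sumr_ge0 => n _; apply: Ex_ge0 => x; exact: sqr_ge0.
    rewrite mulr_natl -[X in _ *+ X]card_ord -sumr_const; apply: ler_sum => n _.
    by apply: big; exact: leq_addr.
  rewrite ler_wpM2l// geometric_sum_le//.
  by case/andP: al01 => /ltW -> ->.
pose T := (ln C + K * (1 - al)^-1) / (k * e).
have ke0 : 0 < k * e by exact: mulr_gt0.
have := sumlow (Num.bound `|T|).
have : T < (Num.bound `|T|)%:R.
  exact: le_lt_trans (ler_norm T) (archi_boundP (normr_ge0 T)).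
rewrite /T ltr_pdivrMr//; lra.
Qed.

(* [E (p Y_n) = E (L p) + O(al^n)], while the relative entropies [E (- ln Y_n)] have bounded partial
   sums by telescoping, so that [Y_n] tends to [1] in [L^2] along a subsequence. *)
Lemma Ex_transf p : holder_class al p -> E (L p) = E p.
Proof.
move=> hp; have [K [K0 hK]] := Ex_mul_Y hp.
have [M [M0 hM]] := H_bdd hp.
have bmp : bm (p : SigMeas m -> R) by exact: H_bm hp.
apply/eqP; rewrite -subr_eq0 -normr_le0.
apply/ler_addgt0Pl => e e0; rewrite addr0.
(* A second moment below the square of [eta] makes the mean of the absolute value of [Y n x - 1] at
   most [2 * eta] by Young's inequality; this costs [2 * M * eta], and [Ex_mul_Y] costs
   [K * eta]. *)
pose eta := e / (1 + 2 * M + K).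
have den0 : 0 < 1 + 2 * M + K by lra.
have eta0 : 0 < eta by exact: divr_gt0.
have [N0 hN0] := expr_small al01 eta0.
have [n [Nn hn]] := second_moment_small N0 (mulr_gt0 eta0 eta0).
have bY1 : bm (fun x : SigMeas m => Y n x - 1) by apply: bmB => //; exact: bm_cst.
have bY2 : bm (fun x : SigMeas m => (Y n x - 1) ^+ 2) by exact: bmM.
have h1 := hK n; have h2 := hN0 n Nn.
have h3 : `|E (fun x => p x * Y n x) - E p| <= 2 * M * eta.
  rewrite -ExB//; last exact: bmM.
  have -> : E (fun x => p x * Y n x - p x) = E (fun x => p x * (Y n x - 1)).
    by apply: eq_Ex => x; ring.
  have bq : bm (fun x : SigMeas m => M * (eta + eta^-1 * (Y n x - 1) ^+ 2)).
    by apply: bmZ; apply: bmD; [exact: bm_cst|exact: bmZ].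
  have le1 x : `|p x * (Y n x - 1)| <= M * (eta + eta^-1 * (Y n x - 1) ^+ 2).
    rewrite normrM ler_pM// -[(Y n x - 1) ^+ 2]real_normK ?num_real//.
    set y := `|_|; have y0 : 0 <= y by exact: normr_ge0.
    rewrite -(ler_pM2l eta0) (_ : eta * (_ + _) = eta ^+ 2 + y ^+ 2); last by field; rewrite gt_eqF.
    by have := sqr_ge0 (y - eta); nra.
  have le2 : E (fun x => M * (eta + eta^-1 * (Y n x - 1) ^+ 2)) <= 2 * M * eta.
    rewrite ExZ; last by apply: bmD; [exact: bm_cst|exact: bmZ].
    rewrite ExD; [|exact: bm_cst|exact: bmZ].
    rewrite Ex_cst ExZ//.
    have : eta^-1 * E (fun x => (Y n x - 1) ^+ 2) <= eta by rewrite ler_pdivrMl.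
    by nra.
  have bpY : bm (fun x : SigMeas m => p x * (Y n x - 1)) by exact: bmM.
  rewrite ler_norml; apply/andP; split.
    rewrite lerNl -ExN//; apply: le_trans le2; apply: Ex_le => //; first exact: bmN.
    by move=> x; apply: le_trans (le1 x); rewrite -normrN ler_norm.
  apply: le_trans le2; apply: Ex_le => // x.
  by apply: le_trans (le1 x); rewrite ler_norm.
have h4 : K * al ^+ n <= K * eta by rewrite ler_wpM2l.
have -> : e = (1 + 2 * M + K) * eta by rewrite mulrC divfK// gt_eqF.
apply: le_trans (ler_distD (E (fun x => p x * Y n x)) _ _) _.
rewrite [X in X + _]distrC; nra.
Qed.

End transfer_invariance.

(** * Contraction of the transfer operator and the Poisson equation *)

Section poisson_equation.
Variables (R : realType) (m : nat) (mu : probability (SigMeas m) R).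
Variables (g : Sig m -> R) (al : R).
Hypothesis al01 : 0 < al < 1.
Hypothesis hg : holder_class al g.
Hypothesis g1 : transf g (fun=> 1) = (fun=> 1).
Hypothesis ExL : forall p, holder_class al p -> Ex mu (transf g p) = Ex mu p.
Local Notation L := (transf g).
Implicit Types (p : Sig m -> R) (A B H v : R).

Let al0 : 0 < al. Proof. by case/andP: al01. Qed.
Let al1 : al < 1. Proof. by case/andP: al01. Qed.

Definition osc_le A p := forall i j : Sig m, `|p i - p j| <= A.

Lemma osc_range A p : osc_le A p -> exists l, forall x, l <= p x <= l + A.
Proof.
move=> hp; exists (inf (range p)) => x.
have lb : has_lbound (range p).
  exists (p (fun=> ord0) - A) => _ [y _ <-].
  by have := hp (fun=> ord0) y; rewrite ler_norml => /andP[_]; lra.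
apply/andP; split; first by apply: ge_inf => //; exists x.
rewrite -lerBlDr; apply: lb_le_inf; first by exists (p x), x.
by move=> _ [y _ <-]; have := hp x y; rewrite ler_norml => /andP[_]; lra.
Qed.

Section words.
Variable N : nat.
Let W (w : N.-tuple 'I_m.+1) x := expR (birkhoff g N (scat w x)).

Lemma sum_transf_weight x : \sum_(w : N.-tuple 'I_m.+1) W w x = 1.
Proof.
have : iter N L (fun=> 1) x = 1.
  by elim: (N) => [//|n IH]; rewrite iterSr g1.
by rewrite transf_iterE; under eq_bigr do rewrite mulr1.
Qed.

Variables (b : R).
Hypothesis hgb : hol al b g.
Let B := b / (1 - al).

Let B0 : 0 <= B.
Proof. by rewrite divr_ge0 ?(hol_ge0 hgb)// subr_ge0 ltW. Qed.

Let birk_dist (w : N.-tuple 'I_m.+1) x y k : agree x y k ->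
  `|birkhoff g N (scat w x) - birkhoff g N (scat w y)| <= B * al ^+ k.
Proof.
move=> xy; apply: birkhoff_hol => //.
by have := @agree_scat _ w _ _ _ xy; rewrite size_tuple.
Qed.

Let alk k : 0 <= al ^+ k <= 1.
Proof. by apply/andP; split; [exact/exprn_ge0/ltW|apply: exprn_ile1; exact: ltW]. Qed.

Let W_ge (w : N.-tuple 'I_m.+1) x y : expR (- B) * W w y <= W w x.
Proof.
rewrite -expRD ler_expR.
have := @birk_dist w x y 0%N (fun k => ltac:(by [])); rewrite expr0 mulr1 ler_norml => /andP[]; lra.
Qed.

Let W_dist (w : N.-tuple 'I_m.+1) x y k : agree x y k ->
  `|W w x - W w y| <= W w y * (expR B * B * al ^+ k).
Proof.
move=> xy; have := birk_dist w xy; set s := birkhoff _ _ _; set t := birkhoff _ _ _ => st.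
have tB : s <= t + B.
  have /andP[a0 a1] := alk k; move: st; rewrite ler_norml => /andP[_].
  have : B * al ^+ k <= B by rewrite ler_piMr.
  by lra.
have tt : t <= t + B by rewrite lerDl.
apply: le_trans (expR_dist_le tB tt) _.
rewrite expRD -!mulrA; apply: ler_wpM2l; first exact: expR_ge0.
apply: ler_wpM2l; first exact: expR_ge0.
by rewrite mulrA.
Qed.

Let avg_dist p x y c : (forall w : N.-tuple 'I_m.+1, `|p (scat w x) - p (scat w y)| <= c) ->
  `|\sum_(w : N.-tuple 'I_m.+1) W w x * (p (scat w x) - p (scat w y))| <= c.
Proof.
move=> hc; apply: le_trans (ler_norm_sum _ _ _) _.
rewrite -[leRHS]mul1r -(sum_transf_weight x) mulr_suml; apply: ler_sum => w _.
by rewrite normrM [`|W w x|]gtr0_norm ?expR_gt0// ler_wpM2l ?expR_ge0.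
Qed.

Let split_diff p x y : iter N L p x - iter N L p y =
  \sum_(w : N.-tuple 'I_m.+1) W w x * (p (scat w x) - p (scat w y)) +
  \sum_(w : N.-tuple 'I_m.+1) (W w x - W w y) * p (scat w y).
Proof.
by rewrite !transf_iterE -big_split -sumrB; apply: eq_bigr => w _ /=; rewrite /W; ring.
Qed.

(** An inequality of Doeblin-Fortet type. The weights at [x] and at [y] have the same total mass, so
    a constant may be subtracted from [p]; this is why the oscillation, not the supremum, multiplies
    the distortion. *)
Lemma transf_iter_hol p A H : osc_le A p -> hol al H p ->
  hol al (H * al ^+ N + A * (expR B * B)) (iter N L p).
Proof.
move=> hA hH x y k xy; rewrite split_diff (le_trans (ler_normD _ _))// mulrDl lerD//.
  apply: avg_dist => w; have := hH _ _ _ (@agree_scat _ w _ _ _ xy).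
  by rewrite size_tuple exprD mulrA.
have [l hl] := osc_range hA.
have -> : \sum_(w : N.-tuple 'I_m.+1) (W w x - W w y) * p (scat w y) =
    \sum_(w : N.-tuple 'I_m.+1) (W w x - W w y) * (p (scat w y) - l).
  under [RHS]eq_bigr do rewrite mulrBr.
  by rewrite sumrB -mulr_suml sumrB !sum_transf_weight subrr mul0r subr0.
apply: le_trans (ler_norm_sum _ _ _) _.
rewrite -[leRHS]mul1r -(sum_transf_weight y) mulr_suml; apply: ler_sum => w _.
rewrite normrM; have /andP[l1 l2] := hl (scat w y).
have pA : `|p (scat w y) - l| <= A by rewrite ger0_norm; lra.
have -> : W w y * (A * (expR B * B) * al ^+ k) = W w y * (expR B * B * al ^+ k) * A by ring.
by apply: ler_pM => //; exact: W_dist.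
Qed.

(** Doeblin's argument: with [c = expR (- B)], a share [c] of the weights at [y] is dominated by
    those at [x] and cancels, so only the mass [1 - c] sees the oscillation of [p]. *)
Lemma transf_iter_osc p A H : osc_le A p -> hol al H p ->
  osc_le (H * al ^+ N + (1 - expR (- B)) * A) (iter N L p).
Proof.
move=> hA hH.
suff step x y : iter N L p x - iter N L p y <= H * al ^+ N + (1 - expR (- B)) * A.
  by move=> x y; rewrite ler_norml lerNl opprB !step.
rewrite split_diff lerD//.
  apply: le_trans (ler_norm _) _; apply: avg_dist => w.
  by have := hH _ _ _ (@agree_scat0 _ w x y); rewrite size_tuple.
have [l hl] := osc_range hA.
set c := expR (- B).
have c1 : 0 <= 1 - c by rewrite subr_ge0 -expR0 ler_expR oppr_le0.
have -> : \sum_(w : N.-tuple 'I_m.+1) (W w x - W w y) * p (scat w y) =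
    \sum_(w : N.-tuple 'I_m.+1) (W w x - c * W w y) * p (scat w y)
    - (1 - c) * \sum_(w : N.-tuple 'I_m.+1) W w y * p (scat w y).
  by rewrite mulr_sumr -sumrB; apply: eq_bigr => w _; ring.
have h1 : \sum_(w : N.-tuple 'I_m.+1) (W w x - c * W w y) * p (scat w y) <= (1 - c) * (l + A).
  have -> : 1 - c = \sum_(w : N.-tuple 'I_m.+1) (W w x - c * W w y).
    by rewrite sumrB -mulr_sumr !sum_transf_weight mulr1.
  rewrite mulr_suml; apply: ler_sum => w _; rewrite ler_wpM2l ?subr_ge0 ?W_ge//.
  by case/andP: (hl (scat w y)).
have h2 : l <= \sum_(w : N.-tuple 'I_m.+1) W w y * p (scat w y).
  rewrite -[leLHS]mul1r -(sum_transf_weight y) mulr_suml; apply: ler_sum => w _.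
  rewrite ler_wpM2l ?expR_ge0//; by case/andP: (hl (scat w y)).
have : (1 - c) * l <= (1 - c) * \sum_(w : N.-tuple 'I_m.+1) W w y * p (scat w y) by rewrite ler_wpM2l.
by move: h1; nra.
Qed.

End words.

(** Phrased through admissible bounds, which avoids handling the optimal oscillation and the optimal
    Hoelder constant as suprema. *)
Definition mixed_seminorm_le (k v : R) p := exists A H, [/\ osc_le A p, hol al H p & A + k * H <= v].

(* [L^N] contracts oscillations because its weights are comparable at all points, and contracts
   Hoelder constants up to a multiple of the oscillation; hence the mixed seminorm. *)
Lemma transf_contraction : exists N (k th : R), [/\ 0 < k, 0 < th < 1 &
  forall p v, mixed_seminorm_le k v p -> mixed_seminorm_le k (th * v) (iter N L p)].
Proof.
case: hg => b hgb; pose B := b / (1 - al); pose c := expR (- B); pose B' := expR B * B.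
have B0 : 0 <= B by rewrite divr_ge0 ?(hol_ge0 hgb)// subr_ge0 ltW.
have B'0 : 0 <= B' by rewrite mulr_ge0 ?expR_ge0.
have c0 : 0 < c by exact: expR_gt0.
have c1 : c <= 1 by rewrite -expR0 ler_expR oppr_le0.
(* With this weight the oscillation re-entering through the Hoelder constant, [k * B'], uses at most
   half of the gain [c]. *)
pose k := c / (2 * (B' + 1)).
have k0 : 0 < k by rewrite divr_gt0// mulr_gt0// ltr_wpDl.
have kB : k * B' <= c / 2.
  rewrite /k mulrAC ler_pdivrMr ?mulr_gt0 ?ltr_wpDl//; nra.
have th0 : 0 < 1 - c / 2 by lra.
(* The Hoelder constant enters both components with the factor [al ^+ N]; this [N] gives
   [al ^+ N * (1 + k) <= k * (1 - c / 2)]. *)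
have [N hN] := expr_small al01 (divr_gt0 (mulr_gt0 k0 th0) (ltr_pwDl ltr01 (ltW k0))).
have k1 : 0 < 1 + k by lra.
have := hN N (leqnn _); rewrite ler_pdivlMr// => {}hN.
exists N, k, (1 - c / 2); split => //; first by apply/andP; split => //; lra.
move=> p v [A [H [hA hH AH]]].
exists (H * al ^+ N + (1 - c) * A), (H * al ^+ N + A * B'); split.
- exact: transf_iter_osc hA hH.
- exact: transf_iter_hol hA hH.
- have A0 : 0 <= A by apply: le_trans (hA (fun=> ord0) (fun=> ord0)).
  have H0 := hol_ge0 hH.
  apply: (@le_trans _ _ ((1 - c / 2) * (A + k * H))); last by rewrite ler_wpM2l// ltW.
  have : H * (al ^+ N * (1 + k)) <= H * (k * (1 - c / 2)) by rewrite ler_wpM2l.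
  have : A * (k * B') <= A * (c / 2) by rewrite ler_wpM2l.
  by lra.
Qed.

Lemma H_transf_iter p n : holder_class al p -> holder_class al (iter n L p).
Proof. by move=> hp; elim: n => //= n IH; exact: H_transf. Qed.

Lemma Ex_transf_iter p n : holder_class al p -> Ex mu (iter n L p) = Ex mu p.
Proof. by move=> hp; elim: n => //= n IH; rewrite ExL//; exact: H_transf_iter. Qed.

Lemma osc_mean p A x : osc_le A p -> holder_class al p -> `|p x - Ex mu p| <= A.
Proof.
move=> hA hp; rewrite -[p x in X in X <= _](Ex_cst mu); apply: Ex_dist_le => //.
  exact: bm_cst.
exact: H_bm hp.
Qed.

Lemma transf_iter_sum n (F : nat -> Sig m -> R) N x :
  iter n L (fun y => \sum_(q < N) F q y) x = \sum_(q < N) iter n L (F q) x.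
Proof.
rewrite transf_iterE; under [RHS]eq_bigr do rewrite transf_iterE.
by rewrite exchange_big; apply: eq_bigr => w _; rewrite mulr_sumr.
Qed.

Lemma transf_iter_cvg (U : nat -> Sig m -> R) p n : (forall x, U ^~ x @ \oo --> p x) ->
  forall x, (fun k => iter n L (U k) x) @ \oo --> iter n L p x.
Proof.
by move=> h; elim: n => //= n IH x; apply: (transf_cvg (U := fun k => iter n L (U k))).
Qed.

(** A Neumann series in [L ^ N]: the iterates keep mean zero, so [osc_mean] bounds them by their
    oscillation and they decay geometrically. The sum inverts [1 - L ^ N]. *)
Lemma poisson_equation p : holder_class al p -> Ex mu p = 0 ->
  exists G, holder_class al G /\ forall x, G x - L G x = p x.
Proof.
move=> hp Ep0; have [N [k [th [k0 th01 hV]]]] := transf_contraction.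
have /andP[th0 th1] := th01.
pose T (q : nat) := iter q (iter N L) p.
have HT (q : nat) : holder_class al (T q) by elim: q => //= q IH; exact: H_transf_iter.
have ET (q : nat) : Ex mu (T q) = 0 by elim: q => //= q IH; rewrite Ex_transf_iter.
have [v hv] : exists v, mixed_seminorm_le k v p.
  by case: hp => b hb; exists (b + k * b), b, b; split => // i j; exact: hol_osc hb.
have VT (q : nat) : mixed_seminorm_le k (th ^+ q * v) (T q).
  elim: q => [|q IH]; first by rewrite expr0 mul1r.
  by rewrite exprS -mulrA; exact: hV.
have Tx (q : nat) x : `|T q x| <= th ^+ q * v.
  have [A [H [hA hH AH]]] := VT q.
  have := osc_mean x hA (HT q); rewrite ET subr0 => /le_trans; apply.
  by apply: le_trans AH; rewrite lerDl mulr_ge0 ?(ltW k0)// (hol_ge0 hH).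
have Th (q : nat) i j n : agree i j n -> `|T q i - T q j| <= th ^+ q * v / k * al ^+ n.
  move=> ij; have [A [H [hA hH AH]]] := VT q.
  apply: le_trans (hH _ _ _ ij) _; rewrite ler_wpM2r ?exprn_ge0 ?(ltW al0)//.
  rewrite ler_pdivlMr// mulrC; apply: le_trans AH; rewrite lerDr.
  exact: le_trans (hA (fun=> ord0) (fun=> ord0)).
have v0 : 0 <= v by have := Tx 0%N (fun=> ord0); rewrite expr0 mul1r; exact: le_trans.
pose S n x := \sum_(q < n) T q x.
have Scvg x : S ^~ x @ \oo --> limn (S ^~ x).
  have : cvgn (series (fun q => T q x)).
    apply: normed_cvg; apply: (@series_le_cvg _ _ (fun q => v * th ^+ q)).
    - by move=> q /=.
    - by move=> q /=; apply: mulr_ge0 => //; exact/exprn_ge0/ltW.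
    - by move=> q /=; rewrite mulrC.
    - by apply: is_cvg_geometric_series; rewrite gtr0_norm.
  rewrite (_ : series _ = S ^~ x)//.
  by apply/funext => n; rewrite /series /S /= big_mkord.
pose G0 x := limn (S ^~ x).
have hS n : hol al (v / k * (1 - th)^-1) (S n).
  move=> i j l ij; rewrite /S -sumrB (le_trans (ler_norm_sum _ _ _))//.
  apply: (@le_trans _ _ (\sum_(q < n) v / k * al ^+ l * th ^+ q)).
    apply: ler_sum => q _; apply: le_trans (Th q _ _ _ ij) _.
    by rewrite le_eqVlt; apply/orP; left; apply/eqP; ring.
  rewrite -mulr_sumr [leRHS]mulrAC; apply: ler_wpM2l.
    by apply: mulr_ge0; [exact/divr_ge0/ltW|exact/exprn_ge0/ltW].
  by apply: geometric_sum_le; rewrite (ltW th0).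
have HG0 : holder_class al G0.
  exists (v / k * (1 - th)^-1) => i j l ij.
  have hc : (fun n => `|S n i - S n j|) @ \oo --> `|G0 i - G0 j|.
    by apply: cvg_norm; apply: cvgB; exact: Scvg.
  by apply: (cvgr_to_le hc); apply: nearW => n; exact: hS.
have LG0 x : iter N L G0 x = G0 x - p x.
  transitivity (limn (fun n => S n.+1 x - p x)).
    have -> : (fun n => S n.+1 x - p x) = (fun n => iter N L (S n) x).
      apply/funext => n; rewrite transf_iter_sum /S big_ord_recl -[T (nat_of_ord ord0) x]/(p x) addrC addKr.
      by apply: eq_bigr => q _; rewrite lift0.
    by apply/esym/cvg_lim => //; exact: transf_iter_cvg.
  apply/cvg_lim => //; apply: cvgB; last exact: cvg_cst.
  by have := Scvg x; rewrite -cvg_shiftS.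
(* Applying [1 + L + ... + L ^ (N - 1)] passes from [1 - L ^ N] to [1 - L] by telescoping. *)
exists (fun x => \sum_(r < N) iter r L G0 x); split.
  by apply: H_sum => r; exact: H_transf_iter.
move=> x; have := transf_iter_sum 1 (fun r => iter r L G0) N x; rewrite /= => ->.
rewrite -sumrB -[p x](_ : G0 x - iter N L G0 x = _); last by rewrite LG0; ring.
elim: N {hV T HT ET VT Tx Th S Scvg G0 hS HG0 LG0} (G0) => [|n IH] G; first by rewrite big_ord0 subrr.
by rewrite big_ord_recr IH /=; ring.
Qed.

End poisson_equation.

(** * Martingale approximation and exponential moments *)

Section exponential_bounds.
Variable R : realType.
Implicit Types s y : R.

Lemma expR_taylor2 s : `|expR s - (1 + s + s ^+ 2 / 2)| <= `|s| ^+ 3 * expR `|s|.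
Proof.
have cvgE (x : R) : series (exp_coeff x) @ \oo --> expR x := is_cvg_series_exp_coeff x.
have hc : (fun n => `|series (exp_coeff s) (n + 3)%N - (1 + s + s ^+ 2 / 2)|) @ \oo -->
    `|expR s - (1 + s + s ^+ 2 / 2)|.
  apply: cvg_norm; apply: cvgB; last exact: cvg_cst.
  by have := cvgE s; rewrite -(cvg_shiftn 3).
apply: (cvgr_to_le hc); apply: nearW => n.
have -> : series (exp_coeff s) (n + 3)%N - (1 + s + s ^+ 2 / 2) =
    \sum_(k < n) s ^+ (k + 3) / (k + 3)`!%:R.
  rewrite /series /= big_mkord addnC big_split_ord /= !big_ord_recl big_ord0 /exp_coeff/=.
  rewrite !factS fact0 /bump /= expr0 expr1 addrC.
  rewrite (_ : 1 / _ + _ = 1 + s + s ^+ 2 / 2); last by field.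
  by rewrite addrK; apply: eq_bigr => k _; rewrite addnC.
apply: le_trans (ler_norm_sum _ _ _) _.
apply: (@le_trans _ _ (`|s| ^+ 3 * series (exp_coeff `|s|) n)); last first.
  rewrite ler_wpM2l ?exprn_ge0//; have c := cvgE `|s|.
  have nd : nondecreasing_seq (series (exp_coeff `|s|)).
    by apply/nondecreasing_seqP => l; rewrite /series /= big_nat_recr//= lerDl /exp_coeff/= divr_ge0// exprn_ge0.
  exact: nondecreasing_cvgn_le nd (cvgP _ c) n.
rewrite /series /= big_mkord mulr_sumr; apply: ler_sum => k _.
rewrite normrM normrX exprD [_ ^+ k * _]mulrC -mulrA ler_wpM2l ?exprn_ge0//.
rewrite /exp_coeff/= ler_wpM2l ?exprn_ge0// ger0_norm ?invr_ge0//.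
by rewrite lef_pV2 ?posrE ?ltr0n ?fact_gt0// ler_nat leq_fact// leq_addr.
Qed.

Lemma expR_dist1 s : `|expR s - 1| <= `|s| * expR `|s|.
Proof.
rewrite -expR0 mulrC -[in leRHS](subr0 s); apply: le_trans (expR_dist_le (ler_norm s) (normr_ge0 s)) _.
by rewrite subr0.
Qed.

(** Inverting [1 - z <= expR (- z)] at [z = y / (1 + y)] gives [expR z <= 1 + y], and [z] exceeds
    [y - 2 * y ^+ 2] in this range. *)
Lemma expR_le1D y : - 2^-1 <= y -> expR (y - 2 * y ^+ 2) <= 1 + y.
Proof.
move=> hy; have y1 : 0 < 1 + y by lra.
have h : (1 + y)^-1 <= expR (- (y / (1 + y))).
  have := expR_ge1Dx (- (y / (1 + y))).
  by rewrite (_ : 1 + - (y / (1 + y)) = (1 + y)^-1)//; field; rewrite gt_eqF.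
move: h; rewrite expRN lef_pV2 ?posrE ?expR_gt0// => /(le_trans _); apply.
rewrite ler_expR -subr_ge0 (_ : _ - _ = y ^+ 2 * (1 + 2 * y) / (1 + y)); last by field; rewrite gt_eqF.
by rewrite divr_ge0 ?(ltW y1)// mulr_ge0 ?sqr_ge0//; lra.
Qed.

(** The quadratic loss of [expR_le1D] is of order four in [t], hence absorbed into the cubic error.
    It allows [n]-th powers of the lower eigenvalue bound to be written as exponentials. *)
Lemma expR_eigenvalue_le (rho K t : R) : 0 <= rho -> 0 < K -> `|t| <= 1 -> 2 * K * `|t| ^+ 3 <= 2^-1 ->
  expR (rho * t ^+ 2 / 2 - (2 * K + 4 * (rho + 2 * K) ^+ 2) * `|t| ^+ 3) <=
  1 + (rho * t ^+ 2 / 2 - 2 * K * `|t| ^+ 3).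
Proof.
move=> rho0 K0 t1 ineq2; have tabs : `|t| ^+ 2 = t ^+ 2 by rewrite real_normK// num_real.
have rt : 0 <= rho * t ^+ 2 by rewrite mulr_ge0// sqr_ge0.
have t3 : 0 <= `|t| ^+ 3 by exact: exprn_ge0.
have Kt : 0 <= K * `|t| ^+ 3 by rewrite mulr_ge0// ltW.
have := @expR_le1D (rho * t ^+ 2 / 2 - 2 * K * `|t| ^+ 3).
move=> /(_ _) h; apply: le_trans (h _); last by lra.
rewrite ler_expR.
have e1 : `|rho * t ^+ 2 / 2 - 2 * K * `|t| ^+ 3| <= (rho + 2 * K) * `|t| ^+ 2.
  apply: le_trans (ler_normB _ _) _.
  have b1 : 0 <= rho * t ^+ 2 / 2 by lra.
  have b2 : 0 <= 2 * K * `|t| ^+ 3 by lra.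
  rewrite (ger0_norm b1) (ger0_norm b2) tabs.
  have : `|t| ^+ 3 <= t ^+ 2 by rewrite -tabs exprS ler_piMl// exprn_ge0.
  by move=> /(ler_wpM2l (ltW K0)); lra.
have e2 : (rho * t ^+ 2 / 2 - 2 * K * `|t| ^+ 3) ^+ 2 <= ((rho + 2 * K) * `|t| ^+ 2) ^+ 2.
  rewrite -[leLHS]real_normK ?num_real// lerXn2r ?nnegrE//.
  by rewrite mulr_ge0 ?exprn_ge0// addr_ge0// mulr_ge0// ltW.
have e3 : ((rho + 2 * K) * `|t| ^+ 2) ^+ 2 <= (rho + 2 * K) ^+ 2 * `|t| ^+ 3.
  by rewrite exprMn ler_wpM2l ?sqr_ge0// -exprM exprS ler_piMl.
by have := mulr_ge0 (sqr_ge0 (rho + 2 * K)) t3; move: e2 e3; lra.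
Qed.

End exponential_bounds.

Section martingale_approximation.
Variables (R : realType) (m : nat) (mu : probability (SigMeas m) R).
Variables (g xi : Sig m -> R) (al : R).
Hypothesis al01 : 0 < al < 1.
Hypothesis hg : holder_class al g.
Hypothesis hxi : holder_class al xi.
Hypothesis g1 : transf g (fun=> 1) = (fun=> 1).
Hypothesis ExL : forall p, holder_class al p -> Ex mu (transf g p) = Ex mu p.
Hypothesis inv : forall A : set (SigMeas m), measurable A -> mu ((@shift m) @^-1` A) = mu A.
Hypothesis Lxi : transf g xi = (fun=> 0).
Local Notation E := (Ex mu).
Local Notation L := (transf g).
Local Notation M := (birkhoff xi).

Let rho := E (fun x => xi x ^+ 2).

Let HbM p : holder_class al p -> bm (p : SigMeas m -> R).
Proof. exact: H_bm. Qed.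

(** Splitting off the first term, the cross term is the mean of [L xi * M n], which vanishes: the
    summands are reverse martingale differences, hence orthogonal. *)
Lemma Ex_sqr_martingale n : E (fun x => M n x ^+ 2) = n%:R * rho.
Proof.
elim: n => [|n IH].
  by rewrite mul0r -(Ex_cst mu 0); apply: eq_Ex => x; rewrite /birkhoff big_ord0 expr0n.
have HMn : holder_class al (M n) by exact: H_birkhoff.
have HMs : holder_class al (fun x => M n (shift x)) by exact: H_shift.
have -> : E (fun x => M n.+1 x ^+ 2) =
    E (fun x => xi x ^+ 2 + (2 * (xi x * M n (shift x)) + M n (shift x) ^+ 2)).
  by apply: eq_Ex => x; rewrite birkhoffS; ring.
have H1 : holder_class al (fun x => xi x * M n (shift x)) by exact: HM.
have H2 : holder_class al (fun x => M n x ^+ 2) by exact: HX.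
have H3 : holder_class al (fun x => M n (shift x) ^+ 2) by exact: HX.
rewrite ExD; [|by apply: HbM; exact: HX|by apply: HbM; apply: HD => //; exact: HZ].
rewrite ExD; [|by apply: HbM; exact: HZ|exact: HbM].
rewrite ExZ; last exact: HbM.
rewrite -(ExL H1) transf_mul_shift Lxi.
have -> : E (fun x => 0 * M n x) = 0 by rewrite -[RHS](Ex_cst mu); apply: eq_Ex => x; rewrite mul0r.
rewrite (Ex_comp (@measurable_shift m) inv (p := fun x => M n x ^+ 2)); last exact: HbM.
by rewrite IH -/rho mulr0 add0r -natr1; ring.
Qed.

(* [v = 1 + t^2 u / 2], with [u] solving a Poisson equation, is an approximate eigenfunction of the
   perturbed operator [p |-> L (e^(t xi) p)], with eigenvalue [1 + rho t^2 / 2 + O(t^3)]. *)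
Lemma perturbed_operator : exists (u : Sig m -> R) (K t0 : R), [/\ holder_class al u, 0 < K, 0 < t0 &
  forall t x, `|t| <= t0 -> [/\ 2^-1 <= 1 + t ^+ 2 / 2 * u x <= 2 &
   `|L (fun y => expR (t * xi y) * (1 + t ^+ 2 / 2 * u y)) x - (1 + rho * t ^+ 2 / 2) * (1 + t ^+ 2 / 2 * u x)|
     <= K * `|t| ^+ 3]].
Proof.
have Hx2 : holder_class al (fun x => xi x ^+ 2) by exact: HX.
have HL2 : holder_class al (L (fun x => xi x ^+ 2)) by exact: H_transf.
have Hp : holder_class al (fun x => L (fun y => xi y ^+ 2) x - rho) by apply: HB => //; exact: H_cst.
have Ep : E (fun x => L (fun y => xi y ^+ 2) x - rho) = 0.
  by rewrite ExB; [|exact: HbM|exact: bm_cst]; rewrite Ex_cst ExL// subrr.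
have [u [Hu hu]] := poisson_equation al01 hg g1 ExL Hp Ep.
have [A [A0 hA]] := H_bdd hxi.
have [U [U0 hU]] := H_bdd Hu.
have rho0 : 0 <= rho by apply: Ex_ge0 => x; exact: sqr_ge0.
pose K := A ^+ 3 * expR A + A * expR A * U + rho * U + 1.
have K0 : 0 < K.
  by rewrite ltr_pwDr// !addr_ge0 ?mulr_ge0 ?exprn_ge0 ?expR_ge0 ?(ltW A0) ?(ltW U0).
(* Then [t ^+ 2 * U <= 1], so the approximate eigenfunction differs from 1 by at most one half. *)
pose t0 := (1 + U)^-1.
have U1 : 0 < 1 + U by lra.
exists u, K, t0; split => //; first by rewrite invr_gt0.
move=> t x tt0.
have tU : `|t| * (1 + U) <= 1 by rewrite -ler_pdivlMr// mul1r.
have t1 : `|t| <= 1 by have := normr_ge0 t; nra.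
have t2E : t ^+ 2 = `|t| ^+ 2 by rewrite real_normK// num_real.
have t2U : `|t| ^+ 2 * U <= 1 by have := normr_ge0 t; nra.
have hUx y : - U <= u y <= U by rewrite -ler_norml.
split.
  have /andP[ux1 ux2] := hUx x; rewrite t2E; have := sqr_ge0 `|t| => t20.
  have : `|t| ^+ 2 * u x <= `|t| ^+ 2 * U by rewrite ler_wpM2l.
  have : `|t| ^+ 2 * (- U) <= `|t| ^+ 2 * u x by rewrite ler_wpM2l.
  by lra.
(* The second order part is mapped exactly: [L xi = 0] kills the first order, and the Poisson
   equation gives [L (xi ^+ 2) + L u = rho + u]. *)
pose P y := 1 + (t * xi y + (t ^+ 2 / 2 * xi y ^+ 2 + t ^+ 2 / 2 * u y)).
pose Q y := expR (t * xi y) * (1 + t ^+ 2 / 2 * u y) - P y.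
have LP : L P x = 1 + t ^+ 2 / 2 * (rho + u x).
  rewrite /P transfD g1 transfD transfZ Lxi transfD !transfZ mulr0 add0r -mulrDr.
  by have := hu x => /eqP; rewrite subr_eq => /eqP ->; ring.
have -> : L (fun y => expR (t * xi y) * (1 + t ^+ 2 / 2 * u y)) x = L P x + L Q x.
  rewrite -[RHS]/((fun x => L P x + L Q x) x) -transfD; congr (L _ x).
  by apply/funext => y; rewrite /Q; ring.
rewrite LP.
have -> : 1 + t ^+ 2 / 2 * (rho + u x) + L Q x - (1 + rho * t ^+ 2 / 2) * (1 + t ^+ 2 / 2 * u x) =
  L Q x - rho * u x * t ^+ 4 / 4 by field.
have hQ y : `|Q y| <= (A ^+ 3 * expR A + A * expR A * U) * `|t| ^+ 3.
  have -> : Q y = (expR (t * xi y) - (1 + t * xi y + (t * xi y) ^+ 2 / 2)) +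
     (expR (t * xi y) - 1) * (t ^+ 2 / 2 * u y) by rewrite /Q /P; field.
  have sA : `|t * xi y| <= `|t| * A by rewrite normrM ler_wpM2l.
  have sA1 : expR `|t * xi y| <= expR A.
    by rewrite ler_expR (le_trans sA)// ler_piMl// ltW.
  apply: le_trans (ler_normD _ _) _; rewrite [leRHS]mulrDl; apply: lerD.
    apply: le_trans (expR_taylor2 _) _; rewrite [leRHS]mulrAC -exprMn; apply: ler_pM; [exact: exprn_ge0|exact: expR_ge0| |exact: sA1].
    have sA' : `|t * xi y| <= A * `|t| by rewrite [A * _]mulrC.
    by apply: lerXn2r; rewrite ?nnegrE ?mulr_ge0 ?(ltW A0).
  rewrite normrM.
  have h1 : `|expR (t * xi y) - 1| <= `|t| * A * expR A.
    apply: le_trans (expR_dist1 _) _; apply: ler_pM => //; exact: expR_ge0.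
  have h2 : `|t ^+ 2 / 2 * u y| <= `|t| ^+ 2 * U.
    have t20 := sqr_ge0 t; have t22 : 0 <= t ^+ 2 / 2 by lra.
    by rewrite normrM (ger0_norm t22) -t2E; apply: ler_pM => //; lra.
  apply: le_trans (ler_pM _ _ h1 h2) _ => //.
  by rewrite le_eqVlt; apply/orP; left; apply/eqP; ring.
have hLQ : `|L Q x| <= (A ^+ 3 * expR A + A * expR A * U) * `|t| ^+ 3.
  have L1 : L (fun=> 1) x = 1 by rewrite g1.
  rewrite -[leRHS]mul1r -L1 /transf mulr_suml.
  apply: le_trans (ler_norm_sum _ _ _) _; apply: ler_sum => a _.
  by rewrite normrM [`|expR _|]gtr0_norm ?expR_gt0// mulr1 ler_wpM2l ?expR_ge0.
apply: le_trans (ler_normB _ _) _.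
have h4 : `|rho * u x * t ^+ 4 / 4| <= rho * U * `|t| ^+ 3.
  have t40 : 0 <= t ^+ 4 / 4 by rewrite divr_ge0// (exprM t 2 2) sqr_ge0.
  rewrite -[rho * u x * _ / _]mulrA normrM (ger0_norm t40) normrM (ger0_norm rho0).
  apply: ler_pM => //; [exact: mulr_ge0|by rewrite ler_wpM2l|].
  have -> : t ^+ 4 = `|t| ^+ 3 * `|t| by rewrite -exprSr (exprM t 2 2) t2E -exprM.
  by have : 0 <= `|t| ^+ 3 by [exact: exprn_ge0]; have := normr_ge0 t; nra.
have : 0 <= `|t| ^+ 3 by exact: exprn_ge0.
by rewrite /K; move: hLQ h4; nra.
Qed.

(** Weighting by [v = 1 + t ^+ 2 / 2 * u], duality expresses the moment at [k + 1] through the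
    perturbed operator applied to [v], so consecutive moments have ratio between [lm] and [lp].
    Inserting and removing [v], which lies between 1/2 and 2, costs the factors 4. *)
Lemma mgf_martingale : exists K t0 : R, [/\ 0 < K, 0 < t0 &
  forall t n, `|t| <= t0 ->
   4^-1 * expR (n%:R * (rho * t ^+ 2 / 2 - K * `|t| ^+ 3)) <= E (fun x => expR (t * M n x)) <=
   4 * expR (n%:R * (rho * t ^+ 2 / 2 + K * `|t| ^+ 3))].
Proof.
have [u [K [t0 [Hu K0 t00 hp]]]] := perturbed_operator.
have rho0 : 0 <= rho by apply: Ex_ge0 => x; exact: sqr_ge0.
pose K2 := 2 * K + 4 * (rho + 2 * K) ^+ 2.
have K20 : 0 < K2 by rewrite ltr_pwDl ?mulr_gt0// mulr_ge0// sqr_ge0.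
(* The last two bounds ensure [2 * K * |t| ^ 3 <= 1/2], as [expR_eigenvalue_le] requires. *)
pose t1 := Num.min t0 (Num.min 1 (4 * K + 1)^-1).
have t10 : 0 < t1 by rewrite !lt_min t00 ltr01 invr_gt0; lra.
exists K2, t1; split => // t n.
rewrite !le_min => /and3P[tt0 tle1 tK].
pose v x := 1 + t ^+ 2 / 2 * u x.
have hv x : 2^-1 <= v x <= 2 by have [] := hp t x tt0.
have Hv : holder_class al v by apply: HD; [exact: H_cst|exact: HZ].
have t30 : 0 <= `|t| ^+ 3 by exact: exprn_ge0.
pose lp := 1 + (rho * t ^+ 2 / 2 + 2 * K * `|t| ^+ 3).
pose lm := 1 + (rho * t ^+ 2 / 2 - 2 * K * `|t| ^+ 3).
have hL x : lm * v x <= L (fun y => expR (t * xi y) * v y) x <= lp * v x.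
  have [_] := hp t x tt0; rewrite -/(v x) => h.
  have /andP[v1 v2] := hv x.
  have : K * `|t| ^+ 3 <= 2 * K * `|t| ^+ 3 * v x.
    have : 0 <= K * `|t| ^+ 3 by rewrite mulr_ge0// ltW.
    by nra.
  by move: h; rewrite ler_norml /lm /lp => /andP[h1 h2] h3; apply/andP; split; lra.
have HtM k : holder_class al (fun x => expR (t * M k x)).
  by apply: H_expR => //; apply: HZ; exact: H_birkhoff.
have Htxi : holder_class al (fun y => expR (t * xi y) * v y).
  by apply: HM => //; apply: H_expR => //; exact: HZ.
pose a k := E (fun x => v x * expR (t * M k x)).
have aS k : a k.+1 = E (fun x => L (fun y => expR (t * xi y) * v y) x * expR (t * M k x)).
  rewrite /a -transf_mul_shift ExL; last by apply: HM => //; exact: (H_shift al01 (HtM k)).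
  by apply: eq_Ex => x; rewrite birkhoffS mulrDr expRD; ring.
have bma k : bm (fun x : SigMeas m => v x * expR (t * M k x)) by apply: HbM; exact: HM.
have bmL k : bm (fun x : SigMeas m => L (fun y => expR (t * xi y) * v y) x * expR (t * M k x)).
  by apply: HbM; apply: HM => //; exact: H_transf.
have tabs : `|t| ^+ 2 = t ^+ 2 by rewrite real_normK// num_real.
have tn0 := normr_ge0 t.
have ineq2 : 2 * K * `|t| ^+ 3 <= 2^-1.
  have : `|t| * (4 * K + 1) <= 1 by rewrite -ler_pdivlMr ?mul1r//; lra.
  have : `|t| ^+ 3 <= `|t|.
    by rewrite exprS ler_piMr// exprn_ile1.
  nra.
have t20 := sqr_ge0 t.
have rt : 0 <= rho * t ^+ 2 by apply: mulr_ge0.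
have Kt : 0 <= K * `|t| ^+ 3 by apply: mulr_ge0 => //; exact: ltW.
have lp0 : 0 <= lp by rewrite /lp; lra.
have lm0 : 0 <= lm by rewrite /lm; lra.
have aup k : a k.+1 <= lp * a k.
  rewrite aS -ExZ//; apply: Ex_le => //; first exact: bmZ.
  by move=> x; rewrite mulrA ler_wpM2r ?expR_ge0//; case/andP: (hL x).
have alo k : lm * a k <= a k.+1.
  rewrite aS -ExZ//; apply: Ex_le => //; first exact: bmZ.
  by move=> x; rewrite mulrA ler_wpM2r ?expR_ge0//; case/andP: (hL x).
have a0 : 2^-1 <= a 0%N <= 2.
  have -> : a 0%N = E v by apply: eq_Ex => x; rewrite /birkhoff big_ord0 mulr0 expR0 mulr1.
  have bv := HbM Hv; apply/andP; split.
    by rewrite -[leLHS](Ex_cst mu); apply: Ex_le => //; [exact: bm_cst|move=> x; case/andP: (hv x)].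
  by rewrite -[leRHS](Ex_cst mu); apply: Ex_le => //; [exact: bm_cst|move=> x; case/andP: (hv x)].
have anup : a n <= 2 * lp ^+ n.
  elim: n => [|n IH]; first by rewrite expr0 mulr1; case/andP: a0.
  by rewrite (le_trans (aup n))// exprS mulrCA ler_wpM2l.
have anlo : 2^-1 * lm ^+ n <= a n.
  elim: n {anup} => [|n IH]; first by rewrite expr0 mulr1; case/andP: a0.
  by apply: le_trans (alo n); rewrite exprS mulrCA ler_wpM2l.
have EaP : 2^-1 * E (fun x => expR (t * M n x)) <= a n.
  rewrite -ExZ; last exact: HbM.
  apply: Ex_le => //; first by apply: bmZ; exact: HbM.
  by move=> x; rewrite ler_wpM2r ?expR_ge0//; case/andP: (hv x).
have EaQ : a n <= 2 * E (fun x => expR (t * M n x)).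
  rewrite -ExZ; last exact: HbM.
  apply: Ex_le => //; first by apply: bmZ; exact: HbM.
  by move=> x; rewrite ler_wpM2r ?expR_ge0//; case/andP: (hv x).
have lpE : lp ^+ n <= expR (n%:R * (rho * t ^+ 2 / 2 + K2 * `|t| ^+ 3)).
  rewrite expRM_natl lerXn2r ?nnegrE ?expR_ge0//.
  apply: le_trans (expR_ge1Dx _) _; rewrite ler_expR lerD2l ler_wpM2r//.
  by rewrite /K2 lerDl mulr_ge0// sqr_ge0.
have lmE : expR (n%:R * (rho * t ^+ 2 / 2 - K2 * `|t| ^+ 3)) <= lm ^+ n.
  rewrite expRM_natl lerXn2r ?nnegrE ?expR_ge0//.
  exact: expR_eigenvalue_le.
apply/andP; split.
  rewrite ler_pdivrMl// (le_trans lmE)// -(ler_pM2l (x := 2^-1))// (le_trans anlo)// (le_trans EaQ)//.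
  rewrite [leRHS]mulrA; apply: ler_wpM2r; last by lra.
  by apply: Ex_ge0 => x; exact: expR_ge0.
rewrite -(ler_pM2l (x := 2^-1))// (le_trans EaP)// (le_trans anup)//.
rewrite [leRHS]mulrA; apply: ler_pM => //; [exact: exprn_ge0|lra].
Qed.

End martingale_approximation.

(** * Entropy, asymptotic variance and cylinder versions of the Birkhoff sums *)

Section gibbs_measure.
Variables (R : realType) (m : nat) (mu : probability (SigMeas m) R).

(* [F n] is an [n]-cylinder version of the centred Birkhoff sums. *)
Record almost_additive (F : nat -> Sig m -> R) (rho K t0 : R) : Prop := AlmostAdditive {
  aa_rho : 0 < rho;
  aa_K : 1 <= K;
  aa_t0 : 0 < t0;
  aa_agree : forall n i j, agree i j n -> F n i = F n j;
  aa_add : forall n k i, `|F (n + k)%N i - F n i - F k (iter n (@shift m) i)| <= K;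
  aa_mgf : forall t n, `|t| <= t0 ->
    K^-1 * expR (n%:R * (rho * t ^+ 2 / 2 - K * `|t| ^+ 3)) <= Ex mu (fun x => expR (t * F n x)) <=
    K * expR (n%:R * (rho * t ^+ 2 / 2 + K * `|t| ^+ 3)) }.

Lemma cvg_epsilon (u : nat -> R) (l : R) :
  (forall e : R, 0 < e -> exists N, forall n, (N <= n)%N -> `|u n - l| <= e) -> u @ \oo --> l.
Proof.
move=> h; apply/cvgrPdist_le => e e0; have [N hN] := h e e0.
by exists N => // n /= Nn; rewrite distrC; exact: hN.
Qed.

Lemma cvg_rate (u : nat -> R) (l c : R) : (forall n, (0 < n)%N -> `|u n - l| <= c / n%:R) ->
  u @ \oo --> l.
Proof.
move=> h; apply: cvg_epsilon => e e0.
have c0 : 0 <= c by have := h 1%N isT; rewrite divr1; exact: le_trans.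
exists (Num.bound (c / e)).+1 => n Nn.
have n0 : (0 < n)%N by exact: leq_ltn_trans Nn.
apply: le_trans (h n n0) _; rewrite ler_pdivrMr ?ltr0n// mulrC -ler_pdivrMr//.
apply: le_trans (ltW (archi_boundP _)) _; first by rewrite divr_ge0// ltW.
by rewrite ler_nat ltnW.
Qed.

Variable f : Sig m -> R.

Section martingale_decomposition.
Variables (al pr C : R) (g w : Sig m -> R).
Hypothesis al01 : 0 < al < 1.
Hypothesis hf : holder_class al f.
Hypothesis ncoh : ~ cohomologous_to_constant f.
Hypothesis inv : forall A : set (SigMeas m), measurable A -> mu ((@shift m) @^-1` A) = mu A.
Hypothesis gib : gibbs_bound mu f pr C.
Hypothesis hg : holder_class al g.
Hypothesis hw : holder_class al w.
Hypothesis g1 : transf g (fun=> 1) = (fun=> 1).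
Hypothesis fgw : forall x, f x = g x + pr - w x + w (shift x).
Hypothesis ExL : forall p, holder_class al p -> Ex mu (transf g p) = Ex mu p.
Local Notation E := (Ex mu).
Local Notation P := (Pr mu).
Let h := pr - E f.
Let fb x := f x - E f.
Let mshift := @measurable_shift m.

Let hfb : holder_class al fb. Proof. by apply: HB => //; exact: H_cst. Qed.
Let bmf : bm (f : SigMeas m -> R). Proof. exact: H_bm hf. Qed.
Lemma Ex_birkhoff n : E (birkhoff f n) = n%:R * E f.
Proof.
rewrite /birkhoff Ex_sum => [|k _]; last exact: (bm_iter mshift k bmf).
rewrite (eq_bigr (fun=> E f)) ?sumr_const ?card_ord ?mulr_natl// => k _.
exact: Ex_iter.
Qed.

Lemma birkhoff_centered n x : birkhoff fb n x = birkhoff f n x - n%:R * E f.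
Proof. by rewrite /birkhoff /fb sumrB sumr_const card_ord mulr_natl. Qed.

(** Integrating the Gibbs bounds determines the entropy of [n]-cylinders as [n * h] up to [ln C], an
    error that the division by [n] removes. *)
Lemma entropyE : entropy mu = h.
Proof.
apply/cvg_lim => //; have [C1 _] := gib; have C0 : 0 < C by exact: lt_trans C1.
apply: (@cvg_rate _ _ (ln C)) => n n0.
have hS : bm (birkhoff f n : SigMeas m -> R) by apply: (H_bm al01); exact: H_birkhoff.
have bl : bm (fun x : SigMeas m => ln (P (pcyl x n)) : R).
  by apply: (@bm_cyl _ _ n) => i j ij; rewrite (pcyl_agree ij).
have -> : \sum_(v : n.-tuple 'I_m.+1) fine (mu (cyl v)) * ln (fine (mu (cyl v))) =
    E (fun x => ln (P (pcyl x n))).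
  rewrite (Ex_cyl mu (n := n)); last by move=> i j ij; rewrite (pcyl_agree ij).
  by apply: eq_bigr => v _; rewrite -cyl_pcyl.
have : `|E (fun x => ln (P (pcyl x n))) - (- (n%:R * h))| <= ln C.
  have -> : - (n%:R * h) = E (fun x => - (n%:R * pr) + birkhoff f n x).
    by rewrite ExD//; [rewrite Ex_cst Ex_birkhoff /h; ring|exact: bm_cst].
  apply: Ex_dist_le => //; first by apply: bmD => //; exact: bm_cst.
  move=> x; have := gibbs_upper gib n x; have := gibbs_lower gib n x; rewrite /gibbs_weight.
  set s := - _ + _; set p := P _ => h1 h2.
  have p0 : 0 < p by exact: Pr_pcyl_gt0 gib _ _.
  rewrite ler_norml lerBlDr lerBrDr; apply/andP; split.
    rewrite -[- ln C]lnV ?posrE// -[X in _ + X]expRK -lnM ?posrE ?invr_gt0 ?expR_gt0//.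
    by rewrite ler_ln ?posrE// mulr_gt0 ?invr_gt0 ?expR_gt0.
  rewrite -[X in _ + X]expRK -lnM ?posrE ?expR_gt0// ler_ln ?posrE// mulr_gt0 ?expR_gt0//.
set Z := E _; rewrite opprK => hZ; have n0' : 0 < n%:R :> R by rewrite ltr0n.
rewrite -[h](mulKf (lt0r_neq0 n0')) -opprD -mulrDr normrN normrM gtr0_norm ?invr_gt0//.
by rewrite mulrC ler_wpM2r// invr_ge0 ltW.
Qed.

(** The weights [expR g] over the preimages of a point sum to one and each is at least [expR (- M)];
    with two symbols or more, [g] stays below a negative constant, and [h = - E g]. *)
Lemma entropy_gt0 : (0 < m)%N -> 0 < h.
Proof.
move=> m0; have [M [M0 hM]] := H_bdd hg.
have gle x : g x <= ln (1 - expR (- M)).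
  have e1 : expR (- M) < 1 by rewrite expR_lt1 oppr_lt0.
  rewrite -[leLHS]expRK ler_ln ?posrE ?expR_gt0 ?subr_gt0//.
  have : transf g (fun=> 1) (shift x) = 1 by rewrite g1.
  pose b : 'I_m.+1 := if x 0%N == ord0 then ord_max else ord0.
  have bx : b != x 0%N.
    rewrite /b; case: ifPn => [/eqP ->|]; last by rewrite eq_sym.
    by rewrite -val_eqE /= -lt0n.
  rewrite /transf (bigD1 (x 0%N))//= (bigD1 b)//= scons_shift !mulr1.
  have : 0 <= \sum_(i < m.+1 | (i != x 0%N) && (i != b)) expR (g (scons i (shift x))) * 1.
    by apply: sumr_ge0 => i _; rewrite mulr1 expR_ge0.
  have : expR (- M) <= expR (g (scons b (shift x))).
    by rewrite ler_expR; have := hM (scons b (shift x)); rewrite ler_norml => /andP[].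
  by lra.
have -> : h = - E g.
  have Ef : E f = E g + pr.
    have bg : bm (g : SigMeas m -> R) by exact: H_bm hg.
    have bw : bm (w : SigMeas m -> R) by exact: H_bm hw.
    have bws : bm (fun x : SigMeas m => w (shift x)) by exact: (bm_iter mshift 1 bw).
    have -> : E f = E (fun x => g x + pr - w x + w (shift x)) by exact: eq_Ex.
    rewrite ExD//; last by apply: bmB => //; apply: bmD => //; exact: bm_cst.
    rewrite ExB//; last by apply: bmD => //; exact: bm_cst.
    rewrite ExD//; last exact: bm_cst.
    by rewrite Ex_cst (Ex_comp mshift inv bw); ring.
  by rewrite /h Ef; ring.
rewrite oppr_gt0; apply: (@le_lt_trans _ _ (ln (1 - expR (- M)))).
  rewrite -[leRHS](Ex_cst mu); apply: Ex_le => //; [exact: H_bm hg|exact: bm_cst].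
by rewrite ln_lt0// subr_gt0 expR_lt1 oppr_lt0 M0/= ltrBlDr ltrDl expR_gt0.
Qed.

(** With [G - L G = fb] and [U = L G], the function [xi = G - U (shift x)] satisfies
    [L xi = L G - U = 0] and differs from [fb] by a coboundary. *)
Lemma martingale_decomposition : exists xi U : Sig m -> R,
  [/\ holder_class al xi, holder_class al U, transf g xi = (fun=> 0) &
      forall n x, birkhoff fb n x = birkhoff xi n x + U (iter n (@shift m) x) - U x].
Proof.
have Efb : E fb = 0 by rewrite /fb ExB//; [rewrite Ex_cst subrr|exact: bm_cst].
have [G [HG hG]] := poisson_equation al01 hg g1 ExL hfb Efb.
pose U := transf g G; have HU : holder_class al U by exact: H_transf.
exists (fun x => G x - U (shift x)), U; split => //.
- by apply: HB => //; exact: H_shift.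
- have -> : (fun x => G x - U (shift x)) = (fun x => G x - 1 * U (shift x)).
    by apply/funext => x; rewrite mul1r.
  by rewrite transfB transf_mul_shift g1; apply/funext => x; rewrite mul1r subrr.
- elim=> [|n IH] x; first by rewrite /birkhoff !big_ord0 /= add0r subrr.
  by rewrite !birkhoffS IH iterSr -hG -/U; ring.
Qed.

Lemma gibbs_almost_additive : exists (F : nat -> Sig m -> R) (K t0 : R),
  almost_additive F (asvar f mu) K t0 /\ forall n i, `|F n i - (birkhoff f n i - n%:R * E f)| <= K.
Proof.
have [xi [U [Hxi HU Lxi hdec]]] := martingale_decomposition.
pose rho := E (fun x => xi x ^+ 2).
have [c [c0 hc]] := H_bdd HU.
have rho_ge0 : 0 <= rho by apply: Ex_ge0 => x; exact: sqr_ge0.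
have Hx2 : holder_class al (fun x => xi x ^+ 2) by exact: HX.
(* If [rho] vanished, continuity and the positive measure of every cylinder would force [xi = 0]
   everywhere, making [f] cohomologous to [E f] through [U]. *)
have rho0 : 0 < rho.
  rewrite lt_neqAle rho_ge0 andbT; apply/eqP => rho0; apply: ncoh.
  exists U, (E f); split; first exact: H_continuous HU.
  move=> x; have := hdec 1%N x; rewrite /birkhoff !big_ord1 /= /fb.
  suff -> : xi x = 0 by lra.
  apply/eqP; rewrite -sqrf_eq0; apply: contrapT => /negP xn0.
  have s0 : 0 < xi x ^+ 2 by rewrite lt_neqAle eq_sym xn0 sqr_ge0.
  have [N hN] := H_continuous al01 Hx2 x (divr_gt0 s0 (ltr0n R 2)).
  have : 0 < xi x ^+ 2 / 2 * P (pcyl x N) by rewrite mulr_gt0 ?(Pr_pcyl_gt0 gib)// divr_gt0.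
  apply/negP; rewrite -leNgt rho0 -(Ex_indic mu (measurable_pcyl _ _)) -ExZ; last first.
    by apply: bm_indic; exact: measurable_pcyl.
  apply: Ex_le; [by apply: bmZ; apply: bm_indic; exact: measurable_pcyl|exact: H_bm Hx2|].
  move=> y; case: (boolP (y \in _)) => [/set_mem xy|_]; last by rewrite mulr0 sqr_ge0.
  by rewrite mulr1; have := hN y xy; rewrite ltr_norml => /andP[]; lra.
have bmFb n : bm (birkhoff fb n : SigMeas m -> R) by apply: (H_bm al01); exact: H_birkhoff.
have HM n : holder_class al (birkhoff xi n) by exact: H_birkhoff.
have bmXi n : bm (birkhoff xi n : SigMeas m -> R) by exact: H_bm (HM n).
have XM n x : `|birkhoff fb n x - birkhoff xi n x| <= 2 * c.
  rewrite hdec; have := hc x; have := hc (iter n (@shift m) x).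
  by rewrite !ler_norml => /andP[? ?] /andP[? ?]; apply/andP; split; lra.
have asvarE : asvar f mu = rho.
  apply/cvg_lim => //; apply: cvg_epsilon => e e0.
  pose eta := e / (2 * (rho + 1)).
  have rho1 : 0 < rho + 1 by lra.
  have eta0 : 0 < eta by rewrite divr_gt0// mulr_gt0.
  pose D := (2 * c) ^+ 2 * (eta^-1 + 1).
  have D0 : 0 <= D by rewrite mulr_ge0 ?sqr_ge0// addr_ge0// invr_ge0 ltW.
  exists (Num.bound (D / (e / 2))).+1 => n Nn.
  have n0 : 0 < n%:R :> R by rewrite ltr0n; exact: leq_ltn_trans Nn.
  have hD : D <= n%:R * (e / 2).
    rewrite -ler_pdivrMr ?divr_gt0//; apply: le_trans (ltW (archi_boundP _)) _.
      by rewrite divr_ge0// divr_ge0// ltW.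
    by rewrite ler_nat ltnW.
  have -> : fine (\int[mu]_x ((birkhoff f n x - n%:R * fine (\int[mu]_y (f y)%:E)) ^+ 2)%:E) =
      E (fun x => birkhoff fb n x ^+ 2).
    by apply: eq_Ex => x; rewrite birkhoff_centered.
  have hE : `|E (fun x => birkhoff fb n x ^+ 2) - n%:R * rho| <= eta * (n%:R * rho) + D.
    rewrite -(Ex_sqr_martingale al01 Hxi ExL inv Lxi n).
    have b1 : bm (fun x : SigMeas m => birkhoff fb n x ^+ 2) by exact: bmM.
    have b2 : bm (fun x : SigMeas m => birkhoff xi n x ^+ 2) by exact: bmM.
    have b3 : bm (fun x : SigMeas m => eta * birkhoff xi n x ^+ 2) by exact: bmZ.
    have b4 : bm (fun x : SigMeas m => eta * birkhoff xi n x ^+ 2 + D) by apply: bmD => //; exact: bm_cst.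
    (* The sums differ by at most [2 * c]; Young's inequality trades the cross term for a small
       multiple of the square and the constant [D], which is negligible after division by [n]. *)
    have pw x : `|birkhoff fb n x ^+ 2 - birkhoff xi n x ^+ 2| <= eta * birkhoff xi n x ^+ 2 + D.
      have := XM n x; set X := birkhoff fb n x; set Y := birkhoff xi n x => hXY.
      have -> : X ^+ 2 - Y ^+ 2 = 2 * Y * (X - Y) + (X - Y) ^+ 2 by ring.
      set d := X - Y in hXY *; have d2 : d ^+ 2 <= (2 * c) ^+ 2.
        by rewrite -[leLHS]real_normK ?num_real// lerXn2r ?nnegrE ?mulr_ge0 ?(ltW c0).
      have e1 : `|2 * Y * d| <= eta * Y ^+ 2 + eta^-1 * d ^+ 2.
        have -> : eta * Y ^+ 2 + eta^-1 * d ^+ 2 = eta^-1 * ((eta * Y) ^+ 2 + d ^+ 2).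
          by field; rewrite gt_eqF.
        rewrite ler_pdivlMl//.
        have -> : eta * `|2 * Y * d| = `|2 * (eta * Y) * d|.
          by rewrite -{1}(gtr0_norm eta0) -normrM; congr `|_|; ring.
        by rewrite ler_norml; have := sqr_ge0 (eta * Y + d); have := sqr_ge0 (eta * Y - d);
          move=> ? ?; apply/andP; split; lra.
      have e2 : eta^-1 * d ^+ 2 <= eta^-1 * (2 * c) ^+ 2 by rewrite ler_wpM2l// invr_ge0 ltW.
      apply: le_trans (ler_normD _ _) _; rewrite [`|d ^+ 2|]ger0_norm ?sqr_ge0//.
      by rewrite /D; lra.
    have -> : eta * E (fun x => birkhoff xi n x ^+ 2) + D = E (fun x => eta * birkhoff xi n x ^+ 2 + D).
      by rewrite ExD ?ExZ ?Ex_cst//; exact: bm_cst.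
    rewrite -ExB// ler_norml; apply/andP; split.
      rewrite lerNl -ExN; last exact: bmB.
      apply: Ex_le => //; first by apply: bmN; exact: bmB.
      by move=> x; apply: le_trans (pw x); rewrite -normrN ler_norm.
    apply: Ex_le => //; first exact: bmB.
    by move=> x; apply: le_trans (pw x); rewrite ler_norm.
  rewrite -(mulKf (lt0r_neq0 n0) rho) -mulrBr normrM gtr0_norm ?invr_gt0//.
  rewrite ler_pdivrMl//; apply: le_trans hE _.
  have : eta * rho <= e / 2.
    rewrite /eta mulrAC ler_pdivrMr ?mulr_gt0//; nra.
  move=> /(ler_wpM2l (ltW n0)); lra.
have [K1 [t1 [K10 t10 hmgf]]] := mgf_martingale al01 hg Hxi g1 ExL Lxi.
case: hfb => b hb; pose B := b / (1 - al).
have B0 : 0 <= B by rewrite divr_ge0 ?(hol_ge0 hb)// subr_ge0 ltW//; case/andP: al01.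
(* Truncation makes the sum a function of [n] symbols, as quasi-independence requires; by bounded
   distortion it moves by at most [B]. *)
pose F n i := birkhoff fb n (proj n i).
have FX n i : `|F n i - birkhoff fb n i| <= B.
  have := @birkhoff_hol _ _ al al01 b fb n (proj n i) i 0%N hb.
  by rewrite addn0 expr0 mulr1; apply; exact: agree_proj.
pose t0 := Num.min t1 1.
have t00 : 0 < t0 by rewrite lt_min t10 ltr01.
pose c' := B + 2 * c.
(* One constant for all clauses: [K1] for the cubic error, [4 * expR c'] for replacing the
   martingale by [F] in the moments, [3 * B] for almost additivity. *)
pose K := K1 + 4 * expR c' + 3 * B + 1.
have ec : 1 <= expR c' by rewrite -expR0 ler_expR addr_ge0// mulr_ge0// ltW.
have K4 : 4 * expR c' <= K by rewrite /K; lra.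
have KK1 : K1 <= K by rewrite /K; lra.
have K3B : 3 * B <= K by rewrite /K; lra.
have K1' : 1 <= K by rewrite /K; lra.
exists F, K, t0; split; last first.
  move=> n i; rewrite -birkhoff_centered; apply: le_trans (FX n i) _; lra.
rewrite asvarE; split => //.
- by move=> n i j ij; rewrite /F (proj_agree ij).
- move=> n k i; apply: le_trans K3B.
  have -> : F (n + k)%N i - F n i - F k (iter n (@shift m) i) =
    (F (n + k)%N i - birkhoff fb (n + k) i) - (F n i - birkhoff fb n i)
     - (F k (iter n (@shift m) i) - birkhoff fb k (iter n (@shift m) i)).
    by rewrite birkhoffD; ring.
  apply: le_trans (ler_normB _ _) _.
  have := FX (n + k)%N i; have := FX n i; have := FX k (iter n (@shift m) i) => h1 h2 h3.
  have := le_trans (ler_normB (F (n + k)%N i - birkhoff fb (n + k) i) (F n i - birkhoff fb n i)) (lerD h3 h2).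
  by lra.
- move=> t n; rewrite le_min => /andP[tt1 tle1].
  have bF : bm (fun x : SigMeas m => expR (t * F n x)).
    by apply: (@bm_cyl _ _ n) => i j ij; rewrite /F (proj_agree ij).
  have bM : bm (fun x : SigMeas m => expR (t * birkhoff xi n x)).
    by apply: bm_expR; exact: bmZ.
  have FM x : `|t * F n x - t * birkhoff xi n x| <= c'.
    rewrite -mulrBr normrM; apply: (@le_trans _ _ `|F n x - birkhoff xi n x|).
      by rewrite ler_piMl.
    by apply: le_trans (ler_distD (birkhoff fb n x) _ _) _; exact: lerD.
  have /andP[lo up] := hmgf t n tt1.
  have up' : E (fun x => expR (t * F n x)) <= expR c' * E (fun x => expR (t * birkhoff xi n x)).
    rewrite -ExZ//; apply: Ex_le => //; first exact: bmZ.
    by move=> x; rewrite -expRD ler_expR; have := FM x; rewrite ler_norml => /andP[]; lra.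
  have lo' : E (fun x => expR (t * birkhoff xi n x)) <= expR c' * E (fun x => expR (t * F n x)).
    rewrite -ExZ//; apply: Ex_le => //; first exact: bmZ.
    by move=> x; rewrite -expRD ler_expR; have := FM x; rewrite ler_norml => /andP[]; lra.
  have EF0 : 0 <= E (fun x => expR (t * F n x)) by apply: Ex_ge0 => x; exact: expR_ge0.
  have t3 : K1 * `|t| ^+ 3 <= K * `|t| ^+ 3 by rewrite ler_wpM2r ?exprn_ge0.
  have K0 : 0 < K by exact: lt_le_trans ltr01 K1'.
  apply/andP; split.
    rewrite ler_pdivrMl//; apply: le_trans (ler_wpM2r EF0 K4).
    rewrite -[leRHS]mulrA; apply: (@le_trans _ _ (4 * E (fun x => expR (t * birkhoff xi n x)))); last by rewrite ler_wpM2l.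
    rewrite -ler_pdivrMl//; apply: le_trans lo.
    by rewrite ler_wpM2l// ler_expR ler_wpM2l// lerD2l lerN2.
  apply: le_trans up' _; apply: le_trans (ler_wpM2l (expR_ge0 _) up) _.
  rewrite [leLHS]mulrCA [leLHS]mulrA.
  apply: (le_trans (ler_wpM2r (expR_ge0 _) K4)).
  by apply: ler_wpM2l; [exact: ltW|rewrite ler_expR ler_wpM2l// lerD2l].
Qed.

End martingale_decomposition.

(** Interface between the thermodynamic and the probabilistic half: the iterated logarithm and
    recurrence arguments see [mu] only through bounds listed here. *)
Theorem gibbs_birkhoff_sums : holder f -> ~ cohomologous_to_constant f -> is_gibbs f mu ->
  exists (F : nat -> Sig m -> R) (K t0 C : R),
  [/\ 0 < entropy mu, gibbs_bound mu f (pressure f) C, almost_additive F (asvar f mu) K t0,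
      forall A : set (SigMeas m), measurable A -> mu ((@shift m) @^-1` A) = mu A &
      forall n i, K^-1 * expR (F n i - n%:R * entropy mu) <= Pr mu (pcyl i n) <=
                  K * expR (F n i - n%:R * entropy mu)].
Proof.
move=> [b [al [b0 [al01 hb]]]] ncoh [inv [_ [C [C1 gibC]]]].
have hf : holder_class al f by exists b.
have gib : gibbs_bound mu f (pressure f) C.
  split => // n i; have [lo up] := gibC n i; move: lo up.
  by rewrite (PrE mu (measurable_pcyl i n)) !lee_fin /gibbs_weight => -> ->.
have C0 : 0 < C by exact: lt_trans C1.
(* With a single symbol the space is one point and [f] is trivially cohomologous to a constant. *)
have m0 : (0 < m)%N.
  rewrite lt0n; apply/eqP => m0; apply: ncoh.
  exists (fun=> 0), (f (fun=> ord0)); split.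
    by move=> i e e0; exists 0%N => j _; rewrite subrr normr0.
  move=> i; rewrite subrr add0r; congr f; apply/funext => k.
  by apply/val_inj => /=; have := ltn_ord (i k); case: (nat_of_ord (i k)) => //; rewrite m0.
have [g [w [hg hw g1 fgw [C' gib']]]] := exists_normalized_potential al01 hf gib.
have ExL p : holder_class al p -> Ex mu (transf g p) = Ex mu p.
  exact: (Ex_transf al01 hg g1 gib' inv).
have hE : entropy mu = pressure f - Ex mu f := entropyE al01 hf inv gib.
have hpos : 0 < entropy mu by rewrite hE; exact: (entropy_gt0 al01 inv hg hw g1 fgw m0).
have [F [K [t0 [hF hFK]]]] := gibbs_almost_additive al01 hf ncoh inv gib hg g1 ExL.
have e0 := expR_gt0 K; have K1 := aa_K hF.
pose K' := K + C * expR K.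
have KK' : K <= K' by rewrite lerDl mulr_ge0// ltW.
have CK' : C * expR K <= K' by rewrite lerDr; lra.
have K'0 : 0 < K' by lra.
exists F, K', t0, C; split => //.
  case: hF => rho0 _ t00 hag had hmgf; split => //; first by lra.
    by move=> n k i; apply: le_trans KK'.
  move=> t n /(hmgf _ n) /andP[lo up]; apply/andP; split.
    apply: le_trans lo; apply: ler_pM; rewrite ?invr_ge0 ?expR_ge0//; first exact: ltW.
      by rewrite lef_pV2 ?posrE//; lra.
    by rewrite ler_expR ler_wpM2l// lerD2l lerN2 ler_wpM2r ?exprn_ge0.
  apply: le_trans up _; apply: ler_pM; rewrite ?expR_ge0//; first by lra.
  by rewrite ler_expR ler_wpM2l// lerD2l ler_wpM2r ?exprn_ge0.
move=> n i; have := hFK n i; rewrite ler_norml => /andP[f1 f2].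
apply/andP; split.
  apply: le_trans (gibbs_lower gib n i); rewrite /gibbs_weight hE.
  apply: (@le_trans _ _ ((C * expR K)^-1 * expR (F n i - n%:R * (pressure f - Ex mu f)))).
    by rewrite ler_wpM2r ?expR_ge0// lef_pV2 ?posrE// mulr_gt0.
  by rewrite invfM -expRN -mulrA -expRD ler_wpM2l ?invr_ge0 ?(ltW C0)// ler_expR; lra.
apply: le_trans (gibbs_upper gib n i) _; rewrite /gibbs_weight hE.
apply: (@le_trans _ _ (C * expR K * expR (F n i - n%:R * (pressure f - Ex mu f)))).
  by rewrite -mulrA -expRD ler_wpM2l ?(ltW C0)// ler_expR; lra.
by rewrite ler_wpM2r ?expR_ge0.
Qed.

End gibbs_measure.

Section iterated_logarithm_asymptotics.
Variable R : realType.

Lemma ln_le_id (y : R) : 0 <= y -> ln y <= y.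
Proof.
rewrite le_eqVlt => /predU1P[<-|y0]; first by rewrite ln0.
by apply: le_trans (ln_le_subr1 y0) _; lra.
Qed.

Lemma ge1_subV_ln (y : R) : 0 < y -> 1 - y^-1 <= ln y.
Proof.
move=> y0; have yV0 : 0 < y^-1 by rewrite invr_gt0.
by have := ln_le_subr1 yV0; rewrite lnV ?posrE//; lra.
Qed.

Lemma ln_le_sqrt (y : R) : 0 < y -> ln y <= 2 * Num.sqrt y.
Proof.
move=> y0; have s0 : 0 < Num.sqrt y by rewrite sqrtr_gt0.
rewrite -{1}(sqr_sqrtr (ltW y0)) lnXn// mulr2n; have := ln_le_id (ltW s0); lra.
Qed.

Lemma nat_ge (x : R) : exists N, forall n, (N <= n)%N -> x <= n%:R.
Proof.
exists (Num.bound `|x|) => n Nn; apply: le_trans (ler_norm x) _.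
apply: le_trans (ltW (archi_boundP (normr_ge0 x))) _.
by rewrite ler_nat.
Qed.

Lemma sumn_ln_ge n : ln (n.+1%:R : R) <= \sum_(k < n) (k.+1%:R)^-1.
Proof.
elim: n => [|n IH]; first by rewrite big_ord0 ln1.
rewrite big_ord_recr /=; have n0 : 0 < n.+1%:R :> R by rewrite ltr0n.
have -> : (n.+2%:R : R) = n.+1%:R * (1 + n.+1%:R^-1).
  by rewrite -natr1; field; rewrite gt_eqF.
rewrite lnM ?posrE ?addr_gt0 ?invr_gt0// lerD// le_ln1Dx//.
by apply: lt_trans (_ : 0 < _); rewrite ?invr_gt0// ltrN10.
Qed.

Lemma invS_le_ln n : (0 < n)%N -> n.+1%:R^-1 <= ln (n.+1%:R : R) - ln (n%:R : R).
Proof.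
move=> n0; have n0' : 0 < n%:R :> R by rewrite ltr0n.
have n1 : 0 < n.+1%:R :> R by rewrite ltr0n.
rewrite -ln_div ?posrE//; apply: le_trans (ge1_subV_ln (divr_gt0 n1 n0')).
by rewrite invf_div -natr1 -[X in X - _ / _](divff (lt0r_neq0 n1)) -natr1 -mulrBl addrAC subrr add0r mul1r.
Qed.

(** Telescoping with [v k], which is [e^-1] times the power [- e] of [k.+1]; its decrements dominate
    the terms, and [v 0] is [e^-1]. *)
Lemma p_series_le (e : R) n : 0 < e ->
  \sum_(k < n) expR (- ((1 + e) * ln (k.+2%:R))) <= e^-1.
Proof.
move=> e0; pose v (k : nat) : R := e^-1 * expR (- (e * ln (k.+1%:R))).
suff h : \sum_(k < n) expR (- ((1 + e) * ln (k.+2%:R))) <= v 0%N - v n.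
  apply: le_trans h _; rewrite /v ln1 mulr0 oppr0 expR0 mulr1 gerBl.
  by rewrite mulr_ge0 ?expR_ge0// invr_ge0 ltW.
elim: n => [|n IH]; first by rewrite big_ord0 subrr.
rewrite big_ord_recr /=; apply: (@le_trans _ _ (v 0%N - v n + (v n - v n.+1))); last by lra.
rewrite lerD// /v -mulrBr ler_pdivlMl//.
set x := ln n.+1%:R; set y := ln n.+2%:R.
have yx : expR (- y) <= y - x by rewrite expRN lnK ?posrE ?ltr0n//; exact: invS_le_ln.
have -> : expR (- ((1 + e) * y)) = expR (- (e * y)) * expR (- y) by rewrite -expRD; congr expR; ring.
have -> : expR (- (e * x)) = expR (- (e * y)) * expR (e * (y - x)) by rewrite -expRD; congr expR; ring.
have := expR_ge1Dx (e * (y - x)); have := expR_gt0 (- (e * y)) => h1 h2.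
have -> : expR (- (e * y)) * expR (e * (y - x)) - expR (- (e * y)) =
  expR (- (e * y)) * (expR (e * (y - x)) - 1) by ring.
rewrite mulrCA ler_pM2l//; apply: (@le_trans _ _ (e * (y - x))); first by rewrite ler_pM2l.
by lra.
Qed.

Definition lnln (n : nat) : R := ln (ln (n%:R)).

Lemma lnln_le n k : (2 <= n)%N -> (n <= k)%N -> lnln n <= lnln k.
Proof.
move=> n2 nk; have n0 : (0 < n)%N by exact: leq_trans n2.
have l0 : 0 < ln (n%:R : R) by rewrite ln_gt0// ltr1n.
have nk' : ln (n%:R : R) <= ln k%:R by rewrite ler_ln ?posrE ?ltr0n ?ler_nat// (leq_trans n0).
by rewrite /lnln ler_ln ?posrE// (lt_le_trans l0).
Qed.

Lemma lnln_ge (x : R) : exists N, forall n, (N <= n)%N -> x <= lnln n.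
Proof.
have [N hN] := nat_ge (expR (expR x)); exists N => n /hN h.
rewrite /lnln; have n0 : 0 < n%:R :> R by exact: lt_le_trans h; rewrite expR_gt0.
have h' : expR x <= ln n%:R by rewrite -[leLHS]expRK ler_ln ?posrE ?expR_gt0.
by rewrite -[leLHS]expRK ler_ln ?posrE ?expR_gt0// (lt_le_trans _ h') ?expR_gt0.
Qed.

Lemma lnln_le_ln n : (0 < n)%N -> lnln n <= ln (n%:R).
Proof. by move=> n0; apply: ln_le_id; rewrite ln_ge0// ler1n. Qed.

Lemma lnln_small (e : R) : 0 < e -> exists N, forall n, (N <= n)%N -> lnln n <= e * n%:R.
Proof.
move=> e0; have [N hN] := nat_ge ((2 / e) ^+ 2); exists N.+1 => n Nn.
have n0 : (0 < n)%N by exact: leq_ltn_trans Nn.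
apply: le_trans (lnln_le_ln n0) _; apply: le_trans (ln_le_sqrt _) _; first by rewrite ltr0n.
have h : 2 / e <= Num.sqrt (n%:R : R).
  have e2 : 0 <= 2 / e by rewrite divr_ge0// ltW.
  by rewrite -ler_sqr ?nnegrE ?sqrtr_ge0// sqr_sqrtr ?ler0n// hN// ltnW.
rewrite -[in leRHS](sqr_sqrtr (ler0n R n)) expr2 mulrA ler_wpM2r ?sqrtr_ge0//.
by rewrite mulrC -ler_pdivrMr.
Qed.

Lemma ae_and_impl d (T : measurableType d) (mu : probability T R) (P Q S : T -> Prop) :
  {ae mu, forall x, P x} -> {ae mu, forall x, Q x} -> (forall x, P x -> Q x -> S x) ->
  {ae mu, forall x, S x}.
Proof. by move=> hP hQ h; apply: filterS2 hP hQ. Qed.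

Lemma borel_cantelli_ae d (T : measurableType d) (mu : probability T R)
    (F : nat -> set T) (u : nat -> R) (K : R) :
  (forall n, measurable (F n)) -> (forall n, Pr mu (F n) <= u n) ->
  (forall n, \sum_(k < n) u k <= K) ->
  {ae mu, forall x, exists N, forall n, (N <= n)%N -> ~ F n x}.
Proof.
move=> mF hu hK; exists [set x : T | forall N, exists n, (N <= n)%N /\ F n x]; split.
- rewrite (_ : [set x | _] = \bigcap_N \bigcup_(n in [set n | (N <= n)%N]) F n).
    apply: bigcap_measurable => // N _; apply: bigcup_measurable => n _; exact: mF.
  apply/seteqP; split => x h N; first by move=> _; have [n [Nn Fn]] := h N; exists n.
  by have [n Nn Fn] := h N I; exists n.
- exact: (borel_cantelli mF hu hK).
- move=> x /= h N; apply: contrapT => no; apply: h; exists N => n Nn Fn; apply: no.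
  by exists n.
Qed.

End iterated_logarithm_asymptotics.

(** * The law of the iterated logarithm *)

Section iterated_logarithm_upper.
Variables (R : realType) (m : nat) (mu : probability (SigMeas m) R).
Variables (f : Sig m -> R) (pr C : R) (F : nat -> Sig m -> R) (rho K t0 : R).
Hypothesis gib : gibbs_bound mu f pr C.
Hypothesis aa : almost_additive mu F rho K t0.
Local Notation E := (Ex mu).
Local Notation P := (Pr mu).

Let rho0 : 0 < rho. Proof. exact: aa_rho aa. Qed.
Let K1 : 1 <= K. Proof. exact: aa_K aa. Qed.
Let K0 : 0 < K. Proof. exact: lt_le_trans ltr01 K1. Qed.
Let t00 : 0 < t0. Proof. exact: aa_t0 aa. Qed.
Let Fagree n i j : agree i j n -> F n i = F n j. Proof. exact: (aa_agree aa). Qed.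

Lemma cylset_ge n (a : R) : cylset n [set i | a <= F n i].
Proof. by move=> i j /Fagree /= ->. Qed.

Lemma bm_almost_additive n : bm (F n : SigMeas m -> R).
Proof. by apply: (@bm_cyl _ _ n); exact: Fagree. Qed.

Lemma mgf_upper n t : `|t| <= t0 ->
  E (fun x => expR (t * F n x)) <= K * expR (n%:R * (rho * t ^+ 2 / 2 + K * `|t| ^+ 3)).
Proof. by move=> /(aa_mgf aa n) /andP[]. Qed.

Lemma mgf_lower n t : `|t| <= t0 ->
  K^-1 * expR (n%:R * (rho * t ^+ 2 / 2 - K * `|t| ^+ 3)) <= E (fun x => expR (t * F n x)).
Proof. by move=> /(aa_mgf aa n) /andP[]. Qed.

(** Chernoff's bound with parameter [t], optimal for the threshold [rho n t]; [tau] keeps the cubic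
    error below the fraction [d] of the Gaussian exponent. *)
Lemma tail_upper (d : R) : 0 < d -> exists tau : R, 0 < tau /\ forall n t, 0 <= t <= tau ->
  P [set i | rho * n%:R * t <= F n i] <= K * expR (- ((1 - d) * (n%:R * rho * t ^+ 2 / 2))).
Proof.
move=> d0; exists (Num.min t0 (d * rho / (2 * K))); split.
  by rewrite lt_min t00 divr_gt0// mulr_gt0.
move=> n t /andP[tge]; rewrite le_min => /andP[tt0 tK].
have bF := bm_almost_additive n.
have mS a : measurable ([set i | a <= F n i] : set (SigMeas m)).
  exact: (measurable_cylset (@cylset_ge n a)).
have bt : bm (fun x : SigMeas m => t * F n x) by exact: bmZ.
have mT : measurable ([set i | t * (rho * n%:R * t) <= t * F n i] : set (SigMeas m)).
  by apply: (@measurable_cylset _ n) => i j /Fagree /= ->.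
apply: le_trans (Pr_le mu (mS _) mT _) _.
  by move=> i /= h; rewrite ler_wpM2l.
apply: le_trans (chernoff mu _ bt) _.
apply: (@le_trans _ _ (expR (- (t * (rho * n%:R * t))) *
   (K * expR (n%:R * (rho * t ^+ 2 / 2 + K * `|t| ^+ 3))))).
  by rewrite ler_wpM2l ?expR_ge0// mgf_upper// ger0_norm.
rewrite mulrCA -expRD ler_wpM2l ?(ltW K0)// ler_expR ger0_norm//.
have h1 : t * (2 * K) <= d * rho by rewrite -ler_pdivlMr// mulr_gt0.
have h2 : n%:R * t ^+ 2 * (t * (2 * K)) <= n%:R * t ^+ 2 * (d * rho).
  by rewrite ler_wpM2l// mulr_ge0// sqr_ge0.
by lra.
Qed.

(* Tilting by [c' th] with [c < c' < 1], where [b = rho n th] and [a = c b]: the part of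
   [E (exp (c' th F))] outside [a <= F <= b] is negligible by the upper moment bounds at [c th]
   and [th]. *)
Lemma tail_lower (c : R) : 0 < c < 1 -> exists tau k x0 : R, [/\ 0 < tau, 0 < k &
  forall n th, 0 < th <= tau -> x0 <= n%:R * rho * th ^+ 2 / 2 ->
  k * expR (- (n%:R * rho * th ^+ 2 / 2)) <= P [set i | c * (rho * n%:R * th) <= F n i]].
Proof.
(* The tilt [c'] is the midpoint of [c] and 1, so the parts below [a] and above [b] both fall short
   of the main exponent [c' ^+ 2 / 2] by the same amount [eta], before errors of size [de]. *)
move=> /andP[c0 c1]; pose c' := (1 + c) / 2; pose eta := ((1 - c) / 2) ^+ 2 / 2.
have eta0 : 0 < eta by rewrite divr_gt0// exprn_gt0//; lra.
pose de := eta / 4; have de0 : 0 < de by rewrite divr_gt0.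
exists (Num.min t0 (de * rho / K)), (2 * K)^-1, (4 * K ^+ 2 / eta); split.
- by rewrite lt_min t00 divr_gt0// mulr_gt0.
- by rewrite invr_gt0 mulr_gt0.
move=> n th /andP[th0]; rewrite le_min => /andP[tht0 thK] hx.
pose N := n%:R * rho * th ^+ 2.
have N0 : 0 <= N by rewrite !mulr_ge0// ltW.
have Kth : K * th <= de * rho by rewrite mulrC -ler_pdivlMr.
have cub x : 0 <= x <= 1 -> n%:R * (K * `|x * th| ^+ 3) <= de * N.
  move=> /andP[x0 x1]; rewrite ger0_norm; last by rewrite mulr_ge0// ltW.
  have x3 : x ^+ 3 <= 1 by exact: exprn_ile1.
  have -> : n%:R * (K * (x * th) ^+ 3) = x ^+ 3 * (n%:R * th ^+ 2 * (K * th)) by ring.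
  have h1 : n%:R * th ^+ 2 * (K * th) <= n%:R * th ^+ 2 * (de * rho).
    by rewrite ler_wpM2l// mulr_ge0// sqr_ge0.
  have -> : de * N = 1 * (n%:R * th ^+ 2 * (de * rho)) by rewrite /N; ring.
  apply: ler_pM => //; first exact: exprn_ge0.
  by rewrite !mulr_ge0// ?sqr_ge0// ltW.
have small x : 0 <= x <= 1 -> `|x * th| <= t0.
  move=> /andP[x0 x1]; rewrite ger0_norm; last by rewrite mulr_ge0// ltW.
  by apply: le_trans tht0; rewrite ler_piMl// ltW.
have up x : 0 <= x <= 1 -> E (fun i => expR (x * th * F n i)) <= K * expR (N * (x ^+ 2 / 2 + de)).
  move=> x01; apply: le_trans (mgf_upper n (small x x01)) _.
  rewrite ler_wpM2l ?(ltW K0)// ler_expR; have := cub x x01; rewrite /N; lra.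
have lo x : 0 <= x <= 1 -> K^-1 * expR (N * (x ^+ 2 / 2 - de)) <= E (fun i => expR (x * th * F n i)).
  move=> x01; apply: le_trans (mgf_lower n (small x x01)).
  rewrite ler_wpM2l ?invr_ge0 ?(ltW K0)// ler_expR; have := cub x x01; rewrite /N; lra.
pose a := c * (rho * n%:R * th); pose b := rho * n%:R * th.
pose S := [set i | a <= F n i].
have mS : measurable (S : set (SigMeas m)) by exact: (measurable_cylset (@cylset_ge n a)).
have c'01 : 0 <= c' <= 1 by rewrite /c'; apply/andP; split; lra.
have bexp x : bm (fun i : SigMeas m => expR (x * th * F n i)).
  by apply: bm_expR; apply: bmZ; exact: bm_almost_additive.
have split3 i : expR (c' * th * F n i) <=
    expR ((c' - c) * th * a) * expR (c * th * F n i) + expR (c' * th * b) * (i \in S)%:R +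
    expR (- ((1 - c') * th * b)) * expR (1 * th * F n i).
  have [aF|Fa] := leP a (F n i).
    have [bF|Fb] := leP b (F n i).
      apply: (@le_trans _ _ (expR (- ((1 - c') * th * b)) * expR (1 * th * F n i))).
        rewrite -expRD ler_expR.
        have : (1 - c') * th * b <= (1 - c') * th * F n i.
          by rewrite ler_wpM2l// mulr_ge0 ?(ltW th0)// subr_ge0; case/andP: c'01.
        lra.
      by rewrite lerDr addr_ge0// mulr_ge0 ?expR_ge0.
    rewrite (mem_set (_ : S i))// mulr1.
    apply: (@le_trans _ _ (expR (c' * th * b))).
      by rewrite ler_expR ler_wpM2l// ?(ltW Fb)// mulr_ge0 ?(ltW th0)//; case/andP: c'01.
    by rewrite -addrA addrCA lerDl addr_ge0// mulr_ge0 ?expR_ge0.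
  apply: (@le_trans _ _ (expR ((c' - c) * th * a) * expR (c * th * F n i))).
    rewrite -expRD ler_expR.
    have : (c' - c) * th * F n i <= (c' - c) * th * a.
      by rewrite ler_wpM2l ?(ltW Fa)// mulr_ge0 ?(ltW th0)// /c'; lra.
    lra.
  by rewrite -addrA lerDl addr_ge0// mulr_ge0 ?expR_ge0.
have bS : bm (fun i : SigMeas m => (i \in S)%:R : R) by exact: bm_indic.
have main : E (fun i => expR (c' * th * F n i)) <=
    expR ((c' - c) * th * a) * (K * expR (N * (c ^+ 2 / 2 + de))) + expR (c' * th * b) * P S +
    expR (- ((1 - c') * th * b)) * (K * expR (N * (1 ^+ 2 / 2 + de))).
  apply: (@le_trans _ _ (expR ((c' - c) * th * a) * E (fun i => expR (c * th * F n i)) +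
     expR (c' * th * b) * P S + expR (- ((1 - c') * th * b)) * E (fun i => expR (1 * th * F n i)))).
    rewrite -(Ex_indic mu mS) -!ExZ// -ExD; [|exact: bmZ|exact: bmZ].
    rewrite -ExD; [|by apply: bmD; exact: bmZ|exact: bmZ].
    by apply: Ex_le => //; apply: bmD; [apply: bmD|]; exact: bmZ.
  apply: lerD; [apply: lerD => //|]; rewrite ler_wpM2l ?expR_ge0//; apply: up.
    by rewrite (ltW c0) ltW.
  by rewrite ler01 lexx.
have tha : th * a = N * c by rewrite /a /N; ring.
have thb : th * b = N by rewrite /b /N; ring.
have lo' := lo _ c'01.
pose Z := expR (N * (c' ^+ 2 / 2 - de)).
have T1 : expR ((c' - c) * th * a) * (K * expR (N * (c ^+ 2 / 2 + de))) = K * (Z * expR (- (N * (eta / 2)))).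
  rewrite mulrCA /Z -!expRD; congr (K * expR _).
  by rewrite -mulrA tha /c' /de /eta; field.
have T3 : expR (- ((1 - c') * th * b)) * (K * expR (N * (1 ^+ 2 / 2 + de))) = K * (Z * expR (- (N * (eta / 2)))).
  rewrite mulrCA /Z -!expRD; congr (K * expR _).
  by rewrite -mulrA thb /c' /de /eta; field.
have Z0 : 0 < Z by exact: expR_gt0.
(* Each of the two outer parts takes at most a quarter of the lower bound [K^-1 * Z], so half of it
   remains for the middle part. *)
have hexp : K * expR (- (N * (eta / 2))) <= K^-1 / 4.
  rewrite expRN ler_pdivrMr ?expR_gt0// -ler_pdivrMl ?mulr_gt0 ?invr_gt0//.
  have := expR_ge1Dx (N * (eta / 2)).
  have : 4 * K ^+ 2 <= N * (eta / 2).
    by have : 4 * K ^+ 2 <= N / 2 * eta by [rewrite -ler_pdivrMr]; lra.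
  rewrite (_ : (K^-1 / 4)^-1 * K = 4 * K ^+ 2); last by field; rewrite gt_eqF.
  lra.
have half : (2 * K)^-1 * Z <= expR (c' * th * b) * P S.
  move: main; rewrite T1 T3 => main.
  have h : K * (Z * expR (- (N * (eta / 2)))) <= K^-1 / 4 * Z.
    by rewrite mulrCA mulrC ler_wpM2r ?(ltW Z0).
  have : (2 * K)^-1 * Z = K^-1 * Z / 2 by field; rewrite gt_eqF.
  by move: lo'; rewrite -/Z; lra.
rewrite -[P _]/(P S) -(ler_pM2l (expR_gt0 (c' * th * b))); apply: le_trans half.
rewrite mulrCA ler_wpM2l ?invr_ge0 ?mulr_ge0 ?(ltW K0)// /Z -expRD ler_expR.
rewrite -mulrA thb -/N /de /c'.
have -> : N * (((1 + c) / 2) ^+ 2 / 2 - eta / 4) = (1 + c) / 2 * N - N / 2 + N * (3 / 4 * eta).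
  by rewrite /eta; field.
by have : 0 <= N * (3 / 4 * eta) by [rewrite mulr_ge0// mulr_ge0// ltW]; lra.
Qed.

Let C1 : 1 < C. Proof. by case: gib. Qed.
Let C0 : 0 < C. Proof. exact: lt_trans C1. Qed.
Let mge n a : measurable ([set i | a <= F n i] : set (SigMeas m)).
Proof. by apply: (@measurable_cylset _ n); exact: cylset_ge. Qed.

Lemma Pr_disjoint_le (G : nat -> set (Sig m)) (S : set (Sig m)) n :
  (forall k, measurable (G k : set (SigMeas m))) -> measurable (S : set (SigMeas m)) ->
  (forall i k l, G k i -> G l i -> k = l) -> (forall k, G k `<=` S) ->
  \sum_(k < n) P (G k) <= P S.
Proof.
move=> mG mS dG GS; under eq_bigr => k _ do rewrite -(Ex_indic mu (mG k)).
rewrite -(Ex_indic mu mS).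
have bG k : bm (fun x : SigMeas m => (x \in G k)%:R : R) by exact: bm_indic.
rewrite -(@Ex_sum _ _ _ mu _ (index_enum 'I_n) xpredT (fun k x => (x \in G k)%:R))//.
apply: Ex_le; [by apply: bm_sum|exact: bm_indic|move=> x].
have [[k Gk]|no] := pselect (exists k : 'I_n, G k x).
  rewrite (bigD1 k)//= big1 => [|l lk]; last first.
    rewrite memNset// => Gl; case/eqP: lk; apply/val_inj; exact: dG Gl Gk.
  by rewrite addr0 (mem_set Gk) (mem_set (GS _ _ Gk)).
rewrite big1 ?ler0n// => l _; rewrite memNset// => Gl; apply: no; by exists l.
Qed.

(** Chernoff's bound at [t = - 1 / sqrt N], where the moments are bounded uniformly in [k <= N];
    [N1] makes this [t] admissible. *)
Lemma lower_deviation : exists (B : R) N1, 0 <= B /\ forall N k, (N1 <= N)%N -> (k <= N)%N ->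
  C ^+ 3 * P [set i | F k i < - (B * Num.sqrt N%:R)] <= 2^-1.
Proof.
(* Chosen so that the final bound equals [expR (- D) * D / 2], at most one half. *)
pose D := 2 * C ^+ 3 * K * expR (rho / 2 + K).
have D0 : 0 < D by rewrite !mulr_gt0 ?exprn_gt0 ?expR_gt0.
have [N1 hN1] := nat_ge (Num.max 1 (t0^-1 ^+ 2)).
exists D, N1; split; first exact: ltW.
move=> N k NN kN; have := hN1 N NN; rewrite ge_max => /andP[N1' Nt].
have n0 : 0 < N%:R :> R by exact: lt_le_trans N1'.
set s := Num.sqrt N%:R; have s0 : 0 < s by rewrite sqrtr_gt0.
have sE : s ^+ 2 = N%:R by rewrite sqr_sqrtr// ltW.
have s1 : 1 <= s by rewrite -(@ler_sqr _ 1 s) ?nnegrE ?(ltW s0)// expr1n sE.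
have st : s^-1 <= t0.
  rewrite -[t0]invrK lef_pV2 ?posrE ?invr_gt0//.
  by rewrite -ler_sqr ?nnegrE ?invr_ge0 ?(ltW s0) ?(ltW t00)// sE.
have bF : bm (F k : SigMeas m -> R) by exact: bm_almost_additive.
have bt : bm (fun x : SigMeas m => - s^-1 * F k x) by exact: bmZ.
have mlt : measurable ([set i | F k i < - (D * s)] : set (SigMeas m)).
  by apply: (@measurable_cylset _ k) => i j /Fagree /= ->.
have mT : measurable ([set i | D <= - s^-1 * F k i] : set (SigMeas m)).
  by apply: (@measurable_cylset _ k) => i j /Fagree /= ->.
have h1 : P [set i | F k i < - (D * s)] <= P [set i | D <= - s^-1 * F k i].
  apply: Pr_le => // i /= h; rewrite mulNr lerNr -(ler_pM2l s0) mulrA divff ?gt_eqF// mul1r.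
  by rewrite mulrN mulrC; exact: ltW.
have h2 : E (fun x => expR (- s^-1 * F k x)) <= K * expR (rho / 2 + K).
  have sn : `|- s^-1| = s^-1 by rewrite normrN gtr0_norm ?invr_gt0.
  apply: le_trans (mgf_upper k _) _; first by rewrite sn.
  rewrite ler_wpM2l ?(ltW K0)// ler_expR sn sqrrN.
  have kN' : k%:R <= N%:R :> R by rewrite ler_nat.
  have e2 : k%:R * s^-1 ^+ 2 <= 1 by rewrite exprVn sE ler_pdivrMr// mul1r.
  have e3 : k%:R * s^-1 ^+ 3 <= 1.
    rewrite exprSr mulrA; apply: (@le_trans _ _ (1 * 1)); last by rewrite mulr1.
    apply: ler_pM => //; rewrite ?invr_ge0 ?(ltW s0)//.
      by rewrite mulr_ge0// exprn_ge0// invr_ge0 ltW.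
    by rewrite invf_le1.
  have -> : k%:R * (rho * s^-1 ^+ 2 / 2 + K * s^-1 ^+ 3) =
    rho / 2 * (k%:R * s^-1 ^+ 2) + K * (k%:R * s^-1 ^+ 3) by field; rewrite gt_eqF.
  apply: lerD; first by rewrite ler_piMr// divr_ge0// ltW.
  by rewrite ler_piMr// ltW.
have h3 := chernoff mu D bt.
have eD : expR (- D) * D <= 1.
  rewrite expRN ler_pdivrMl ?expR_gt0// mulr1.
  by have := expR_ge1Dx D; lra.
have h4 : P [set i | F k i < - (D * s)] <= expR (- D) * (K * expR (rho / 2 + K)).
  apply: le_trans h1 _; apply: le_trans h3 _.
  by rewrite ler_wpM2l ?expR_ge0.
have c30 : 0 <= C ^+ 3 by rewrite exprn_ge0// ltW.
apply: le_trans (ler_wpM2l c30 h4) _.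
have -> : C ^+ 3 * (expR (- D) * (K * expR (rho / 2 + K))) = expR (- D) * D / 2 by rewrite /D; field.
lra.
Qed.

(* Ottaviani's inequality, with quasi-independence in place of independence. *)
Lemma maximal_inequality : exists (B : R) N1, 0 <= B /\ forall N a, (N1 <= N)%N ->
  P [set i | exists k, (k <= N)%N /\ a <= F k i] <= 2 * P [set i | a - B * Num.sqrt N%:R <= F N i].
Proof.
have [B [N1 [B0 hB]]] := lower_deviation.
exists (B + K), N1.+1; split; first by rewrite addr_ge0// ltW.
move=> N a NN; set s := Num.sqrt N%:R.
have s1 : 1 <= s.
  rewrite -(@ler_sqr _ 1 s) ?nnegrE ?sqrtr_ge0// expr1n sqr_sqrtr// ler1n.
  exact: leq_ltn_trans NN.
(* First passage at time [k]: disjoint events, each decided by the first [k] symbols. *)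
pose A k := [set i | a <= F k i /\ forall l, (l < k)%N -> F l i < a].
have cA k : cylset k (A k).
  move=> i j ij [ai hi]; split; first by rewrite -(Fagree ij).
  by move=> l lk; rewrite -(Fagree (agree_le (ltnW lk) ij)); exact: hi.
have mA k : measurable (A k : set (SigMeas m)) by exact: (measurable_cylset (@cA k)).
pose S := [set i | a - (B + K) * s <= F N i].
have mS : measurable (S : set (SigMeas m)) by exact: mge.
pose G k := if (k <= N)%N then A k `&` S else set0.
have mG k : measurable (G k : set (SigMeas m)).
  by rewrite /G; case: ifP => // _; exact: measurableI.
(* After a first passage the remaining increment drops below [- B * s] with conditional probability
   at most one half; the extra [K] in the constant absorbs the error of almost additivity. *)
have half k : (k <= N)%N -> P (A k) <= 2 * P (A k `&` S).
  move=> kN; pose D := [set i | F (N - k)%N i < - (B * s)].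
  have cD : cylset (N - k) D by move=> i j ij; rewrite /D /= (Fagree ij).
  have mD : measurable (iter k (@shift m) @^-1` D : set (SigMeas m)).
    by apply: measurable_preimage_iter; [exact: measurable_shift|exact: (measurable_cylset cD)].
  have /andP[_ up] := Pr_qb gib (@cA k) cD.
  have hD := hB N (N - k)%N (ltnW NN) (leq_subr _ _).
  have mI : measurable (A k `&` ~` (iter k (@shift m) @^-1` D) : set (SigMeas m)).
    by apply: measurableI => //; exact: measurableC.
  have := PrID mu (mA k) mD => hID.
  have : P (A k `&` ~` (iter k (@shift m) @^-1` D)) <= P (A k `&` S).
    apply: Pr_le => //; first exact: measurableI.
    move=> i [[aF hi] /= nD]; split => //; rewrite /S /=.
    have := aa_add aa k (N - k)%N i; rewrite subnKC// ler_norml => /andP[h1 _].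
    move: nD; rewrite /D /= => /negP; rewrite -leNgt => nD.
    by have := ler_peMr (ltW K0) s1; lra.
  have : C ^+ 3 * (P (A k) * P D) <= 2^-1 * P (A k).
    by rewrite mulrCA mulrC ler_wpM2r ?Pr_ge0.
  by move: hID up; lra.
have sub : [set i | exists k, (k <= N)%N /\ a <= F k i] `<=` \big[setU/set0]_(k < N.+1) A k.
  move=> i [k [kN ak]]; have [l [al hl]] : exists l, a <= F l i /\ forall l', (l' < l)%N -> F l' i < a.
    have ex : exists l, a <= F l i by exists k.
    exists (ex_minn ex); case: ex_minnP => l al hl; split => // l' l'l.
    by rewrite ltNge; apply/negP => /hl; rewrite leqNgt l'l.
  have lk : (l <= N)%N.
    apply: leq_trans kN; rewrite leqNgt; apply/negP => kl; have := hl k kl.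
    by rewrite ltNge ak.
  rewrite -bigcup_mkord; exists l => //=.
have mE : measurable ([set i | exists k, (k <= N)%N /\ a <= F k i] : set (SigMeas m)).
  apply: (@measurable_cylset _ N) => i j ij [k [kN ak]]; exists k; split => //.
  by rewrite -(Fagree (agree_le kN ij)).
apply: le_trans (Pr_le mu mE _ sub) _; first by apply: bigsetU_measurable => k _; exact: mA.
apply: le_trans (Pr_bigsetU_le _ _ _ _) _ => //.
apply: (@le_trans _ _ (\sum_(k < N.+1) 2 * P (G k))).
  by apply: ler_sum => k _; rewrite /G -ltnS ltn_ord; apply: half; rewrite -ltnS.
rewrite -mulr_sumr ler_wpM2l//; apply: Pr_disjoint_le => //.
  move=> i k l; rewrite /G; case: ifP => // _ [[ak hk] _]; case: ifP => // _ [[al hl] _].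
  by apply/eqP; rewrite eqn_leq; apply/andP; split; rewrite leqNgt; apply/negP;
    [move=> /hk; rewrite ltNge al|move=> /hl; rewrite ltNge ak].
by move=> k i; rewrite /G; case: ifP => // _ [].
Qed.

Definition lil_scale (n : nat) : R := Num.sqrt (2 * rho * n%:R * lnln R n).
Local Notation A := lil_scale.

Lemma lil_scale_le n k : (2 <= n)%N -> (n <= k)%N -> 0 <= lnln R n -> A n <= A k.
Proof.
move=> n2 nk l0; rewrite ler_wsqrtr// -!mulrA ler_wpM2l// ler_wpM2l ?(ltW rho0)//.
by apply: ler_pM => //; [rewrite ler_nat|exact: lnln_le].
Qed.

Lemma lil_scale_ge (x : R) : exists N, forall n, (N <= n)%N -> x <= A n.
Proof.
have [N hN] := @lnln_ge R (x ^+ 2 / (2 * rho)); exists N.+1 => n Nn.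
have [x0|x0] := leP x 0; first exact: le_trans x0 (sqrtr_ge0 _).
have r2 : 0 < 2 * rho by rewrite mulr_gt0.
have := hN n (ltnW Nn); rewrite ler_pdivrMr// mulrC => h.
have h0 := le_trans (sqr_ge0 x) h.
rewrite -[x](gtr0_norm x0) -sqrtr_sqr ler_wsqrtr//; apply: le_trans h _.
rewrite [leRHS]mulrAC ler_peMr//.
by rewrite ler1n; exact: leq_ltn_trans Nn.
Qed.

Lemma ln4_ge1 : 1 <= ln (4 : R).
Proof.
have := @ge1_subV_ln R 2 (ltr0n _ 2).
have -> : ln (4 : R) = ln 2 + ln 2 by rewrite -lnM ?posrE//; congr ln; ring.
lra.
Qed.

(** Cutting the interval from [4 ^ j * q] to [4 ^ j.+1 * q] into [3 * q] equal blocks gives integer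
    times with ratios at most [(q + 1) / q], without rounding powers of a real number close to
    one. *)
Lemma block_decomposition q k : (0 < q)%N -> (q <= k)%N ->
  exists j i, [/\ (i < 3 * q)%N, (4 ^ j * (q + i) <= k)%N, (k <= 4 ^ j * (q + i).+1)%N &
    forall J, (4 ^ J * q <= k)%N -> (J <= j)%N].
Proof.
move=> q0 qk; pose p := (k %/ q)%N; have p0 : (0 < p)%N by rewrite divn_gt0.
have /andP[lo up] := trunc_log_bounds (isT : (1 < 4)%N) p0.
set j := trunc_log 4 p in lo up; have j0 : (0 < 4 ^ j)%N by rewrite expn_gt0.
have lo' : (4 ^ j * q <= k)%N by rewrite -leq_divRL.
have up' : (k < 4 ^ j.+1 * q)%N by rewrite -ltn_divLR.
have qj : (q <= k %/ 4 ^ j)%N by rewrite leq_divRL// mulnC.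
exists j, (k %/ 4 ^ j - q)%N; rewrite subnKC//; split.
- by rewrite ltn_subLR// -mulSn ltn_divLR//; move: up'; rewrite expnS mulnAC.
- by rewrite mulnC leq_trunc_div.
- by rewrite mulnC ltnW// ltn_ceil.
- move=> J hJ; rewrite -(@leq_exp2l 4)//; rewrite leqNgt; apply/negP => jJ.
  have : (4 ^ j.+1 <= 4 ^ J)%N by rewrite leq_exp2l// -(@ltn_exp2l 4).
  move=> /(leq_mul (leqnn q)); rewrite mulnC [(q * 4 ^ J)%N]mulnC => h.
  by have := leq_trans (leq_trans up' h) hJ; rewrite ltnn.
Qed.

Lemma lnln_pow4_ge j n : (0 < j)%N -> (4 ^ j <= n)%N -> ln (j%:R : R) <= lnln R n.
Proof.
move=> j0 jn; have j0' : 0 < j%:R :> R by rewrite ltr0n.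
have h2 : (2 <= 4 ^ j)%N by case: j j0 {jn j0'} => // j _; rewrite expnS; have : (0 < 4 ^ j)%N by [rewrite expn_gt0]; lia.
apply: le_trans (lnln_le R h2 jn); rewrite /lnln natrX lnXn//.
have lj : (j%:R : R) <= ln 4 *+ j by rewrite -[leRHS]mulr_natr ler_peMl// ln4_ge1.
by rewrite ler_ln ?posrE// (lt_le_trans j0').
Qed.

Lemma block_ratio (q i j : nat) : (0 < q)%N ->
  (q%:R / q.+1%:R) * Num.sqrt ((4 ^ j * (q + i).+1)%N%:R : R) <= Num.sqrt (4 ^ j * (q + i))%N%:R.
Proof.
move=> q0; have q1 : 0 < q.+1%:R :> R by rewrite ltr0n.
rewrite -[q%:R / _]ger0_norm ?divr_ge0// -sqrtr_sqr -sqrtrM ?sqr_ge0//.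
rewrite ler_wsqrtr// exprMn exprVn mulrAC ler_pdivrMr ?exprn_gt0//.
rewrite -!natrX -!natrM ler_nat mulnCA -mulnA leq_mul2l; apply/orP; right.
rewrite [q.+1]lock -!mulnn -lock; nia.
Qed.

(* Borel-Cantelli for the maximal inequality along the times [4^j (q + i)], [i < 3 q], whose
   consecutive ratios are close to [1]. *)
Theorem lil_upper (d : R) : 0 < d ->
  {ae mu, forall x : SigMeas m, exists N, forall k, (N <= k)%N -> F k x < (1 + d) * A k}.
Proof.
move=> d0.
(* This size gives [(1 + d) * q / (q + 1) >= 1 + 3 * d / 4]: moving from the left to the right end
   of a block costs [d / 4]. *)
have [q' hq'] := nat_ge (4 / d + 3 : R); pose q := q'.+1.
have q0 : (0 < q)%N by [].
have hq : 4 / d + 3 <= q%:R :> R by apply: hq'.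
have [B [N1 [B0 hmax]]] := maximal_inequality.
(* It satisfies [1 - dd = 1 / (1 + d / 2)], so the tail exponent at level [1 + d / 2] is exactly
   [(1 + d / 2)] times the iterated logarithm, hence summable in [j]. *)
pose dd := d / 2 / (1 + d / 2).
have d2 : 0 < 1 + d / 2 by lra.
have dd0 : 0 < dd by rewrite !divr_gt0.
have [tau [tau0 htail]] := tail_upper dd0.
pose e := tau ^+ 2 * rho / (2 * (1 + d / 2) ^+ 2).
have e0 : 0 < e by rewrite divr_gt0 ?mulr_gt0 ?exprn_gt0.
have [M1 hM1] := lnln_small e0.
have [M2 hM2] := @lnln_ge R ((4 * B / d) ^+ 2 / (2 * rho)).
pose J := (maxn (maxn M1 M2) (maxn N1 2)).
have J2 : (2 <= J)%N by rewrite /J !leq_max leqnn !orbT.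
pose N0 j i := (4 ^ j * (q + i))%N.
pose N2 j i := (4 ^ j * (q + i).+1)%N.
pose W j i := [set x : Sig m | exists k, (k <= N2 j i)%N /\ (1 + d) * A (N0 j i) <= F k x].
have mW j i : measurable (W j i : set (SigMeas m)).
  apply: (@measurable_cylset _ (N2 j i)) => x y xy [k [kN hk]]; exists k; split => //.
  by rewrite -(Fagree (agree_le kN xy)).
have N0_ge j i : (J <= j)%N -> [/\ (4 ^ j <= N0 j i)%N, (2 <= N0 j i)%N, (M1 <= N0 j i)%N,
    (M2 <= N0 j i)%N & (N1 <= N2 j i)%N].
  move=> Jj; have h1 : (4 ^ j <= N0 j i)%N by rewrite /N0 leq_pmulr// addn_gt0.
  have h2 : (N0 j i <= N2 j i)%N by rewrite /N0 /N2 leq_mul2l leqnSn orbT.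
  have h3 : (j < 4 ^ j)%N by exact: ltn_expl.
  have jN : (j <= N0 j i)%N by exact: leq_trans (ltnW h3) h1.
  move: Jj; rewrite /J !geq_max => /andP[/andP[a1 a2] /andP[a3 a4]].
  by split => //; [exact: leq_trans jN|exact: leq_trans jN|exact: leq_trans jN|exact: leq_trans (leq_trans jN h2)].
have lnln0 j i : (J <= j)%N -> 0 <= lnln R (N0 j i).
  move=> /(N0_ge j i) [_ _ _ h _]; apply: le_trans (hM2 _ h).
  by rewrite divr_ge0 ?sqr_ge0// mulr_ge0// ltW.
have PW j i : (J <= j)%N -> P (W j i) <= 2 * K * expR (- ((1 + d / 2) * ln j%:R)).
  move=> Jj; have [h1 h2 h3 h4 h5] := N0_ge j i Jj.
  set n0 := N0 j i; set n1 := N2 j i; set l := lnln R n0.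
  have l0 : 0 <= l by exact: lnln0.
  have n01 : (n0 <= n1)%N by rewrite /n0 /n1 /N0 /N2 leq_mul2l leqnSn orbT.
  have n0p : 0 < n0%:R :> R by rewrite ltr0n (leq_trans _ h2).
  have n1p : 0 < n1%:R :> R by rewrite (lt_le_trans n0p)// ler_nat.
  set S := Num.sqrt (2 * rho * l); set s1 := Num.sqrt (n1%:R : R); set s0 := Num.sqrt (n0%:R : R).
  have s10 : 0 < s1 by rewrite sqrtr_gt0.
  have S0 : 0 <= S by exact: sqrtr_ge0.
  have r0 : 0 <= 2 * rho * l by rewrite !mulr_ge0// ltW.
  have S2 : S ^+ 2 = 2 * rho * l by rewrite sqr_sqrtr.
  have s12 : s1 ^+ 2 = n1%:R by rewrite sqr_sqrtr// ltW.
  have AE : A n0 = s0 * S.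
    by rewrite /A -sqrtrM ?(ltW n0p)//; congr Num.sqrt; rewrite -/l; ring.
  pose t := (1 + d / 2) * S / (rho * s1).
  have rs0 : 0 < rho * s1 by rewrite mulr_gt0.
  have t0' : 0 <= t by apply: divr_ge0; [apply: mulr_ge0 => //; exact: ltW|exact: ltW].
  have tt : t <= tau.
    rewrite ler_pdivrMr// -ler_sqr ?nnegrE ?mulr_ge0 ?(ltW d2) ?(ltW tau0) ?(ltW rho0) ?(ltW s10)//.
    rewrite !exprMn S2 s12.
    have hl : l <= e * n1%:R.
      by apply: le_trans (hM1 _ h3) _; rewrite ler_wpM2l ?(ltW e0)// ler_nat.
    have -> : tau ^+ 2 * (rho ^+ 2 * n1%:R) = (1 + d / 2) ^+ 2 * (2 * rho * (e * n1%:R)).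
      by rewrite /e; field; rewrite gt_eqF//; lra.
    by rewrite ler_wpM2l ?sqr_ge0// ler_wpM2l// mulr_ge0// ltW.
  (* Of the surplus [3 * d / 4] left by the block ratio, [d / 4] pays for the maximal inequality;
     [1 + d / 2] remains. *)
  have key : rho * n1%:R * t <= (1 + d) * A n0 - B * s1.
    have -> : rho * n1%:R * t = (1 + d / 2) * S * s1.
      by rewrite -s12 /t; field; rewrite !gt_eqF.
    have hs := block_ratio i j q0; rewrite -/(N0 j i) -/(N2 j i) -/n0 -/n1 -/s0 -/s1 in hs.
    have q1 : 0 < q.+1%:R :> R by rewrite ltr0n.
    have hqd : (1 + 3 * d / 4) <= (1 + d) * (q%:R / q.+1%:R).
      rewrite mulrA ler_pdivlMr// -natr1.
      have : 4 + 3 * d <= d * q%:R.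
        by have := ler_wpM2l (ltW d0) hq; rewrite mulrDr mulrCA divff ?gt_eqF// mulr1; lra.
      by lra.
    have BS : B <= d / 4 * S.
      have := hM2 _ h4; rewrite -/n0 -/l ler_pdivrMr ?mulr_gt0// [leRHS]mulrC -S2.
      rewrite ler_sqr ?nnegrE ?divr_ge0 ?mulr_ge0 ?(ltW d0)// => h.
      by move: h; rewrite ler_pdivrMr//; lra.
    rewrite AE.
    have : (1 + 3 * d / 4) * s1 * S <= (1 + d) * (s0 * S).
      apply: (@le_trans _ _ ((1 + d) * (q%:R / q.+1%:R) * s1 * S)).
        by rewrite ler_wpM2r// ler_wpM2r// ltW.
      rewrite -!mulrA ler_wpM2l//; first by lra.
      by rewrite !mulrA ler_wpM2r// -!mulrA mulrA.
    have := ler_wpM2r (ltW s10) BS; lra.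
  have hm := hmax n1 ((1 + d) * A n0) h5; rewrite -/s1 in hm.
  apply: (le_trans hm).
  rewrite -mulrA ler_wpM2l//.
  have sub : [set x | (1 + d) * A n0 - B * s1 <= F n1 x] `<=` [set x | rho * n1%:R * t <= F n1 x].
    by move=> x /=; exact: le_trans.
  apply: le_trans (Pr_le mu (mge _ _) (mge _ _) sub) _.
  apply: le_trans (htail n1 t _) _; first by rewrite t0' tt.
  rewrite ler_wpM2l ?(ltW K0)// ler_expR lerN2.
  have -> : (1 - dd) * (n1%:R * rho * t ^+ 2 / 2) = (1 + d / 2) * l.
    have -> : t ^+ 2 = (1 + d / 2) ^+ 2 * (2 * rho * l) / (rho ^+ 2 * n1%:R).
      by rewrite /t -S2 -s12; field; rewrite !gt_eqF.
    by rewrite /dd; field; rewrite !gt_eqF//; lra.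
  rewrite ler_wpM2l ?(ltW d2)//; apply: lnln_pow4_ge => //.
  exact: leq_trans (ltnW J2) Jj.
pose V n := \big[setU/set0]_(i < 3 * q) W (n + J)%N i.
have mV n : measurable (V n : set (SigMeas m)) by apply: bigsetU_measurable => i _; exact: mW.
pose D := (3 * q)%:R * (2 * K).
have D0 : 0 <= D by rewrite mulr_ge0// mulr_ge0// ltW.
have PV n : P (V n) <= D * expR (- ((1 + d / 2) * ln n.+2%:R)).
  apply: le_trans (Pr_bigsetU_le mu _ _ _) _ => //.
  apply: (@le_trans _ _ (\sum_(i < 3 * q) 2 * K * expR (- ((1 + d / 2) * ln n.+2%:R)))).
    apply: ler_sum => i _; apply: le_trans (PW _ _ (leq_addl _ _)) _.
    rewrite ler_wpM2l ?mulr_ge0 ?(ltW K0)// ler_expR lerN2 ler_wpM2l ?(ltW d2)//.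
    have nJ : (n.+2 <= n + J)%N by rewrite -addn2 leq_add2l.
    by rewrite ler_ln ?posrE ?ltr0n ?ler_nat//; apply: leq_trans nJ.
  by rewrite sumr_const card_ord -[leLHS]mulr_natl /D [leLHS]mulrA.
have SV n : \sum_(k < n) D * expR (- ((1 + d / 2) * ln k.+2%:R)) <= D * (d / 2)^-1.
  by rewrite -mulr_sumr ler_wpM2l// p_series_le// divr_gt0.
apply: filterS (borel_cantelli_ae mV PV SV) => x [N hN].
exists (4 ^ (N + J) * q)%N => k hk; rewrite ltNge; apply/negP => Fk.
have qk : (q <= k)%N by apply: leq_trans hk; rewrite leq_pmull// expn_gt0.
have [j [i [iq lo up jJ]]] := block_decomposition q0 qk.
have Nj := jJ _ hk; have Jj : (J <= j)%N by exact: leq_trans (leq_addl _ _) Nj.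
apply: (hN (j - J)%N); first by rewrite leq_subRL// addnC.
rewrite /V -bigcup_mkord; exists i => //=; rewrite subnK//; exists k; split => //.
apply: le_trans Fk; rewrite ler_wpM2l//; first by lra.
have [_ h2 _ _ _] := N0_ge j i Jj.
by apply: lil_scale_le => //; exact: lnln0.
Qed.

End iterated_logarithm_upper.

(** * Lower half of the law of the iterated logarithm *)

Section lower_lil_theorem.
Variables (R : realType) (m : nat) (mu : probability (SigMeas m) R).
Variables (f : Sig m -> R) (pr C : R) (F : nat -> Sig m -> R) (rho K t0 : R).
Hypothesis gib : gibbs_bound mu f pr C.
Hypothesis aa : almost_additive mu F rho K t0.
Local Notation P := (Pr mu).
Local Notation A := (lil_scale rho).

Let rho0 : 0 < rho. Proof. exact: aa_rho aa. Qed.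

Lemma almost_additiveN : almost_additive mu (fun n i => - F n i) rho K t0.
Proof.
case: aa => h1 h2 h3 hag had hmgf; split => //.
- by move=> n i j /(hag n) ->.
- move=> n k i; have -> : - F (n + k)%N i - - F n i - - F k (iter n (@shift m) i) =
    - (F (n + k)%N i - F n i - F k (iter n (@shift m) i)) by ring.
  by rewrite normrN.
- move=> t n tt; have := hmgf (- t) n; rewrite normrN sqrrN => /(_ tt).
  by rewrite (eq_Ex mu (q := fun x => expR (t * - F n x)))// => x; rewrite mulNr mulrN.
Qed.

Lemma succ_add_le_mul (i j : nat) : ((i + j).+1 <= j.+1 * i.+1)%N.
Proof. by rewrite mulSn mulnS addnA -addSn addSn -addSn leq_addr. Qed.

(* The increments between the times [Q^j] are quasi-independent; the upper law applied to [- F]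
   bounds what is lost before each increment. *)
Theorem lil_lower (d : R) : 0 < d < 1 ->
  {ae mu, forall x : SigMeas m, forall N, exists k, (N <= k)%N /\ (1 - d) * A k <= F k x}.
Proof.
move=> /andP[d0 d1]; pose c := 1 - d / 4.
have c01 : 0 < c < 1 by rewrite /c; apply/andP; split; lra.
have /andP[c0 c1] := c01.
have [tau [kap [x0 [tau0 kap0 htail]]]] := tail_lower aa c01.
(* Budget for the total loss [d]: [d / 4] from [c], [d / 6] from the factor [1 - 1 / s] of the
   shorter increment, [2 * d / 6] from the past and [d / 4] from almost additivity. *)
have [s' hs'] := nat_ge (6 / d : R); pose s := s'.+2.
have hs : 6 / d <= s%:R :> R by apply: hs'; rewrite /s -addn2 leq_addr.
have s0 : 0 < s%:R :> R by rewrite ltr0n.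
pose Q := (s ^ 2)%N.
have Q4 : (4 <= Q)%N by rewrite /Q -[4%N]/(2 ^ 2)%N leq_exp2r.
have Qp : (0 < Q)%N by exact: leq_trans Q4.
have Q1 : (1 < Q)%N by exact: leq_trans Q4.
have lnQ : 1 <= ln (Q%:R : R).
  by apply: le_trans (ln4_ge1 R) _; rewrite ler_ln ?posrE ?ltr0n// ler_nat.
have Q0 : 0 < ln (Q%:R : R) by exact: lt_le_trans lnQ.
pose e := tau ^+ 2 * rho / 8.
have e0 : 0 < e by rewrite divr_gt0// mulr_gt0// exprn_gt0.
have [M1 hM1] := lnln_small e0.
have [M2 hM2] := @lnln_ge R (Num.max x0 1).
pose J := maxn M1 M2.
pose t j := (Q ^ (j + J))%N.
pose l j := (t j.+1 - t j)%N.
have tS j : t j.+1 = (Q * t j)%N by rewrite /t addSn expnS.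
have t_gt0 j : (0 < t j)%N by rewrite /t expn_gt0 Qp.
have t_le j : (t j <= t j.+1)%N by rewrite tS leq_pmull.
have tl j : (t j + l j)%N = t j.+1 by rewrite subnKC.
have tj j : (j + J <= t j)%N by rewrite ltnW// ltn_expl.
pose L j := lnln R (t j.+1).
have L_ge j : Num.max x0 1 <= L j.
  by apply: hM2; apply: leq_trans (tj j.+1); apply: leq_trans (leq_maxr _ _) (leq_addl _ _).
have L1 j : 1 <= L j by apply: le_trans (L_ge j); rewrite le_max lexx orbT.
have L0 j : 0 < L j by exact: lt_le_trans (L1 j).
have LE j : L j = ln ((j + J).+1%:R) + ln (ln Q%:R).
  rewrite /L /lnln /t addSn natrX lnXn ?ltr0n//.
  by rewrite -[ln _ *+ _]mulr_natr lnM ?posrE// addrC.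
have l_ge j : (t j.+1)%:R * (1 - s%:R^-1) ^+ 2 <= (l j)%:R :> R.
  rewrite /l natrB// tS /Q natrM natrX.
  have -> : s%:R ^+ 2 * (t j)%:R * (1 - s%:R^-1) ^+ 2 = (t j)%:R * (s%:R - 1) ^+ 2 :> R.
    by field; rewrite gt_eqF.
  have -> : s%:R ^+ 2 * (t j)%:R - (t j)%:R = (t j)%:R * (s%:R ^+ 2 - 1) :> R by ring.
  rewrite ler_wpM2l//; have : 1 <= s%:R :> R by rewrite ler1n.
  by nra.
have s2 : s%:R^-1 <= 2^-1 :> R by rewrite lef_pV2 ?posrE// ler_nat.
have l_half j : (t j.+1)%:R / 4 <= (l j)%:R :> R.
  apply: le_trans (l_ge j); rewrite ler_wpM2l//.
  by have := sqr_ge0 (2^-1 - s%:R^-1 : R); lra.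
have t_pos j : 0 < (t j)%:R :> R by rewrite ltr0n.
have l_pos j : 0 < (l j)%:R :> R by apply: lt_le_trans (l_half j); rewrite divr_gt0.
(* This makes the Gaussian exponent of [tail_lower] equal to [L j], so [P (B j)] is at least a
   multiple of [1 / (j + J + 1)], whose sum diverges. *)
pose th j := Num.sqrt (2 * L j / (rho * (l j)%:R)).
have th2 j : th j ^+ 2 = 2 * L j / (rho * (l j)%:R).
  by rewrite sqr_sqrtr// divr_ge0 ?mulr_ge0// ltW.
have th0 j : 0 < th j by rewrite sqrtr_gt0 divr_gt0 ?mulr_gt0.
have th_le j : th j <= tau.
  rewrite -ler_sqr ?nnegrE ?(ltW tau0) ?(ltW (th0 j))// th2 ler_pdivrMr ?mulr_gt0//.
  have h1 : L j <= e * (t j.+1)%:R.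
    by apply: hM1; apply: leq_trans (tj j.+1); apply: leq_trans (leq_maxl _ _) (leq_addl _ _).
  have h2 : tau ^+ 2 * rho * ((t j.+1)%:R / 4) <= tau ^+ 2 * rho * (l j)%:R.
    by rewrite ler_wpM2l// mulr_ge0 ?sqr_ge0 ?(ltW rho0).
  by move: h1 h2; rewrite /e; lra.
have thL j : (l j)%:R * rho * th j ^+ 2 / 2 = L j.
  by rewrite th2; field; rewrite !gt_eqF.
pose B j := [set x : Sig m | c * (rho * (l j)%:R * th j) <= F (l j) x].
have PB j : kap / ln Q%:R / (j + J).+1%:R <= P (B j).
  have := htail (l j) (th j); rewrite th0 th_le thL => /(_ isT) h.
  have {h} := h (le_trans _ (L_ge j)); rewrite le_max lexx => /(_ isT).
  apply: le_trans.
  by rewrite LE opprD expRD !expRN !lnK ?posrE// -mulrA [X in kap * X]mulrC.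
have div (S : R) : exists J', S <= \sum_(j < J') P (B j).
  pose k2 := kap / ln Q%:R / J.+1%:R.
  have k20 : 0 < k2 by rewrite !divr_gt0.
  have [N hN] := nat_ge (expR (S / k2)); exists N.
  apply: (@le_trans _ _ (\sum_(j < N) k2 * (j.+1%:R)^-1)); last first.
    apply: ler_sum => j _; apply: le_trans (PB j); rewrite /k2 -!mulrA.
    rewrite ler_wpM2l ?(ltW kap0)// ler_wpM2l ?invr_ge0 ?(ltW Q0)// -invfM -natrM lef_pV2 ?posrE ?ltr0n//.
    by rewrite ler_nat succ_add_le_mul.
  rewrite -mulr_sumr -ler_pdivrMl// mulrC; apply: le_trans (sumn_ln_ge R N).
  by rewrite -[leLHS]expRK ler_ln ?posrE ?expR_gt0// hN.
have cB j : cylset (l j) (B j) by exact: (cylset_ge aa).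
have htl j : (t j + l j <= t j.+1)%N by rewrite tl.
have h1 := borel_cantelli_diverging gib cB htl div.
(* The crude level 2 for [- F] suffices, since [A (t j)] is at most [A (t j.+1) / s]. *)
have h2 := lil_upper gib almost_additiveN ltr01.
have [M3 hM3] := lil_scale_ge aa (4 * K / d).
apply: (ae_and_impl h1 h2) => x hx [N1 hN1] N.
have [j [hj Bj]] := hx (maxn (maxn N1 N) M3).
exists (t j.+1).
have jt : (j <= t j)%N by apply: leq_trans (tj j); exact: leq_addr.
have jt1 : (j <= t j.+1)%N by exact: leq_trans jt (t_le j).
have [hj1 hj2 hj3] : [/\ (N1 <= j)%N, (N <= j)%N & (M3 <= j)%N].
  by move: hj; rewrite !geq_max => /andP[/andP[-> ->] ->].
split; first exact: leq_trans hj2 jt1.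
set a := A (t j.+1).
have a_ge : 4 * K / d <= a by apply: hM3; exact: leq_trans jt1.
have a0 : 0 <= a by exact: sqrtr_ge0.
have aE : a = Num.sqrt (2 * rho * L j) * Num.sqrt (t j.+1)%:R.
  by rewrite -sqrtrM ?mulr_ge0 ?(ltW rho0) ?(ltW (L0 j))//; congr Num.sqrt; rewrite -/(L j); ring.
have Bj' : c * (1 - s%:R^-1) * a <= F (l j) (iter (t j) (@shift m) x).
  apply: le_trans Bj; rewrite -mulrA ler_wpM2l ?(ltW c0)//.
  have s1 : 0 <= 1 - s%:R^-1 :> R by lra.
  rewrite -ler_sqr ?nnegrE ?mulr_ge0 ?(ltW rho0) ?(ltW (th0 j))//.
  have -> : (rho * (l j)%:R * th j) ^+ 2 = 2 * rho * L j * (l j)%:R.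
    by rewrite exprMn th2; field; rewrite !gt_eqF.
  rewrite exprMn aE exprMn !sqr_sqrtr ?mulr_ge0 ?(ltW rho0) ?(ltW (L0 j))//.
  rewrite mulrCA ler_wpM2l ?mulr_ge0 ?(ltW rho0) ?(ltW (L0 j))//.
  by rewrite mulrC.
have up : - F (t j) x < 2 * A (t j).
  by have := hN1 (t j) (leq_trans hj1 jt); rewrite (_ : 1 + 1 = 2)//; ring.
have At : A (t j) <= a / s%:R.
  have -> : a = s%:R * Num.sqrt (2 * rho * (t j)%:R * L j).
    rewrite -[s%:R](ger0_norm (ltW s0)) -sqrtr_sqr -sqrtrM ?sqr_ge0// /a /lil_scale.
    by congr Num.sqrt; rewrite -/(L j) tS /Q natrM natrX; ring.
  rewrite mulrAC divff ?gt_eqF// mul1r ler_wsqrtr// ler_wpM2l ?mulr_ge0 ?(ltW rho0)//.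
  have [t2|t2] := leqP 2 (t j); first exact: lnln_le.
  have t1 : t j = 1%N by apply/eqP; rewrite eqn_leq -ltnS t2 t_gt0.
  by rewrite t1 /lnln ln1 ln0// ltW.
have add := aa_add aa (t j) (l j) x; rewrite tl ler_norml in add; case/andP: add => add _.
have Kd : K <= d / 4 * a.
  by move: a_ge; rewrite ler_pdivrMr//; lra.
have sd : s%:R^-1 <= d / 6.
  by rewrite -[d / 6]invrK invf_div lef_pV2 ?posrE// divr_gt0.
have sa : a / s%:R <= d / 6 * a by rewrite mulrC ler_wpM2r.
have h3 : c * (1 - s%:R^-1) * a >= (1 - d / 4 - d / 6) * a.
  rewrite ler_wpM2r// /c; have : 0 < s%:R^-1 :> R by rewrite invr_gt0.
  by nra.
by lra.
Qed.

End lower_lil_theorem.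

(** * The coding map *)

Section euclidean_norm.
Variables (R : realType) (d : nat).
Implicit Types x y : 'rV[R]_d.

Lemma enorm_ge0 x : 0 <= enorm x.
Proof. exact: sqrtr_ge0. Qed.

Lemma coord_le_enorm x j : `|x ord0 j| <= enorm x.
Proof.
rewrite /enorm -sqrtr_sqr ler_wsqrtr// (bigD1 j)//= lerDl.
by apply: sumr_ge0 => k _; exact: sqr_ge0.
Qed.

Lemma coord_le_norm x j : `|x ord0 j| <= `|x|.
Proof.
rewrite -[`|x|]/(mx_norm x) mx_normrE; exact: (le_bigmax_cond 0 (fun i : 'I_1 * 'I_d => `|x i.1 i.2|) (isT : xpredT (ord0, j))).
Qed.

Lemma norm_le_coord x c : 0 <= c -> (forall j, `|x ord0 j| <= c) -> `|x| <= c.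
Proof.
move=> c0 h; rewrite -[`|x|]/(mx_norm x) mx_normrE; apply: bigmax_le => // -[i j] _ /=.
by rewrite (ord1 i).
Qed.

Lemma norm_le_enorm x : `|x| <= enorm x.
Proof. by apply: norm_le_coord; [exact: enorm_ge0|move=> j; exact: coord_le_enorm]. Qed.

Lemma enorm_le_norm x : enorm x <= Num.sqrt d%:R * `|x|.
Proof.
rewrite /enorm -[X in _ * X](ger0_norm (normr_ge0 x)) -sqrtr_sqr -sqrtrM// ler_wsqrtr//.
apply: (@le_trans _ _ (\sum_(j < d) `|x| ^+ 2)); last by rewrite sumr_const card_ord mulr_natl.
apply: ler_sum => j _; rewrite -[leLHS]real_normK ?num_real// lerXn2r ?nnegrE//.
exact: coord_le_norm.
Qed.

End euclidean_norm.

Lemma geometric_cauchy (R : realType) (v : nat -> R) (M r : R) : 0 < r < 1 ->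
  (forall n, `|v n.+1 - v n| <= M * r ^+ n) ->
  exists l, forall n, `|v n - l| <= M / (1 - r) * r ^+ n.
Proof.
move=> /andP[r0 r1] h; have M0 : 0 <= M.
  by have := h 0%N; rewrite expr0 mulr1; exact: le_trans.
have c : cvgn (series (telescope v)).
  apply: normed_cvg; apply: (@series_le_cvg _ _ (fun n => M * r ^+ n)).
  - by move=> n /=.
  - by move=> n /=; apply: mulr_ge0 => //; exact/exprn_ge0/ltW.
  - by move=> n /=; exact: h.
  - by apply: is_cvg_geometric_series; rewrite gtr0_norm.
pose l := limn (series (telescope v)) + v 0%N.
have vl : v @ \oo --> l.
  have -> : v = (fun n => series (telescope v) n + v 0%N).
    by apply/funext => n; rewrite addrC -eq_sum_telescope.
  by apply: cvgD => //; exact: cvg_cst.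
exists l => n; have tail k : `|v (n + k)%N - v n| <= M / (1 - r) * r ^+ n.
  apply: (@le_trans _ _ (\sum_(i < k) M * r ^+ (n + i))).
    elim: k => [|k IH]; first by rewrite addn0 subrr normr0 big_ord0.
    rewrite big_ord_recr /= addnS; apply: le_trans (ler_distD (v (n + k)%N) _ _) _.
    by rewrite addrC lerD.
  under eq_bigr do rewrite exprD.
  rewrite -!mulr_sumr [leRHS]mulrAC -!mulrA ler_wpM2l// ler_wpM2l ?exprn_ge0 ?(ltW r0)//.
  by apply: geometric_sum_le; rewrite (ltW r0).
have hc : (fun k => `|v n - v (k + n)%N|) @ \oo --> `|v n - l|.
  apply: cvg_norm; apply: cvgB; first exact: cvg_cst.
  by move: vl; rewrite -(cvg_shiftn n).
by apply: (cvgr_to_le hc); apply: nearW => k; rewrite distrC addnC.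
Qed.

Lemma geometric_cvg (R : realType) (V : normedModType R) (u : nat -> V) (l : V) (M r : R) :
  0 < r < 1 -> 0 <= M -> (forall n, `|u n - l| <= M * r ^+ n) -> u @ \oo --> l.
Proof.
move=> r01 M0 h; apply/cvgrPdist_le => e e0; have M1 : 0 < M + 1 by rewrite ltr_wpDl.
have [N hN] := expr_small r01 (divr_gt0 e0 M1); exists N => // n /= Nn; rewrite distrC.
apply: le_trans (h n) _; have := hN n Nn; rewrite ler_pdivlMr// => /(le_trans _); apply.
by rewrite mulrC ler_wpM2l ?lerDl// exprn_ge0//; case/andP: r01 => /ltW.
Qed.

Lemma eq0_geometric_bound (R : realType) (V : normedModType R) (z : V) (M r : R) : 0 < r < 1 ->
  (forall n, `|z| <= M * r ^+ n) -> z = 0.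
Proof.
move=> r01 h; have M0 : 0 <= M by have := h 0%N; rewrite expr0 mulr1; exact: le_trans.
have c : (fun=> z) @ \oo --> (0 : V) by apply: (geometric_cvg r01 M0) => n; rewrite subr0.
by apply: (cvg_unique _ _ c); [exact: norm_hausdorff|exact: cvg_cst].
Qed.

(** * Distances between coded points and common prefixes *)

Section coding_map.
Variables (R : realType) (d m : nat) (phi : 'I_m.+1 -> 'rV[R]_d -> 'rV[R]_d) (r : R).
Variable X : set 'rV[R]_d.
Hypothesis hom : homogeneous_IFS phi r.
Hypothesis self : self_similar_set phi X.
Hypothesis ssc : SSC phi X.
Implicit Types i : Sig m.

Let r01 : 0 < r < 1. Proof. by case: hom. Qed.
Let r0 : 0 < r. Proof. by case/andP: r01. Qed.
Let r1 : r < 1. Proof. by case/andP: r01. Qed.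
Let sim a x y : enorm (phi a x - phi a y) = r * enorm (x - y).
Proof. by case: hom => _ /(_ a x y). Qed.
Let X0 : X !=set0. Proof. by case: self. Qed.
Let cX : compact X. Proof. by case: self => _ []. Qed.
Let XE : X = \bigcup_(i in [set: 'I_m.+1]) (phi i @` X). Proof. by case: self => _ []. Qed.
Let phiX a x : X x -> X (phi a x).
Proof. by move=> Xx; rewrite XE; exists a => //; exists x. Qed.

Lemma compn_sim n i x y : enorm (compn phi n i x - compn phi n i y) = r ^+ n * enorm (x - y).
Proof. by elim: n i => [|n IH] i /=; rewrite ?mul1r// sim IH exprS mulrA. Qed.

Lemma compnSr n i x : compn phi n.+1 i x = compn phi n i (phi (i n) x).
Proof. by elim: n i => [//|n IH] i; rewrite -[LHS]/(phi (i 0%N) (compn phi n.+1 (shift i) x)) IH. Qed.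

Lemma compn_X n i x : X x -> X (compn phi n i x).
Proof. by move=> Xx; elim: n i => [//|n IH] i /=; exact/phiX/IH. Qed.

(** Consecutive approximations differ by [r ^+ n] times the norm of some [phi a 0]; working by
    coordinates reduces completeness to the real line, and the rate is uniform in [i]. *)
Lemma cvg_compn : exists c : R, 0 <= c /\ forall i n, `|compn phi n i 0 - coding phi i| <= c * r ^+ n.
Proof.
pose M := \sum_(a < m.+1) enorm (phi a 0).
have M0 : 0 <= M by apply: sumr_ge0 => a _; exact: enorm_ge0.
have Ma a : enorm (phi a 0) <= M.
  by rewrite /M (bigD1 a)//= lerDl; apply: sumr_ge0 => b _; exact: enorm_ge0.
have c0 : 0 <= M / (1 - r) by rewrite divr_ge0// subr_ge0 ltW.
exists (M / (1 - r)); split => // i.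
have step n (j : 'I_d) : `|(compn phi n.+1 i 0) ord0 j - (compn phi n i 0) ord0 j| <= M * r ^+ n.
  have := coord_le_enorm (compn phi n.+1 i 0 - compn phi n i 0) j; rewrite !mxE => /le_trans; apply.
  by rewrite compnSr compn_sim subr0 mulrC ler_wpM2r// exprn_ge0// ltW.
have ex (j : 'I_d) : exists lj : R, forall n,
    `|(compn phi n i 0) ord0 j - lj| <= M / (1 - r) * r ^+ n.
  apply: (geometric_cauchy (v := fun n => (compn phi n i 0) ord0 j) r01) => n.
  by have := step n j; rewrite /=.
have [l hl] := choice ex.
pose L : 'rV[R]_d := \row_j l j.
have hL n : `|compn phi n i 0 - L| <= M / (1 - r) * r ^+ n.
  apply: norm_le_coord; first by rewrite mulr_ge0// exprn_ge0// ltW.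
  by move=> j; rewrite !mxE; exact: hl.
suff -> : coding phi i = L by [].
apply/cvg_lim; first exact: norm_hausdorff.
exact: geometric_cvg r01 c0 hL.
Qed.

Lemma coding_shift i : coding phi i = phi (i 0%N) (coding phi (shift i)).
Proof.
have [c [c0 hc]] := cvg_compn; apply/eqP; rewrite -subr_eq0; apply/eqP.
apply: (@eq0_geometric_bound _ _ _ (c + Num.sqrt d%:R * c)) r01 _ => n.
apply: le_trans (ler_distD (compn phi n.+1 i 0) _ _) _; rewrite mulrDl; apply: lerD.
  rewrite distrC; apply: le_trans (hc i n.+1) _; rewrite ler_wpM2l// exprS.
  by rewrite ler_piMl ?exprn_ge0// ltW.
apply: le_trans (norm_le_enorm _) _; rewrite /= sim.
apply: (@le_trans _ _ (1 * enorm (compn phi n (shift i) 0 - coding phi (shift i)))).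
  by rewrite ler_wpM2r ?enorm_ge0// ltW.
rewrite mul1r; apply: le_trans (enorm_le_norm _) _.
by rewrite -mulrA ler_wpM2l ?sqrtr_ge0.
Qed.

Lemma coding_in i : X (coding phi i).
Proof.
have [x0 Xx0] := X0; have [c [c0 hc]] := cvg_compn.
have clX : closed X by apply: compact_closed => //; exact: norm_hausdorff.
have hy n : `|compn phi n i x0 - coding phi i| <= (enorm x0 + c) * r ^+ n.
  apply: le_trans (ler_distD (compn phi n i 0) _ _) _; rewrite mulrDl; apply: lerD => //.
  by apply: le_trans (norm_le_enorm _) _; rewrite compn_sim subr0 mulrC.
apply: (@closed_cvg _ _ \oo _ (fun n => compn phi n i x0) X clX).
  by apply: nearW => n; exact: compn_X.
by apply: geometric_cvg r01 _ hy; rewrite addr_ge0// enorm_ge0.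
Qed.

Lemma coding_agree i j k : agree i j k -> enorm (coding phi i - coding phi j) =
  r ^+ k * enorm (coding phi (iter k (@shift m) i) - coding phi (iter k (@shift m) j)).
Proof.
elim: k i j => [|k IH] i j ij; first by rewrite expr0 mul1r.
rewrite coding_shift [coding phi j]coding_shift (ij 0%N isT) sim (IH _ _ (agree_shift ij)).
by rewrite exprS mulrA !iterSr.
Qed.

Lemma coding_dist_le : exists D : R, 0 < D /\ forall i j k, agree i j k ->
  enorm (coding phi i - coding phi j) <= D * r ^+ k.
Proof.
have [M [_ hM]] := compact_bounded cX.
have hM1 x : X x -> `|x| <= `|M| + 1.
  by move=> Xx; apply: (hM (`|M| + 1)) => //; apply: le_lt_trans (ler_norm _) _; rewrite ltrDl.
pose D := Num.sqrt d%:R * (2 * (`|M| + 1)) + 1.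
have D0 : 0 < D by rewrite ltr_wpDl// mulr_ge0 ?sqrtr_ge0// mulr_ge0// addr_ge0.
exists D; split => // i j k ij; rewrite (coding_agree ij) mulrC.
rewrite ler_wpM2r ?exprn_ge0 ?(ltW r0)//; apply: le_trans (enorm_le_norm _) _.
rewrite /D; apply: (@le_trans _ _ (Num.sqrt d%:R * (2 * (`|M| + 1)))); last by rewrite lerDl.
rewrite ler_wpM2l ?sqrtr_ge0//; apply: le_trans (ler_normB _ _) _.
have := hM1 _ (coding_in (iter k (@shift m) i)); have := hM1 _ (coding_in (iter k (@shift m) j)); lra.
Qed.

Let continuous_phi a : continuous (phi a).
Proof.
move=> x; apply/(@cvgrPdist_le _ _ _ (nbhs x) (nbhs_filter x)) => e e0.
pose s : R := Num.sqrt d%:R + 1; have s0 : 0 < s by rewrite ltr_wpDl ?sqrtr_ge0.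
have hn : nbhs x [set y | `|x - y| <= s^-1 * e].
  have /(@cvgrPdist_le _ _ _ (nbhs x) (nbhs_filter x)) : (id : 'rV[R]_d -> _) @ x --> x by exact: cvg_id.
  by apply; rewrite mulr_gt0// invr_gt0.
move: hn; apply: (@filterS _ _ (nbhs_filter x)) => y /=; rewrite ler_pdivlMl// => hy.
apply: le_trans (norm_le_enorm _) _; rewrite sim; apply: le_trans hy.
apply: (@le_trans _ _ (1 * enorm (x - y))); first by rewrite ler_wpM2r ?enorm_ge0// ltW.
by rewrite mul1r; apply: le_trans (enorm_le_norm _) _; rewrite ler_wpM2r// lerDl.
Qed.

(** The distance attains its minimum on the product of the two compact pieces, and strong separation
    makes it positive. *)
Lemma pieces_separated (p : 'I_m.+1 * 'I_m.+1) : p.1 != p.2 ->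
  exists e : R, 0 < e /\ forall x y, X x -> X y -> e <= enorm (phi p.1 x - phi p.2 y).
Proof.
move=> ab; pose A := (phi p.1 @` X) `*` (phi p.2 @` X).
have cphi a : compact (phi a @` X).
  by apply: continuous_compact => //; apply: continuous_subspaceT; exact: continuous_phi.
have cA : compact A by exact: compact_setX.
have [x0 Xx0] := X0.
have A0 : A !=set0 by exists (phi p.1 x0, phi p.2 x0); split => /=; exists x0.
pose f (z : 'rV[R]_d * 'rV[R]_d) : R := `|z.1 - z.2|.
have cf : continuous f.
  move=> z; apply: cvg_norm; apply: cvgB; [exact: cvg_fst|exact: cvg_snd].
have [z /set_mem [z1 z2] hz] := compact_EVT_min A0 cA (continuous_subspaceT cf).
exists (f z); split.
  rewrite normr_gt0 subr_eq0; apply/eqP => z12.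
  have : (phi p.1 @` X `&` phi p.2 @` X) z.1 by split => //; rewrite z12.
  by rewrite (ssc ab).
move=> x y Xx Xy; apply: le_trans (norm_le_enorm _); apply: (hz (phi p.1 x, phi p.2 y)).
by apply/mem_set; split => /=; [exists x|exists y].
Qed.

(** If [l < k] is the first disagreement, the distance is [r ^+ l] times that of two points in
    different pieces, hence at least [e * r ^+ k]. *)
Lemma coding_dist_ge : exists e : R, 0 < e /\ forall i j k,
  enorm (coding phi i - coding phi j) < e * r ^+ k -> agree i j k.
Proof.
have [e [e0 he]] : exists e : R, 0 < e /\ forall (p : 'I_m.+1 * 'I_m.+1), p.1 != p.2 ->
    forall x y, X x -> X y -> e <= enorm (phi p.1 x - phi p.2 y).
  suff : forall s : seq ('I_m.+1 * 'I_m.+1), exists e : R, 0 < e /\ forall p, p \in s -> p.1 != p.2 ->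
      forall x y, X x -> X y -> e <= enorm (phi p.1 x - phi p.2 y).
    move=> /(_ (enum {: 'I_m.+1 * 'I_m.+1})) [e [e0 he]]; exists e; split => // p; apply: he.
    by rewrite mem_enum.
  elim=> [|p s [e [e0 he]]]; first by exists 1.
  have [pp|pp] := eqVneq p.1 p.2.
    exists e; split => // q; rewrite inE => /orP[/eqP ->|/he//].
    by rewrite pp eqxx.
  have [e' [e'0 he']] := pieces_separated pp.
  exists (Num.min e e'); split; first by rewrite lt_min e0 e'0.
  move=> q; rewrite inE => /orP[/eqP ->|/he h] q12 x y Xx Xy; rewrite ge_min; apply/orP.
    by right; exact: he'.
  by left; exact: h.
exists e; split => // i j k hk l lk.
elim/ltn_ind: l lk => l IH lk; apply/eqP; apply: contraT => ij.
have ag : agree i j l by move=> l' l'l; apply: IH => //; exact: ltn_trans lk.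
move: hk; rewrite (coding_agree ag) ltNge => /negP; case.
rewrite mulrC; apply: ler_pM; rewrite ?exprn_ge0 ?(ltW r0) ?(ltW e0)//.
  by rewrite ler_wiXn2l ?(ltW r0) ?(ltW r1)// ltnW.
rewrite coding_shift [coding phi (iter l _ j)]coding_shift !iter_shiftE add0n.
by apply: (he (i l, j l)) => //; exact: coding_in.
Qed.

(** Whatever preimage in [X] the choice operator returns, separation forces its branch to be [i 0]
    and similarities with [r > 0] are injective. *)
Lemma Tmap_coding i : Tmap phi X (coding phi i) = coding phi (shift i).
Proof.
rewrite /Tmap; set S := [set y | _].
have Si : S (coding phi (shift i)).
  by split; [exact: coding_in|exists (i 0%N); rewrite -coding_shift].
have [Xy [a ha]] := xgetPex (coding phi i) (ex_intro _ _ Si : exists y, S y).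
set y := xget _ _ in Xy ha *.
have ai : a = i 0%N.
  apply/eqP; apply: contraT => ai.
  have : (phi a @` X `&` phi (i 0%N) @` X) (coding phi i).
    split; first by exists y.
    by exists (coding phi (shift i)); [exact: coding_in|rewrite -coding_shift].
  by rewrite (ssc ai).
have : enorm (phi a y - phi a (coding phi (shift i))) = 0.
  rewrite ha ai -coding_shift subrr /enorm big1 ?sqrtr0// => j _.
  by rewrite mxE expr0n.
rewrite sim => /eqP; rewrite mulf_eq0 gt_eqF//= => /eqP h.
apply/eqP; rewrite -subr_eq0 -normr_le0; apply: le_trans (norm_le_enorm _) _.
by rewrite h.
Qed.

Lemma iter_Tmap_coding n i : iter n (Tmap phi X) (coding phi i) = coding phi (iter n (@shift m) i).
Proof. by elim: n => //= n ->; rewrite Tmap_coding. Qed.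

Lemma Rtilde_coding (psi : nat -> R) i : Rtilde phi X r psi (coding phi i) <->
  forall N, exists n, (N <= n)%N /\
    enorm (coding phi (iter n (@shift m) i) - coding phi i) <= r `^ psi n.
Proof.
split=> [[_ h] N|h]; first by have [n] := h N; rewrite iter_Tmap_coding; exists n.
split=> [|N]; first exact: coding_in.
by have [n] := h N; rewrite -iter_Tmap_coding; exists n.
Qed.

Lemma measurable_recurrence (psi : nat -> R) :
  measurable (coding phi @^-1` Rtilde phi X r psi : set (SigMeas m)).
Proof.
pose g n (i : SigMeas m) := enorm (coding phi (iter n (@shift m) i) - coding phi i).
have mg n : measurable_fun setT (g n).
  have mc n' (j : 'I_d) : measurable_fun setT (fun i : SigMeas m => coding phi (iter n' (@shift m) i) ord0 j).
    apply: measurable_continuous_Sig => i e e0; have [D [D0 hD]] := coding_dist_le.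
    have [k hk] := expr_small r01 (divr_gt0 e0 (addr_gt0 D0 (@ltr01 R))).
    exists (n' + k)%N => i' /(agree_iter_shift) /hD h.
    have := coord_le_enorm (coding phi (iter n' (@shift m) i) - coding phi (iter n' (@shift m) i')) j.
    rewrite !mxE => /le_lt_trans; apply; apply: (le_lt_trans h).
    have := hk k (leqnn _); rewrite ler_pdivlMr ?addr_gt0//; apply: lt_le_trans.
    by rewrite mulrC ltr_pM2l ?exprn_gt0// ltrDl.
  apply: (@measurableT_comp _ _ _ _ _ _ (@Num.sqrt R)).
    by apply: continuous_measurable_fun; exact: sqrt_continuous.
  apply: measurable_sum => j; under eq_fun do rewrite !mxE.
  apply: measurable_funX; apply: measurable_funB; first exact: mc.
  exact: (mc 0%N).
have -> : coding phi @^-1` Rtilde phi X r psi =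
    \bigcap_N \bigcup_(n in [set n | (N <= n)%N]) [set i | g n i <= r `^ psi n].
  apply/seteqP; split => i.
    by move=> /Rtilde_coding h N _; have [n [Nn hn]] := h N; exists n.
  by move=> h; apply/Rtilde_coding => N; have [n Nn hn] := h N I; exists n.
apply: bigcap_measurable => // N _; apply: bigcup_measurable => n _.
rewrite (_ : [set i | _] = g n @^-1` `]-oo, r `^ psi n]); last first.
  by apply/seteqP; split => i /=; rewrite in_itv.
by rewrite -[X in measurable X]setTI; exact: mg.
Qed.

End coding_map.

(** * Rates of recurrence *)

Section eventual_comparisons.
Variable R : realType.

Lemma mul_ln_le_sqrt (M : R) : exists x0 : R, 1 <= x0 /\ forall x, x0 <= x -> M * ln x <= Num.sqrt x.
Proof.
pose q : R := 4 * `|M| + 1; have q1 : 1 <= q by rewrite lerDr mulr_ge0.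
have q0 : 0 < q by exact: lt_le_trans q1.
exists (q ^+ 4); split; first by rewrite exprn_ege1.
move=> x hx; have x1 : 1 <= x by apply: le_trans hx; rewrite exprn_ege1.
have x0 : 0 < x by exact: lt_le_trans x1.
have z0 : 0 < Num.sqrt x by rewrite sqrtr_gt0.
have hz : q <= Num.sqrt (Num.sqrt x).
  have -> : q = Num.sqrt (Num.sqrt (q ^+ 4)).
    by rewrite -[4%N]/(2 * 2)%N exprM sqrtr_sqr ger0_norm ?sqr_ge0// sqrtr_sqr gtr0_norm.
  by rewrite !ler_wsqrtr.
apply: (@le_trans _ _ (`|M| * ln x)); first by rewrite ler_wpM2r ?ln_ge0// ler_norm.
have -> : ln x = ln (Num.sqrt x) *+ 2 by rewrite -lnXn// sqr_sqrtr// ltW.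
have := ln_le_sqrt z0; rewrite mulr2n => h.
apply: (@le_trans _ _ (`|M| * (4 * Num.sqrt (Num.sqrt x)))).
  by rewrite ler_wpM2l//; lra.
rewrite -[leRHS](sqr_sqrtr (ltW z0)) expr2 mulrA ler_wpM2r ?sqrtr_ge0//.
by apply: le_trans hz; rewrite /q mulrC; lra.
Qed.

(** For large [x] one has [ln y <= 2 * ln x], and [ln 2] is at most [d * ln (ln x)]. It lets
    iterated logarithms be evaluated at [k] or at [ln n] interchangeably. *)
Lemma lnln_le_scale (c d : R) : 0 < c -> 0 < d -> exists x0 : R, 1 <= x0 /\
  forall x y, x0 <= x -> y <= c * x -> ln (ln y) <= (1 + d) * ln (ln x).
Proof.
move=> c0 d0; pose x0 := expR (expR (ln 2 / d)) + c + 1.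
have e0 : 0 < expR (expR (ln 2 / d)) by exact: expR_gt0.
exists x0; split; first by rewrite /x0; lra.
move=> x y hx yc; have xp : 0 < x by move: hx; rewrite /x0; lra.
have cx : c <= x by move: hx; rewrite /x0; lra.
have ex : expR (expR (ln 2 / d)) <= x by move: hx; rewrite /x0; lra.
have lx : expR (ln 2 / d) <= ln x by rewrite -[leLHS]expRK ler_ln ?posrE.
have lx0 : 0 < ln x by apply: lt_le_trans lx; exact: expR_gt0.
have llx : ln 2 / d <= ln (ln x) by rewrite -[leLHS]expRK ler_ln ?posrE ?expR_gt0.
have l2 : 0 <= ln 2 :> R by rewrite ln_ge0// ler1n.
have llx0 : 0 <= ln (ln x) by apply: le_trans llx; rewrite divr_ge0// ltW.
have [ly|ly] := leP (ln y) 0.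
  by rewrite (ln0 ly) mulr_ge0//; lra.
have y0 : 0 < y by rewrite ltNge; apply/negP => /ln0 y0; move: ly; rewrite y0 ltxx.
have : ln y <= 2 * ln x.
  have : ln y <= ln (c * x) by rewrite ler_ln ?posrE ?mulr_gt0.
  rewrite lnM ?posrE//; have : ln c <= ln x by rewrite ler_ln ?posrE.
  lra.
rewrite -ler_ln ?posrE ?mulr_gt0// lnM ?posrE// => h.
move: llx; rewrite ler_pdivrMr//; lra.
Qed.

Lemma sqrt_lnln_le (a d : R) : 0 < a -> 0 < d -> exists x0 : R, 1 <= x0 /\
  forall x, x0 <= x -> Num.sqrt (a * x * ln (ln x)) <= d * x.
Proof.
move=> a0 d0; have [x0 [x1 h]] := mul_ln_le_sqrt (a / d ^+ 2).
exists x0; split => // x xx; have x1' : 1 <= x by exact: le_trans xx.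
have xp : 0 < x by exact: lt_le_trans x1'.
have dx : 0 < d * x by rewrite mulr_gt0.
rewrite -[leRHS](gtr0_norm dx) -sqrtr_sqr ler_wsqrtr//.
have d2 : 0 < d ^+ 2 by rewrite exprn_gt0.
have : a / d ^+ 2 * ln x <= x.
  apply: le_trans (h x xx) _; rewrite -[leRHS](sqr_sqrtr (ltW xp)) expr2 ler_peMl ?sqrtr_ge0//.
  by rewrite -[leLHS]sqrtr1 ler_wsqrtr.
rewrite mulrAC ler_pdivrMr// => h2.
rewrite mulrAC exprMn [x ^+ 2]expr2 mulrA ler_pM2r//.
apply: (@le_trans _ _ (a * ln x)); last by rewrite [leRHS]mulrC.
by rewrite ler_pM2l//; apply: ln_le_id; exact: ln_ge0.
Qed.

Lemma mul_ln_le_sqrt_lnln (a M : R) : 0 < a -> exists x0 : R, 1 <= x0 /\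
  forall x, x0 <= x -> M * ln x <= Num.sqrt (a * x * ln (ln x)).
Proof.
move=> a0; have [x0 [x1 h]] := mul_ln_le_sqrt M.
pose y0 := expR (expR a^-1).
have y00 : 0 < y0 by exact: expR_gt0.
exists (x0 + y0); split; first by lra.
move=> x hx; have xx : x0 <= x by lra.
have xp : 0 < x by lra.
have yx : y0 <= x by lra.
have lx : expR a^-1 <= ln x by rewrite -[leLHS]expRK ler_ln ?posrE.
have lx0 : 0 < ln x by apply: lt_le_trans lx; exact: expR_gt0.
have llx : a^-1 <= ln (ln x) by rewrite -[leLHS]expRK ler_ln ?posrE ?expR_gt0.
apply: le_trans (h x xx) _; rewrite ler_wsqrtr// mulrAC ler_peMl ?(ltW xp)//.
by rewrite -ler_pdivrMl// mulr1.
Qed.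

Lemma nat_ln_ge (x : R) : exists N, forall n, (N <= n)%N -> x <= ln (n%:R : R).
Proof.
have [N hN] := nat_ge (expR x); exists N => n /hN h.
by rewrite -[leLHS]expRK ler_ln ?posrE ?expR_gt0// (lt_le_trans _ h) ?expR_gt0.
Qed.

(** Telescoping with reciprocals of logarithms, whose consecutive gaps dominate the terms by
    [invS_le_ln]. *)
Lemma bertrand_series_le N n : (2 <= N)%N ->
  \sum_(k < n) ((N + k).+1%:R * ln ((N + k).+1%:R : R) ^+ 2)^-1 <= (ln (N%:R : R))^-1.
Proof.
move=> N2; pose v (k : nat) : R := (ln (N + k)%N%:R)^-1.
have lp k : 0 < ln ((N + k)%N%:R : R) by rewrite ln_gt0// ltr1n (leq_trans N2)// leq_addr.
suff h : \sum_(k < n) ((N + k).+1%:R * ln ((N + k).+1%:R : R) ^+ 2)^-1 <= v 0%N - v n.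
  apply: le_trans h _; rewrite /v addn0 gerBl invr_ge0; exact/ltW/lp.
elim: n => [|n IH]; first by rewrite big_ord0 subrr.
rewrite big_ord_recr /=; apply: (@le_trans _ _ (v 0%N - v n + (v n - v n.+1))); last by lra.
rewrite lerD// /v addnS; have x0 := lp n; have y0 := lp n.+1; rewrite addnS in y0.
have hyx : ln ((N + n)%N%:R : R) <= ln (N + n).+1%:R.
  by rewrite ler_ln ?posrE ?ler_nat// ltr0n addn_gt0 (leq_trans _ N2).
have Nn : (0 < N + n)%N by rewrite addn_gt0 (leq_trans _ N2).
have := @invS_le_ln R _ Nn.
set x := ln (N + n)%N%:R in x0 hyx *; set y := ln (N + n).+1%:R in y0 hyx * => h.
have -> : x^-1 - y^-1 = (y - x) / (x * y) by field; rewrite !gt_eqF.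
rewrite invfM; apply: ler_pM; [by rewrite invr_ge0 ltW|by rewrite invr_ge0 sqr_ge0|exact: h|].
by rewrite lef_pV2 ?posrE ?exprn_gt0 ?mulr_gt0// expr2 ler_pM2r.
Qed.

End eventual_comparisons.

(** * The rate as a balance between entropy and fluctuation *)

Section recurrence_rate.
Variables (R : realType) (h rho : R).
Hypotheses (h0 : 0 < h) (rho0 : 0 < rho).
Local Notation L n := (ln (n%:R : R)).
Local Notation g n := (Num.sqrt (2 * (rho / h) * L n * ln (ln (L n)))).
Local Notation A := (lil_scale rho).

Lemma LogE (x : R) : 1 < x -> Log x = ln x.
Proof. by rewrite /Log leNgt => ->. Qed.

(** Past the truncations in [Log], one factor [sqrt h] of the power 3/2 moves under the root. What
    remains, [g n], is the scale [A] at [k = L n / h] up to replacing [ln ln k] by [ln ln (L n)]. *)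
Lemma psiE s n : 1 < ln (L n) -> psi h rho s n = (L n + s * g n) / h.
Proof.
move=> l1; have L1 : 1 < L n.
  by rewrite ltNge; apply/negP => /ln_le0 /(lt_le_trans l1); rewrite ltNge ler01.
have n1 : 1 < n%:R :> R.
  by rewrite ltNge; apply/negP => /ln_le0 /(lt_le_trans L1); rewrite ltNge ler01.
rewrite /psi (LogE n1) (LogE L1) (LogE l1).
have -> : h `^ (3 / 2) = h * Num.sqrt h.
  have -> : 3 / 2 = 1 + 2^-1 :> R by lra.
  by rewrite powRD ?powRr1 ?powR12_sqrt// ?(ltW h0)// gt_eqF// implybT.
have -> : Num.sqrt (2 * rho * L n * ln (ln (L n))) = Num.sqrt h * g n.
  by rewrite -sqrtrM ?(ltW h0)//; congr Num.sqrt; field; rewrite gt_eqF.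
have q0 : Num.sqrt h != 0 by rewrite gt_eqF// sqrtr_gt0.
by field; rewrite q0 gt_eqF.
Qed.

(** Here [k * h] is at least [L n + (1 + eps) * g n] minus a constant, while [(1 + eps / 2) * A k]
    is at most [(1 + 3 * eps / 4) * g n]; the remaining [eps / 4 * g n] exceeds [2 * ln (L n)] and
    the rounding cost, which yields the terms of a convergent Bertrand series. *)
Lemma upper_rate eps c0 (M : R) : 0 < eps -> 0 <= c0 -> exists N, forall n, (N <= n)%N ->
  let k := Num.truncn (psi h rho (1 + eps) n - c0) in
  [/\ (k <= n)%N, k%:R + c0 <= psi h rho (1 + eps) n, M <= k%:R &
      expR ((1 + eps / 2) * A k - k%:R * h) <= (n%:R * L n ^+ 2)^-1].
Proof.
move=> eps0 c00; pose s := 1 + eps; pose d := eps / 4 / (1 + eps / 2).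
have s0 : 0 < s by rewrite /s; lra.
have e2 : 0 < 1 + eps / 2 by lra.
have d0 : 0 < d by rewrite !divr_gt0.
have dE : (1 + eps / 2) * (1 + d) = 1 + 3 * eps / 4 by rewrite /d mulrDr mulr1 [X in _ + X]mulrC divfK ?gt_eqF//; lra.
have a0 : 0 < 2 * (rho / h) by rewrite mulr_gt0// divr_gt0.
have [x1 [_ h1]] := sqrt_lnln_le a0 (divr_gt0 d0 s0).
have d1h : 0 < (1 + d) / h by rewrite divr_gt0//; lra.
have [x2 [_ h2]] := lnln_le_scale d1h d0.
have [x3 [_ h3]] := mul_ln_le_sqrt_lnln (4 / eps * (2 + h * (c0 + 1))) a0.
have [x4 [_ h4]] := mul_ln_le_sqrt ((1 + d) / h).
have [N1 hN1] := nat_ln_ge x1; have [N2 hN2] := nat_ln_ge x2; have [N3 hN3] := nat_ln_ge x3.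
have [N4 hN4] := nat_ge x4; have [N5 hN5] := nat_ln_ge (h * (`|M| + c0 + 1)).
have [N6 hN6] := nat_ln_ge (expR (1 + 1) : R).
exists (maxn 1 (maxn N1 (maxn N2 (maxn N3 (maxn N4 (maxn N5 N6)))))) => n; rewrite !geq_max.
move=> /and5P[n1 /hN1 yx1 /hN2 yx2 /hN3 yx3 /and3P[/hN4 hn4 /hN5 yM /hN6 ye]].
pose y := L n; pose G := g n; pose l := ln (ln y).
have ee : 0 < expR (1 + 1) :> R by exact: expR_gt0.
have y0 : 0 < y by exact: lt_le_trans ee ye.
have ly : 1 + 1 <= ln y by rewrite -[leLHS]expRK ler_ln ?posrE.
have ly1 : 1 < ln y by lra.
have n0 : 0 < n%:R :> R by rewrite ltr0n.
have G0 : 0 <= G by exact: sqrtr_ge0.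
have l0 : 0 <= l by rewrite ln_ge0// ltW.
have pE : psi h rho (1 + eps) n = (y + s * G) / h by apply: psiE.
have Gd : s * G <= d * y.
  have := h1 y yx1; rewrite -/l -[X in Num.sqrt X <= _]/(2 * (rho / h) * L n * ln (ln (L n))) -/G.
  by rewrite [d / s * y]mulrAC ler_pdivlMr// mulrC.
have pup : psi h rho (1 + eps) n <= (1 + d) / h * y.
  by rewrite pE [leRHS]mulrAC ler_pM2r ?invr_gt0//; lra.
have plo : y / h <= psi h rho (1 + eps) n.
  by rewrite pE ler_pM2r ?invr_gt0// lerDl mulr_ge0// ltW.
have pM : `|M| + c0 + 1 <= psi h rho (1 + eps) n.
  by apply: le_trans plo; rewrite ler_pdivlMr// mulrC.
have pc0 : 0 <= psi h rho (1 + eps) n - c0 by have := normr_ge0 M; lra.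
have /andP[kle kgt] := truncn_itv pc0; move: kle kgt.
set k := Num.truncn _ => kle; rewrite -natr1 => kgt.
have ky : k%:R <= (1 + d) / h * y by lra.
split.
- rewrite -(ler_nat R); apply: le_trans ky _; apply: le_trans (h4 n%:R hn4) _.
  rewrite -[leRHS](sqr_sqrtr (ltW n0)) expr2 ler_peMl ?sqrtr_ge0//.
  by rewrite -[leLHS]sqrtr1 ler_wsqrtr// ler1n.
- lra.
- have := ler_norm M; lra.
- have Ak : A k <= (1 + d) * G.
    have d1 : 0 <= 1 + d by lra.
    rewrite -[1 + d](ger0_norm d1) -sqrtr_sqr -sqrtrM ?sqr_ge0// ler_wsqrtr//.
    have lk : lnln R k <= (1 + d) * l by apply: (h2 y).
    have -> : (1 + d) ^+ 2 * (2 * (rho / h) * L n * ln (ln (L n))) =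
        2 * rho * ((1 + d) / h * y) * ((1 + d) * l) by rewrite -/y -/l; ring.
    apply: (@le_trans _ _ (2 * rho * k%:R * ((1 + d) * l))).
      by rewrite ler_wpM2l// !mulr_ge0// ltW.
    rewrite ler_wpM2r ?mulr_ge0//; apply: ler_wpM2l => //.
    by rewrite mulr_ge0// ltW.
  have GL : (2 + h * (c0 + 1)) * ln y <= eps / 4 * G.
    have := h3 y yx3; rewrite -[X in _ <= X]/G => h3'.
    rewrite -ler_pdivrMl ?divr_gt0// mulrA; apply: le_trans h3'; rewrite invf_div ler_wpM2r//.
    exact: le_trans ler01 (ltW ly1).
  have hc : 0 <= h * (c0 + 1) by rewrite mulr_ge0 ?(ltW h0)// addr_ge0.
  have hcl : h * (c0 + 1) <= h * (c0 + 1) * ln y by rewrite ler_peMr// ltW.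
  have hk : y + s * G - h * (c0 + 1) <= k%:R * h.
    have : psi h rho (1 + eps) n * h = y + s * G by rewrite pE divfK// gt_eqF.
    have : (psi h rho (1 + eps) n - (c0 + 1)) * h <= k%:R * h by rewrite ler_pM2r//; lra.
    by rewrite mulrBl => ? E; move: E => <-; lra.
  have -> : (n%:R * L n ^+ 2)^-1 = expR (- (y + 2 * ln y)).
    rewrite expRN; have -> : y + 2 * ln y = y + ln y + ln y by ring.
    by rewrite !expRD (lnK (x := y)) ?posrE// /y lnK ?posrE// expr2 mulrA.
  rewrite ler_expR.
  have : (1 + eps / 2) * A k <= (1 + 3 * eps / 4) * G.
    by rewrite -dE -mulrA ler_wpM2l// ltW.
  move: GL hk hcl; rewrite /s; set w := h * (c0 + 1); set u := k%:R * h; set v := (1 + eps / 2) * A k.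
  move=> ? ? ? ?; lra.
Qed.

(** Levels of [A k] in order: [1 - e / 3] for the cylinder measure, [1 - e / 2] for the time
    horizon, [1 - e] for the rate. The first gap makes the expected number of returns large; the
    second leaves [e / 4 * A k], after replacing [g n] by [A k], to absorb [c0]. *)
Lemma lower_rate e s c0 (c : R) : 0 < e <= 1 -> s <= 1 - e -> 0 <= c0 -> 0 < c ->
  exists N, forall k, (N <= k)%N ->
  let J := Num.truncn (expR (k%:R * h - (1 - e / 2) * A k) / k%:R) in
  2 * ln k%:R <= c * (J%:R * expR ((1 - e / 3) * A k - k%:R * h)) /\
  forall n, (k <= n)%N -> (n <= J * k)%N -> psi h rho s n + c0 <= k%:R.
Proof.
move=> /andP[e0 e1] se c00 cp.
have d0 : 0 < e / 4 by rewrite divr_gt0.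
have a0 : 0 < 2 * rho by rewrite mulr_gt0.
have [x1 [_ h1]] := sqrt_lnln_le a0 h0.
have [x2 [_ h2]] := lnln_le_scale h0 d0.
(* The gap [e / 2 - e / 3 = e / 6] times [A k] then exceeds [3 * ln k], so even after division by
   [k] and truncation about [k ^+ 2] is left. *)
have [x3 [_ h3]] := mul_ln_le_sqrt_lnln (18 / e) a0.
have [N1 hN1] := nat_ge x1; have [N2 hN2] := nat_ge x2; have [N3 hN3] := nat_ge x3.
have [N4 hN4] := nat_ge (2 / c); have [N5 hN5] := nat_ln_ge (h * c0).
have [N6 hN6] := nat_ln_ge (expR (1 + 1) : R).
exists (maxn 2 (maxn N1 (maxn N2 (maxn N3 (maxn N4 (maxn N5 N6)))))) => k; rewrite !geq_max.
move=> /and5P[k2 /hN1 kx1 /hN2 kx2 /hN3 kx3 /and3P[/hN4 kc /hN5 hlc k6]] J.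
have k0 : 0 < k%:R :> R by rewrite ltr0n (leq_trans _ k2).
have k1 : 1 <= k%:R :> R by rewrite ler1n (leq_trans _ k2).
set a := A k in J *; have A0 : 0 <= a by exact: sqrtr_ge0.
have Ah : a <= h * k%:R by exact: h1.
have Aln : 18 / e * ln k%:R <= a by exact: h3.
have hA : 4 / e * (h * c0) <= a.
  apply: le_trans Aln; have hc0 : 0 <= h * c0 by rewrite mulr_ge0// ltW.
  by apply: ler_pM => //; [rewrite divr_ge0// ltW|rewrite ler_pM2r ?invr_gt0//; lra].
set E1 := expR (k%:R * h - (1 - e / 2) * a) in J *.
have E10 : 0 < E1 by exact: expR_gt0.
have J0 : 0 <= E1 / k%:R by rewrite divr_ge0 ?(ltW k0)// ltW.
have /andP[Jle Jgt] := truncn_itv J0; rewrite -/J -natr1 in Jle Jgt.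
split.
  set E2 := expR (_ - _); have E20 : 0 < E2 by exact: expR_gt0.
  have E21 : E2 <= 1.
    rewrite -expR0 ler_expR subr_le0 [leRHS]mulrC; apply: le_trans Ah.
    by rewrite ler_piMl//; lra.
  have E12 : k%:R ^+ 3 <= E1 * E2.
    rewrite -expRD -[k%:R in leLHS]lnK ?posrE// -expRM_natl ler_expR.
    have -> : k%:R * h - (1 - e / 2) * a + ((1 - e / 3) * a - k%:R * h) = e / 6 * a by field.
    rewrite -ler_pdivrMl ?divr_gt0// invf_div mulrA; apply: le_trans Aln.
    rewrite le_eqVlt; apply/orP; left; apply/eqP; congr (_ * _).
    by field; rewrite gt_eqF.
  have lnk : ln (k%:R : R) <= k%:R - 1 by exact: ln_le_subr1.
  have k21 : k%:R ^+ 2 - 1 <= J%:R * E2.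
    have : E1 / k%:R * E2 <= (J%:R + 1) * E2 by rewrite ler_pM2r// ltW.
    have : k%:R ^+ 2 <= E1 / k%:R * E2 by rewrite mulrAC ler_pdivlMr// -exprSr.
    by rewrite mulrDl mul1r; set w := J%:R * E2; set v := E1 / _ * _; lra.
  apply: (@le_trans _ _ (c * (k%:R ^+ 2 - 1))); last by rewrite ler_pM2l.
  have -> : c * (k%:R ^+ 2 - 1) = (c * (k%:R + 1)) * (k%:R - 1) by ring.
  apply: (@le_trans _ _ (2 * (k%:R - 1))); first by rewrite ler_pM2l.
  rewrite ler_wpM2r ?subr_ge0//; apply: (@le_trans _ _ (c * k%:R)).
    by rewrite mulrC -ler_pdivrMr.
  by rewrite ler_pM2l// lerDl.
move=> n kn nJ; have n0 : 0 < n%:R :> R by rewrite ltr0n (leq_trans _ kn)// (leq_trans _ k2).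
pose y := L n.
have yk : y <= k%:R * h - (1 - e / 2) * a.
  rewrite /y -[leRHS]expRK ler_ln ?posrE ?expR_gt0//; apply: le_trans (_ : (J * k)%N%:R <= _).
    by rewrite ler_nat.
  by rewrite natrM -ler_pdivlMr.
have ly : expR (1 + 1) <= y by apply: hN6; exact: leq_trans kn.
have y0 : 0 < y by apply: lt_le_trans ly; exact: expR_gt0.
have lly : 1 + 1 <= ln y by rewrite -[leLHS]expRK ler_ln ?posrE ?expR_gt0.
have lly1 : 1 < ln y by lra.
have l0 : 0 <= ln (ln y) by rewrite ln_ge0// ltW.
have ea : 0 <= (1 - e / 2) * a by rewrite mulr_ge0//; lra.
have ykh : y <= h * k%:R by rewrite mulrC; move: yk ea; set v := (1 - e / 2) * a; lra.
rewrite (@psiE s n lly1) -/y; set G := Num.sqrt _.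
have GA : G <= (1 + e / 4) * a.
  have d1 : 0 <= 1 + e / 4 by lra.
  rewrite -[1 + e / 4](ger0_norm d1) -sqrtr_sqr -sqrtrM ?sqr_ge0// ler_wsqrtr//.
  have lk : ln (ln y) <= (1 + e / 4) * lnln R k by apply: (h2 k%:R).
  have lk0 : 0 <= (1 + e / 4) * lnln R k by exact: le_trans lk.
  apply: (@le_trans _ _ (2 * rho * k%:R * ((1 + e / 4) * lnln R k))).
    have -> : 2 * (rho / h) * y * ln (ln y) = 2 * rho * (y / h) * ln (ln y) by ring.
    apply: ler_pM => //; first by rewrite mulr_ge0 ?(ltW a0)// divr_ge0// ltW.
    by rewrite ler_pM2l// ler_pdivrMr// mulrC.
  have -> : (1 + e / 4) ^+ 2 * (2 * rho * k%:R * lnln R k) =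
    (1 + e / 4) * (2 * rho * k%:R * ((1 + e / 4) * lnln R k)) by ring.
  rewrite ler_peMl//; last by lra.
  by rewrite mulr_ge0// mulr_ge0 ?ltW.
have G0 : 0 <= G by exact: sqrtr_ge0.
have sG : s * G <= (1 - 3 * e / 4) * a.
  apply: (@le_trans _ _ ((1 - e) * G)); first by rewrite ler_wpM2r.
  apply: (@le_trans _ _ ((1 - e) * ((1 + e / 4) * a))).
    by rewrite ler_wpM2l// subr_ge0.
  rewrite mulrA ler_wpM2r//; have := sqr_ge0 e; rewrite expr2 => ?; lra.
have hc : h * c0 <= e / 4 * a by rewrite -ler_pdivrMl ?divr_gt0// invf_div.
have -> : (y + s * G) / h + c0 = (y + s * G + h * c0) / h by field; rewrite gt_eqF.
rewrite ler_pdivrMr//; move: yk sG hc; set u := k%:R * h; set v := s * G; set w := h * c0.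
by move=> *; lra.
Qed.

End recurrence_rate.

(** * Probabilities of early and missing returns *)

Section return_probabilities.
Variables (R : realType) (m : nat) (mu : probability (SigMeas m) R).
Variables (f : Sig m -> R) (pr C h K : R) (F : nat -> Sig m -> R).
Hypothesis gib : gibbs_bound mu f pr C.
Hypothesis Fagree : forall n i j, agree i j n -> F n i = F n j.
Hypothesis K0 : 0 < K.
Hypothesis local : forall n i,
  K^-1 * expR (F n i - n%:R * h) <= Pr mu (pcyl i n) <= K * expR (F n i - n%:R * h).
Implicit Types (b : R) (n k J : nat).
Local Notation P := (Pr mu).
Local Notation s := (@shift m).

Let C0 : 0 < C. Proof. by case: gib => /(lt_trans ltr01). Qed.

Definition early_return n k b : set (Sig m) :=
  \big[setU/set0]_(w : k.-tuple 'I_m.+1 | F k (pt w) < b) (cyl w `&` iter n s @^-1` cyl w).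

(** No return at the times [k], ..., [J * k]: the index shift [j.+1] places the first test where the
    prefix [w] ends, and multiples of [k] keep the tests disjoint. *)
Definition late_return k J b : set (Sig m) :=
  \big[setU/set0]_(w : k.-tuple 'I_m.+1 | b <= F k (pt w))
    missing (cyl w) (fun=> cyl w) (fun j => j.+1 * k)%N J.

Let measurable_miss k (w : k.-tuple 'I_m.+1) J :
  measurable (missing (cyl w) (fun=> cyl w) (fun j => j.+1 * k)%N J : set (SigMeas m)).
Proof.
apply: (@measurable_cylset _ (J.+1 * k)).
apply: (@cylset_missing _ _ _ (fun j => j.+1 * k)%N (fun=> k)) => [|j|j].
- by rewrite mul1n; exact: cylset_cyl.
- exact: cylset_cyl.
- by rewrite [leqRHS]mulSn addnC.
Qed.

Let measurable_ret k n (w : k.-tuple 'I_m.+1) :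
  measurable (cyl w `&` iter n s @^-1` cyl w : set (SigMeas m)).
Proof.
apply: measurableI; first exact: measurable_cyl.
by apply: measurable_preimage_iter; [exact: measurable_shift|exact: measurable_cyl].
Qed.

Lemma measurable_early_return n k b : measurable (early_return n k b : set (SigMeas m)).
Proof. by apply: bigsetU_measurable => w _; exact: measurable_ret. Qed.

Lemma measurable_late_return k J b : measurable (late_return k J b : set (SigMeas m)).
Proof. by apply: bigsetU_measurable => w _; exact: measurable_miss. Qed.

Lemma early_returnP n k b i : agree i (iter n s i) k -> F k i < b -> early_return n k b i.
Proof.
move=> hi Fb; have ai := @agree_word m k i.
rewrite /early_return (bigD1 (word k i))/=; last by rewrite (Fagree ai).
left; split; first exact/cyl_word.
by rewrite cylE /=; exact: agree_trans ai hi.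
Qed.

Lemma late_returnP k J b i : b <= F k i -> ~ late_return k J b i ->
  exists j, (j < J)%N /\ agree i (iter (j.+1 * k) s i) k.
Proof.
move=> Fb; have ai := @agree_word m k i.
rewrite /late_return (bigD1 (word k i))/=; last by rewrite (Fagree ai).
move=> /not_orP[hm _]; move: hm; elim: J => [|J IH] /=.
  by case; exact/cyl_word.
move=> /not_andP[/IH [j [jJ hj]]|/contrapT hJ].
  by exists j; split => //; exact: ltnW.
exists J; split => //; move: hJ; rewrite /= cylE /= => hJ.
by apply: agree_trans hJ; exact: agree_sym.
Qed.

(** The hypothesis [k <= n] separates the two occurrences of [w], whose joint probability is thus at
    most [C ^+ 3] times the square of [P (cyl w)]. One factor is bounded using [F k (pt w) < b]; the
    other sums to at most one. *)
Lemma Pr_early_return n k b : (k <= n)%N ->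
  P (early_return n k b) <= C ^+ 3 * K * expR (b - k%:R * h).
Proof.
move=> kn; apply: le_trans (Pr_bigsetU_le mu _ _ (fun w => measurable_ret n w)) _.
have C30 : 0 < C ^+ 3 by rewrite exprn_gt0.
apply: (@le_trans _ _ (\sum_(w : k.-tuple 'I_m.+1 | F k (pt w) < b)
    C ^+ 3 * K * expR (b - k%:R * h) * P (cyl w))).
  apply: ler_sum => w wb.
  have /andP[_] := Pr_qb gib (cylset_le kn (@cylset_cyl m k w)) (@cylset_cyl m k w).
  move=> /le_trans; apply; move: (C ^+ 3) C30 => c c0; rewrite -!mulrA ler_pM2l//.
  rewrite [leRHS]mulrA ler_wpM2r ?Pr_ge0// cyl_pcyl.
  have /andP[_ /le_trans] := local k (pt w); apply.
  by rewrite ler_pM2l// ler_expR lerD2r ltW.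
have q0 : 0 <= C ^+ 3 * K * expR (b - k%:R * h) by apply/mulr_ge0/expR_ge0; apply/ltW/mulr_gt0.
rewrite -mulr_sumr -[leRHS]mulr1 ler_wpM2l//.
rewrite -(sum_Pr_cyl mu k) [leRHS](bigID (fun w : k.-tuple 'I_m.+1 => F k (pt w) < b))/= lerDl.
by apply: sumr_ge0 => w _; exact: Pr_ge0.
Qed.

(** [Pr_missing] is applied inside each cylinder and keeps the factor [P (cyl w)], so the sum over
    words costs nothing; each of the [J] tests succeeds with at least the measure of the cylinder,
    up to [C ^- 3]. *)
Lemma Pr_late_return k J b :
  P (late_return k J b) <= expR (- (C ^- 3 * (J%:R * (K^-1 * expR (b - k%:R * h))))).
Proof.
apply: le_trans (Pr_bigsetU_le mu _ _ (fun w => measurable_miss w J)) _.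
set q := expR (- _); have q0 : 0 <= q by exact: expR_ge0.
apply: (@le_trans _ _ (\sum_(w : k.-tuple 'I_m.+1 | b <= F k (pt w)) q * P (cyl w))).
  apply: ler_sum => w wb.
  have h1 : cylset (1 * k) (cyl w) by rewrite mul1n; exact: cylset_cyl.
  apply: le_trans (@Pr_missing _ _ _ _ _ _ gib _ (fun=> cyl w) (fun j => j.+1 * k)%N (fun=> k) h1 _ _ J) _.
  - by move=> j; exact: cylset_cyl.
  - by move=> j; rewrite [leqRHS]mulSn addnC.
  rewrite mulrC ler_wpM2r ?Pr_ge0// ler_expR lerN2 ler_pM2l ?invr_gt0 ?exprn_gt0//.
  rewrite sumr_const card_ord -[leRHS]mulr_natl ler_wpM2l// cyl_pcyl.
  have /andP[/(le_trans _) lo _] := local k (pt w); apply: lo.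
  by rewrite ler_pM2l ?invr_gt0// ler_expR lerD2r.
rewrite -mulr_sumr -[leRHS]mulr1 ler_wpM2l//.
rewrite -(sum_Pr_cyl mu k) [leRHS](bigID (fun w : k.-tuple 'I_m.+1 => b <= F k (pt w)))/= lerDl.
by apply: sumr_ge0 => w _; exact: Pr_ge0.
Qed.

End return_probabilities.

Lemma measure0_ae_not d (T : measurableType d) (R : realType) (mu : probability T R) (S : set T) :
  measurable S -> {ae mu, forall x, ~ S x} -> mu S = 0%E.
Proof.
move=> mS h; apply: (proj1 (negligibleP mu mS)); rewrite -[S]setCK; exact: h.
Qed.

(** * From return estimates to the recurrence sets *)

Section recurrence.
Variables (R : realType) (d m : nat) (phi : 'I_m.+1 -> 'rV[R]_d -> 'rV[R]_d) (r : R).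
Variables (X : set 'rV[R]_d) (mu : probability (SigMeas m) R).
Variables (f : Sig m -> R) (pr C h K rho t0 : R) (F : nat -> Sig m -> R).
Hypothesis hom : homogeneous_IFS phi r.
Hypothesis self : self_similar_set phi X.
Hypothesis ssc : SSC phi X.
Hypothesis gib : gibbs_bound mu f pr C.
Hypothesis aa : almost_additive mu F rho K t0.
Hypothesis local : forall n i,
  K^-1 * expR (F n i - n%:R * h) <= Pr mu (pcyl i n) <= K * expR (F n i - n%:R * h).
Hypothesis h0 : 0 < h.
Local Notation s := (@shift m).
Local Notation A := (lil_scale rho).
Local Notation recurrent t := (coding phi @^-1` Rtilde phi X r (psi h rho t)).

Let r01 : 0 < r < 1. Proof. by case: hom. Qed.
Let r0 : 0 < r. Proof. by case/andP: r01. Qed.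
Let r1 : 0 < r <= 1. Proof. by case/andP: r01 => -> /ltW. Qed.
Let rho0 : 0 < rho. Proof. exact: aa_rho aa. Qed.
Let K0 : 0 < K. Proof. exact: lt_le_trans ltr01 (aa_K aa). Qed.
Let C0 : 0 < C. Proof. by case: gib => /(lt_trans ltr01). Qed.
Let Fagree n i j : agree i j n -> F n i = F n j. Proof. exact: (aa_agree aa). Qed.

Lemma recurrent_null eps : 0 < eps -> mu (recurrent (1 + eps)) = 0%E.
Proof.
move=> eps0; have mS := measurable_recurrence hom self ssc (psi h rho (1 + eps)).
apply: measure0_ae_not => //.
have [e [e0 hge]] := coding_dist_ge hom self ssc.
(* Shortening the prefix by [c0] symbols absorbs the separation constant [e]; halving [e] gives the
   strict inequality that [coding_dist_ge] needs. *)
have [c0 hc0] := expr_small r01 (divr_gt0 e0 (ltr0n R 2)).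
have {}hc0 : r ^+ c0 < e by apply: le_lt_trans (hc0 c0 (leqnn _)) _; lra.
pose k n := Num.truncn (psi h rho (1 + eps) n - c0%:R).
pose b n := (1 + eps / 2) * A (k n).
have [N' hN'] := upper_rate h0 rho0 0 eps0 (ler0n R c0).
pose N := maxn N' 2; have NN' : (N' <= N)%N by exact: leq_maxl.
have N2 : (2 <= N)%N by exact: leq_maxr.
pose E n := early_return F (N + n).+1 (k (N + n).+1) (b (N + n).+1).
have e2 : 0 < eps / 2 by rewrite divr_gt0.
have bc : {ae mu, forall x : SigMeas m, exists M, forall n, (M <= n)%N -> ~ E n x}.
  pose c := C ^+ 3 * K; have c1 : 0 < c by rewrite mulr_gt0// exprn_gt0.
  apply: (@borel_cantelli_ae _ _ _ mu E
    (fun n => c * ((N + n).+1%:R * ln ((N + n).+1%:R) ^+ 2)^-1) (c * (ln N%:R)^-1)) => n.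
  - exact: measurable_early_return.
  - have [kn _ _ hx] := hN' (N + n).+1 (leq_trans NN' (leqW (leq_addr n N))).
    apply: le_trans (Pr_early_return gib K0 local (b (N + n).+1) kn) _.
    by rewrite -/c ler_wpM2l// ltW.
  - by rewrite -mulr_sumr ler_pM2l//; exact: bertrand_series_le.
apply: ae_and_impl bc (lil_upper gib aa e2) _ => x [M1 hM1] [M2 hM2] /(Rtilde_coding hom self ssc) hx.
(* Used a second time with the bound [M2], to push the prefix length [k n] past the point where the
   upper law holds for [x]. *)
have [N3 hN3] := upper_rate h0 rho0 M2%:R eps0 (ler0n R c0).
have [n [Nn hn]] := hx (maxn N3 (N + M1).+1).
move: Nn; rewrite geq_max => /andP[/hN3 [_ kpsi M2k _] Nn].
have nE : n = (N + (n.-1 - N)).+1.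
  by case: n Nn {hn kpsi M2k} => // n; rewrite ltnS => Nn /=; rewrite subnKC// (leq_trans _ Nn)// leq_addr.
have M1n : (M1 <= n.-1 - N)%N by rewrite -(leq_add2l N) -ltnS -nE.
apply: (hM1 _ M1n); rewrite /E -nE; apply: early_returnP => //.
  apply: agree_sym; apply: hge; apply: le_lt_trans hn _.
  apply: (@le_lt_trans _ _ (r ^+ (k n + c0))).
    by rewrite -powR_mulrn ?(ltW r0)// ger_powR// natrD.
  by rewrite exprD mulrC ltr_pM2r// exprn_gt0.
by apply: hM2; rewrite -(ler_nat R).
Qed.

Lemma recurrent_full eps : 0 < eps -> mu (recurrent (1 - eps)) = 1%E.
Proof.
move=> eps0; have mS := measurable_recurrence hom self ssc (psi h rho (1 - eps)).
suff : mu (~` (recurrent (1 - eps))) = 0%E.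
  move=> h1; rewrite -[recurrent _]setCK; have := probability_setC mu (measurableC mS).
  by move=> ->; rewrite h1 sube0.
apply: measure0_ae_not; first exact: measurableC.
(* For [eps > 1] the coefficient [1 - eps] is negative; capping at 1 keeps all levels between 0 and
   1. *)
pose e := Num.min eps 1; have e0 : 0 < e by rewrite lt_min eps0 ltr01.
have e1 : e <= 1 by rewrite ge_min lexx orbT.
have se : 1 - eps <= 1 - e by rewrite lerD2l lerN2 ge_min lexx.
have e01 : 0 < e <= 1 by rewrite e0.
have e3 : 0 < e / 3 < 1 by apply/andP; split; lra.
have [D [D0 hle]] := coding_dist_le hom self.
have D10 : 0 < D^-1 by rewrite invr_gt0.
(* The [c0] extra common symbols compensate the constant [D] in the distance bound. *)
have [c0 hc0] := expr_small r01 D10; have {}hc0 := hc0 c0 (leqnn _).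
have c1 : 0 < C ^- 3 * K^-1 by rewrite mulr_gt0 ?invr_gt0 ?exprn_gt0.
have [N' hN'] := lower_rate h0 rho0 e01 se (ler0n R c0) c1.
pose N := maxn N' 2; have NN' : (N' <= N)%N by exact: leq_maxl.
have N2 : (2 <= N)%N by exact: leq_maxr.
pose J k := Num.truncn (expR (k%:R * h - (1 - e / 2) * A k) / k%:R).
pose b k := (1 - e / 3) * A k.
pose E n := late_return F (N + n) (J (N + n)%N) (b (N + n)%N).
have bc : {ae mu, forall x : SigMeas m, exists M, forall n, (M <= n)%N -> ~ E n x}.
  apply: (@borel_cantelli_ae _ _ _ mu E (fun n => expR (- ((1 + 1) * ln n.+2%:R))) 1^-1) => n.
  - exact: measurable_late_return.
  - have [hx _] := hN' (N + n)%N (leq_trans NN' (leq_addr n N)).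
    apply: le_trans (Pr_late_return gib K0 local _ _ _) _.
    rewrite ler_expR lerN2.
    have assoc (u v w y : R) : u * (v * (w * y)) = u * w * (v * y) by ring.
    rewrite assoc; apply: le_trans hx; rewrite -[1 + 1]/2 ler_pM2l// ler_ln ?posrE ?ltr0n ?addn_gt0 ?(leq_trans _ N2)//.
    by rewrite ler_nat -[n.+2]add2n leq_add2r.
  - exact: p_series_le.
apply: ae_and_impl bc (lil_lower gib aa e3) _ => x [M1 hM1] hx; apply; apply/(Rtilde_coding hom self ssc) => N0.
(* Such [k] exist beyond any bound, and the return time is at least [k], so the returns are
   infinitely many. *)
have [k [Nk Fk]] := hx (maxn N0 (N + M1)).
move: Nk; rewrite geq_max => /andP[N0k Nk].
have kE : k = (N + (k - N))%N by rewrite subnKC// (leq_trans _ Nk)// leq_addr.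
have M1k : (M1 <= k - N)%N by rewrite -(leq_add2l N) -kE.
have := hM1 _ M1k; rewrite /E -kE => /(late_returnP Fagree Fk)[j [jJ hj]].
have k_gt0 : (0 < k)%N by rewrite (leq_trans _ Nk)// (leq_trans _ (leq_addr _ _))// (leq_trans _ N2).
have kj : (k <= j.+1 * k)%N by rewrite leq_pmull.
exists (j.+1 * k)%N; split; first exact: leq_trans kj.
apply: le_trans (hle _ _ _ (agree_sym hj)) _.
have Nk' : (N' <= k)%N by rewrite (leq_trans NN')// (leq_trans _ Nk)// leq_addr.
have [_ hpsi] := hN' k Nk'.
have {}hpsi := hpsi _ kj (leq_mul jJ (leqnn k)).
apply: (@le_trans _ _ (D * (r `^ psi h rho (1 - eps) (j.+1 * k) * r ^+ c0))).
  rewrite ler_pM2l// -!powR_mulrn ?(ltW r0)// -powRD ?(gt_eqF r0) ?implybT//.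
  exact: ger_powR.
rewrite mulrCA ler_piMr ?powR_ge0//.
by rewrite -ler_pdivlMl// mulr1.
Qed.

End recurrence.

(* K = m.+1 maps phi_i, i : 'I_m.+1; pi^* mu (A) = mu (pi^{-1} A). *)
Theorem theorem7p2 (R : realType) (d m : nat)
    (phi : 'I_m.+1 -> 'rV[R]_d -> 'rV[R]_d) (r : R) (X : set 'rV[R]_d)
    (f : Sig m -> R) (mu : probability (SigMeas m) R) :
  homogeneous_IFS phi r ->
  self_similar_set phi X ->
  SSC phi X ->
  holder f ->
  ~ cohomologous_to_constant f ->
  is_gibbs f mu ->
  forall eps : R, 0 < eps ->
    mu (coding phi @^-1` Rtilde phi X r (psi (entropy mu) (asvar f mu) (1 + eps)))
      = 0%E /\
    mu (coding phi @^-1` Rtilde phi X r (psi (entropy mu) (asvar f mu) (1 - eps)))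
      = 1%E.
Proof.
move=> hom self ssc hf ncoh gibbs eps eps0.
have [F [K [t0 [C [h0 gib aa _ local]]]]] := gibbs_birkhoff_sums hf ncoh gibbs.
split; first exact: (recurrent_null hom self ssc gib aa local h0 eps0).
exact: (recurrent_full hom self ssc gib aa local h0 eps0).
Qed.
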